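(* Assume $f\in\mathbb L^\infty(\mathbb S^1)$ and Assumption (A). Let $\kappa>32$, define for $m\in\mathcal M_n$ \[ \widehat{\mathrm{pen}}(m)=\kappa\,\frac{\|\hat G_m^{-1}\|_{op}}{2\pi}\,\frac{D_m}{n}, \] $\hat m^*=\arg\min_{m\in\mathcal M_n}\big(\zeta(\mathring f_m)+\widehat{\mathrm{pen}}(m)\big)$, and $\tilde f_{\hat m^*}=\mathring f_{\hat m^*}\mathbf 1\{\|\mathring f_{\hat m^*}\|_2^2\le n^2\}$. Then \[ \mathbb E\|\tilde f_{\hat m^*}-f\|_2^2\ \le\ K(\sigma_0)\inf_{m\in\mathcal M_n}\Big(\|f-f_m\|_2^2+\kappa\frac{D_m}{n}\Big)+\frac{\tilde K(\sigma_0,\|f\|_\infty)}{n}, \] where $f_m$ is the $\mathbb L^2$-orthogonal projection of $f$ onto $S_m$, $K(\sigma_0)$ depends only on $\sigma_0$ (and the fixed $\kappa$) and $\tilde K$ only on $\sigma_0,\|f\|_\infty$ (and the fixed $\kappa$).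
   Context: Circle convention: $\mathbb S^1\cong[0,2\pi)$, anticlockwise orientation; $[x,y]$ is the usual interval if $x\le y$ and $[x,2\pi)\cup[0,y]$ if $x>y$. Model: $X$ has density $f$ on $\mathbb S^1$; $(L,U)$ random pair in $(\mathbb S^1)^2$ independent of $X$ with $L\ne U$ a.s.; $(X_i,L_i,U_i)_{i\le n}$ i.i.d. copies; $\Delta_i=\mathbf 1\{X_i\in[L_i,U_i]\}$, $X_i'=X_i$ if $\Delta_i=1$ and $-\pi$ otherwise. $\sigma(x)=\mathbb P(x\in[L,U])$. Assumption (A): there is $\sigma_0>0$ with $\sigma\ge\sigma_0$ on $\mathbb S^1$. Trigonometric basis $\varphi_0=1/\sqrt{2\pi}$, $\varphi_{2j-1}=\pi^{-1/2}\cos(j\cdot)$, $\varphi_{2j}=\pi^{-1/2}\sin(j\cdot)$; $\mathcal M_n=\{1,\dots,\lfloor n/2\rfloor-1\}$; $\Lambda_m=\{0,\dots,2m\}$, $S_m=\mathrm{span}\{\varphi_\lambda:\lambda\in\Lambda_m\}$, $D_m=2m+1$. $\hat G_m$: $(\hat G_m)_{\lambda\lambda'}=\frac1n\sum_i\int_{[L_i,U_i]}\varphi_\lambda\varphi_{\lambda'}$ (a.s. invertible). $\|M\|_{op}$ is the square root of the largest eigenvalue of $M^TM$. $\hat U_m=(\frac1n\sum_i\Delta_i\varphi_\lambda(X_i))_\lambda$. Contrast $\zeta(t)=\frac1n\sum_{i=1}^n\big(\int_{\mathbb S^1}t^2(x)\mathbf 1\{x\in[L_i,U_i]\}dx-2\Delta_i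 t(X_i')\big)$; $\mathring f_m=\arg\min_{t\in S_m}\zeta(t)=\sum_\lambda\hat a_\lambda\varphi_\lambda$ with $(\hat a_\lambda)=\hat G_m^{-1}\hat U_m$. *)

(* Defs.v *)
From HB Require Import structures.
From mathcomp Require Import all_boot all_order all_algebra.
From mathcomp Require Import all_classical all_reals all_analysis ess_sup_inf.
Set Implicit Arguments. Unset Strict Implicit. Unset Printing Implicit Defensive.
Import Order.TTheory GRing.Theory Num.Theory Num.Def.
Import numFieldNormedType.Exports.
Local Open Scope classical_set_scope.
Local Open Scope ring_scope.

Section defs.
Variable R : realType.

(* The circle S^1 is identified with [0, 2pi). *)
Definition circ : set R := `[0, pi *+ 2[%classic.

(* Anticlockwise arc [x, y] on the circle. *)
Definition arc (x y : R) : set R :=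
  if x <= y then `[x, y]%classic else (`[x, pi *+ 2[ `|` `[0, y])%classic.

Definition phi (k : nat) (x : R) : R :=
  if k == 0%N then (Num.sqrt (pi *+ 2))^-1
  else if odd k then cos ((k.+1./2)%:R * x) / Num.sqrt pi
  else sin ((k./2)%:R * x) / Num.sqrt pi.

Definition leb := (@lebesgue_measure R).

Definition Icirc (g : R -> R) : R := Rintegral leb circ g.
Definition L2sq (g : R -> R) : R := Icirc (fun x => g x ^+ 2).

Definition Mn (n : nat) : set nat := [set m | (1 <= m)%N /\ (m <= n./2 - 1)%N].

Definition Dm (m : nat) : nat := m.*2.+1.

Definition Delta (X L U : nat -> R) (i : nat) : R :=
  if `[< arc (L i) (U i) (X i) >] then 1 else 0.
Definition Xprime (X L U : nat -> R) (i : nat) : R :=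
  if `[< arc (L i) (U i) (X i) >] then X i else - pi.

Definition Ghat (n : nat) (L U : nat -> R) (m : nat) : 'M[R]_(Dm m) :=
  \matrix_(a < Dm m, b < Dm m)
    (n%:R^-1 * \sum_(i < n) Rintegral leb (arc (L i) (U i))
                                (fun x => phi a x * phi b x)).

Definition Uhat (n : nat) (X L U : nat -> R) (m : nat) : 'cV[R]_(Dm m) :=
  \col_(a < Dm m) (n%:R^-1 * \sum_(i < n) Delta X L U i * phi a (X i)).

Definition opnorm (k : nat) (M : 'M[R]_k) : R :=
  Num.sqrt (sup [set a : R | eigenvalue (M^T *m M) a]).

(* the minimum contrast estimator on S_m *)
Definition fcirc (n : nat) (X L U : nat -> R) (m : nat) (x : R) : R :=
  let ah := invmx (Ghat n L U m) *m Uhat n X L U m in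
  \sum_(a < Dm m) ah a ord0 * phi a x.

Definition zeta (n : nat) (X L U : nat -> R) (t : R -> R) : R :=
  n%:R^-1 * \sum_(i < n)
    (Rintegral leb (arc (L i) (U i)) (fun x => t x ^+ 2)
     - 2 * Delta X L U i * t (Xprime X L U i)).

Definition pen (kappa : R) (n : nat) (L U : nat -> R) (m : nat) : R :=
  kappa * (opnorm (invmx (Ghat n L U m)) / (pi *+ 2)) * ((Dm m)%:R / n%:R).

Definition crit (kappa : R) (n : nat) (X L U : nat -> R) (m : nat) : R :=
  zeta n X L U (fcirc n X L U m) + pen kappa n L U m.

Definition ftilde (n : nat) (X L U : nat -> R) (m : nat) (x : R) : R :=
  if L2sq (fcirc n X L U m) <= n%:R ^+ 2 then fcirc n X L U m x else 0.

(* L2-orthogonal projection of f onto S_m (orthonormal basis expansion) *)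
Definition fproj (f : R -> R) (m : nat) (x : R) : R :=
  \sum_(a < Dm m) Icirc (fun y => f y * phi a y) * phi a x.

(* sigma(x) = P(x in [L, U]) where nu is the law of (L, U) *)
Definition sigma (nu : {measure set (R * R)%type -> \bar R}) (x : R) : \bar R :=
  nu [set p | arc p.1 p.2 x].

Definition supnorm (f : R -> R) : \bar R :=
  ess_sup leb (fun x => (if `[< circ x >] then `|f x| else 0)%:E).

End defs.
Arguments leb {R}.
Arguments circ {R}.

(* Main.v *)
Require Import Defs.
From HB Require Import structures.
From mathcomp Require Import all_boot all_order all_algebra.
From mathcomp Require Import all_classical all_reals all_analysis ess_sup_inf.
From mathcomp Require Import measurable_realfun ring lra zify.
Import Order.TTheory GRing.Theory Num.Theory Num.Def.
Import numFieldNormedType.Exports.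
Local Open Scope classical_set_scope.
Local Open Scope ring_scope.
Set Implicit Arguments. Unset Strict Implicit. Unset Printing Implicit Defensive.

(** On the event where every point of the circle is covered by at least [s n] of the
    [n] arcs, [s = sigma0 / 2], the contrast is a norm equivalent to the [L^2] norm on all
    [S_m] and the classical comparison of [crit] at [mhat] and at [m] bounds the loss by the
    bias, the penalty at [m], and the excess over [8 D_m / (2 pi n)] of
    [chi^2_m = sum_(a < D_m) nu_n(phi_a)^2], where [nu_n] is the noise centred
    conditionally on the arcs.

    No Talagrand inequality is needed for this excess. Since [chi^2_m] increases with [m],
    only [m = 2^j] matter. With [xi_i] the centred vectors, [n^2 chi^2_m] is the
    deterministically bounded diagonal [sum_i |xi_i|^2] plus twice the martingale
    [M = sum_(i < k) <xi_i, xi_k>], whose increments are controlled by the weak variance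
    [|f|_oo]; a recursion on the fourth moment gives [E M^4 <= C n^4 D_m^2], so that the
    excess at [2^j] is [O(1 / (n 2^j))] on average.

    The complement of the good event is covered by a number of Bernoulli deviations that
    depends only on [sigma0]: the circle is cut at quantiles of the law of the two end
    points, so that, up to a small mass, an arc contains all of a cell or none of it.
    Hoeffding's bound beats the crude bound [O(n^2)] on the truncated estimator. *)

(** Why the fourth moment: the excess of [u = 2 M / n^2] over a level [h] is at most
    [u^p / h^(p-1)]. With [h] of order [D_m / n] and [E M^2] of order [n^2 D_m], the choice [p = 2]
    gives [1 / n] at every dyadic level and loses a logarithm in the sum; [p = 4] gains the factor
    [1 / D_m]. The threshold on [kappa] is free of [sigma0] because the noise over [S_m] is compared
    with the contrast norm through the same random operator norm that sits in the penalty; [sigma0]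
    enters only when the penalty at [m] and the excess are bounded. The law of the end points may
    have atoms, and coverage is required at uncountably many points. The cells are therefore open,
    which controls their mass, and each quantile is treated as a single point. The quantities whose
    moments are computed are bounded and measurable, so integrability is automatic. A density that
    is only essentially bounded is replaced by its minimum with [|f|_oo], which equals it almost
    everywhere. *)

Local Notation arc := Defs.arc.

(** * Quadratic forms and the operator norm of an inverse *)

Section quadratic_forms.
Variable R : realType.

Definition dot k (a b : 'cV[R]_k) : R := \sum_i a i ord0 * b i ord0.

Lemma dotE k (a b : 'cV[R]_k) : dot a b = (a^T *m b) ord0 ord0.
Proof. by rewrite mxE; apply: eq_bigr => i _; rewrite mxE. Qed.

Lemma dotC k (a b : 'cV[R]_k) : dot a b = dot b a.
Proof. by apply: eq_bigr => i _; rewrite mulrC. Qed.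

Lemma dotDl k (a b c : 'cV[R]_k) : dot (a + b) c = dot a c + dot b c.
Proof. by rewrite -big_split; apply: eq_bigr => i _; rewrite mxE mulrDl. Qed.

Lemma dotZl k t (a c : 'cV[R]_k) : dot (t *: a) c = t * dot a c.
Proof. by rewrite mulr_sumr; apply: eq_bigr => i _; rewrite mxE mulrA. Qed.

Lemma dotDr k (a b c : 'cV[R]_k) : dot c (a + b) = dot c a + dot c b.
Proof. by rewrite dotC dotDl !(dotC c). Qed.

Lemma dotZr k t (a c : 'cV[R]_k) : dot c (t *: a) = t * dot c a.
Proof. by rewrite dotC dotZl dotC. Qed.

Lemma dot_ge0 k (a : 'cV[R]_k) : 0 <= dot a a.
Proof. by apply: sumr_ge0 => i _; rewrite -expr2 sqr_ge0. Qed.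

Lemma dot_eq0 k (a : 'cV[R]_k) : dot a a = 0 -> a = 0.
Proof.
move=> /eqP; rewrite psumr_eq0; last by move=> i _; rewrite -expr2 sqr_ge0.
move=> /allP h; apply/matrixP => i j; rewrite (ord1 j) mxE.
by have := h i (mem_index_enum _); rewrite /= -expr2 sqrf_eq0 => /eqP.
Qed.

Lemma dot_gt0 k (a : 'cV[R]_k) : a != 0 -> 0 < dot a a.
Proof.
move=> a0; rewrite lt_neqAle dot_ge0 andbT eq_sym.
by apply: contra a0 => /eqP/dot_eq0 ->.
Qed.

Lemma dot_mulmxr k (G : 'M[R]_k) (a b : 'cV[R]_k) :
  dot a (G *m b) = dot (G^T *m a) b.
Proof. by rewrite !dotE trmx_mul trmxK mulmxA. Qed.

(** Shared by the Cauchy-Schwarz inequalities for semidefinite matrices and for integrals on the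
    circle. Both forms can be degenerate, hence the separate case [s = 0]. *)
Lemma discriminant_le0 (p r s : R) : 0 <= p -> 0 <= s ->
  (forall t, 0 <= p + t * r *+ 2 + t ^+ 2 * s) -> r ^+ 2 <= p * s.
Proof.
move=> p0 s0 h; have [s_eq0|s_neq0] := eqVneq s 0.
  rewrite s_eq0 mulr0 (_ : r = 0) ?expr0n //.
  apply/eqP; apply: contraT => r0.
  (* For [s = 0] the form is affine in [t], and this [t] gives it the value -1. *)
  have := h (- (p + 1) / (r *+ 2)); rewrite s_eq0 mulr0 addr0.
  have -> : p + - (p + 1) / (r *+ 2) * r *+ 2 = -1 by field.
  by lra.
have sp : 0 < s by rewrite lt_neqAle eq_sym s_neq0.
(* The minimiser of the quadratic in [t]. *)
have := h (- r / s).
have -> : p + - r / s * r *+ 2 + (- r / s) ^+ 2 * s = (p * s - r ^+ 2) / s by field.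
by rewrite pmulr_lge0 ?invr_gt0// subr_ge0.
Qed.

Lemma psd_cauchy_schwarz k (G : 'M[R]_k) (a b : 'cV[R]_k) :
  G^T = G -> (forall c, 0 <= dot c (G *m c)) ->
  dot a (G *m b) ^+ 2 <= dot a (G *m a) * dot b (G *m b).
Proof.
move=> Gs G0; apply: discriminant_le0 => // t.
have := G0 (a + t *: b).
rewrite mulmxDr -scalemxAr !dotDr !dotDl !dotZr !dotZl.
have -> : dot b (G *m a) = dot a (G *m b) by rewrite dot_mulmxr Gs dotC.
by rewrite !mulrA -expr2 => h; apply: le_trans h _; rewrite le_eqVlt; apply/orP; left; apply/eqP; ring.
Qed.

Lemma dot_cauchy_schwarz k (a b : 'cV[R]_k) : dot a b ^+ 2 <= dot a a * dot b b.
Proof.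
have := @psd_cauchy_schwarz k 1%:M a b (trmx1 _ _).
by rewrite !mul1mx; apply => c; rewrite mul1mx dot_ge0.
Qed.

(** Only the finiteness of the constant matters: it is applied to the inverse in the argument by
    contradiction for the smallest eigenvalue. *)
Lemma dot_mulmx_bound k (G : 'M[R]_k) :
  exists2 C, 0 <= C & forall a, dot a (G *m a) <= C * dot a a.
Proof.
exists (\sum_i \sum_j `|G i j|); first by apply: sumr_ge0 => i _; apply: sumr_ge0.
move=> a; rewrite /dot mulr_suml ler_sum// => i _.
rewrite mxE mulr_sumr mulr_suml ler_sum// => j _.
have le1 l : a l ord0 ^+ 2 <= dot a a.
  rewrite /dot (bigD1 l)//= -expr2 lerDl sumr_ge0// => j' _.
  by rewrite -expr2 sqr_ge0.
have h : `|a i ord0 * a j ord0| <= dot a a.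
  rewrite normrM.
  have := le1 i; have := le1 j; rewrite -(real_normK (num_real (a i ord0))).
  rewrite -(real_normK (num_real (a j ord0))).
  move: `|a i ord0| `|a j ord0| (normr_ge0 (a i ord0)) (normr_ge0 (a j ord0)) => x y.
  by move=> *; nra.
rewrite mulrCA; apply: le_trans (ler_norm _) _; rewrite normrM.
by rewrite ler_wpM2l.
Qed.

(* The infimum [l] of the Rayleigh quotient is an eigenvalue: were [G - l] invertible,
   Cauchy-Schwarz for the form [G - l] would bound it away from 0. *)
Lemma rayleigh_eigenvalue k (G : 'M[R]_k.+1) : G^T = G ->
  (forall a, 0 <= dot a (G *m a)) ->
  exists2 l, eigenvalue G l & forall a, l * dot a a <= dot a (G *m a).
Proof.
move=> Gs G0.
pose S := [set l : R | forall a, l * dot a a <= dot a (G *m a)].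
have S0 : S 0 by move=> a; rewrite mul0r.
pose e : 'cV[R]_k.+1 := const_mx 1.
have e_neq0 : e != 0.
  by apply/eqP => /matrixP/(_ ord0 ord0)/eqP; rewrite !mxE oner_eq0.
have supS : has_sup S.
  split; first by exists 0.
  exists (dot e (G *m e) / dot e e) => l /(_ e).
  by rewrite ler_pdivlMr// dot_gt0.
pose l := sup S.
have Sl : S l.
  move=> a; have [->|a0] := eqVneq a 0.
    by rewrite mulmx0 /dot !big1 ?mulr0// => i _; rewrite mxE mul0r.
  rewrite -ler_pdivlMr ?dot_gt0//; apply: ge_sup; first by exists 0.
  by move=> t /(_ a); rewrite -ler_pdivlMr ?dot_gt0.
exists l => //.
pose B := G - l%:M.
have Bs : B^T = B by rewrite /B linearB /= Gs tr_scalar_mx.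
have BE a : dot a (B *m a) = dot a (G *m a) - l * dot a a.
  by rewrite /B mulmxBl mul_scalar_mx dotDr -scaleN1r dotZr mulN1r dotZr.
have B0 a : 0 <= dot a (B *m a) by rewrite BE subr_ge0 Sl.
rewrite /eigenvalue /eigenspace kermx_eq0 row_free_unit -/B.
apply/negP => Bu.
have [C C0 hC] := dot_mulmx_bound (invmx B).
(* Cauchy-Schwarz for [B] at [a] and [invmx B *m a] gives [|a|^4 <= (a, B a) (a, B^-1 a) <= (a, B a)
   C |a|^2]. Hence [l + 1 / (C + 1)] would still be a lower bound of the Rayleigh quotient; the 1
   added to [C] keeps the denominator positive. *)
have key a : dot a a <= (C + 1) * dot a (B *m a).
  have := psd_cauchy_schwarz a (invmx B *m a) Bs B0.
  rewrite mulKVmx// [dot (invmx B *m a) a]dotC.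
  have := hC a; have := B0 a; have := dot_ge0 a.
  move: (dot a a) (dot a (invmx B *m a)) (dot a (B *m a)) => x y z x0 z0 yx xyz.
  have [->|xn] := eqVneq x 0; first by rewrite mulr_ge0// addr_ge0.
  have xp : 0 < x by rewrite lt_neqAle eq_sym xn.
  have : x ^+ 2 <= x * ((C + 1) * z) by nra.
  by rewrite expr2 ler_pM2l.
have : S (l + (C + 1)^-1).
  move=> a; rewrite mulrDl -lerBrDl -BE ler_pdivrMl ?ltr_wpDl//.
move=> /(ub_le_sup supS.2); rewrite -/l gerDl invr_le0.
by apply/negP; rewrite -ltNge ltr_wpDl.
Qed.

(** * Inverse of a coercive symmetric matrix *)

Section opnorm_inverse.
Variables (k : nat) (G : 'M[R]_k.+1) (c : R).
Hypotheses (Gs : G^T = G) (c0 : 0 < c) (Gc : forall a, c * dot a a <= dot a (G *m a)).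

Lemma coercive_unitmx : G \in unitmx.
Proof.
rewrite -row_free_unit -kermx_eq0; apply: contraT => /rowV0Pn[v].
move=> /sub_kermxP vG v0.
have GvE : G *m v^T = 0 by rewrite -{1}Gs -trmx_mul vG trmx0.
have := Gc v^T; rewrite GvE {2}/dot big1; last by move=> i _; rewrite [X in _ * X]mxE mulr0.
have : 0 < dot v^T v^T by apply: dot_gt0; rewrite trmx_eq0.
by move=> h; rewrite -(pmulr_rgt0 _ c0) in h; rewrite leNgt h.
Qed.

Let Gu := coercive_unitmx.

Lemma invmx_sym : (invmx G)^T = invmx G.
Proof. by rewrite trmx_inv Gs. Qed.

(** Coercivity and Cauchy-Schwarz give [c |w| <= |G w|]; taking [w = G^-1 v] for an eigenvector [v]
    bounds the eigenvalue [|w|^2 / |v|^2]. *)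
Lemma eigenvalue_inv_sqr_le a :
  eigenvalue ((invmx G)^T *m invmx G) a -> a <= c^-1 ^+ 2.
Proof.
rewrite invmx_sym => /eigenvalueP[v vE v0].
pose w := invmx G *m v^T.
have vw : v^T = G *m w by rewrite /w mulKVmx.
have aE : a * dot v^T v^T = dot w w.
  rewrite -dotZr -linearZ /= -vE !trmx_mul invmx_sym -mulmxA dot_mulmxr invmx_sym.
  by rewrite -/w.
have vv : 0 < dot v^T v^T by apply: dot_gt0; rewrite trmx_eq0.
have := Gc w; rewrite -vw => h1.
have := dot_cauchy_schwarz w v^T => h2; have := dot_ge0 w => h3.
have h4 : c ^+ 2 * dot w w <= dot v^T v^T.
  move: h1 h2 h3 vv; move: (dot w w) (dot w v^T) (dot v^T v^T) => x y z h1 h2 h3 vv.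
  have [->|xn] := eqVneq x 0; first by rewrite mulr0 ltW.
  have xp : 0 < x by rewrite lt_neqAle eq_sym xn.
  rewrite -(ler_pM2l xp); apply: le_trans h2.
  have -> : x * (c ^+ 2 * x) = (c * x) ^+ 2 by ring.
  by rewrite ler_sqr ?nnegrE// ?mulr_ge0 ?(ltW c0)//; apply: le_trans h1; rewrite mulr_ge0 ?(ltW c0).
rewrite -(ler_pM2r vv) aE exprVn ler_pdivlMl ?exprn_gt0//.
Qed.

(** The smallest eigenvalue [l] of [G] yields the eigenvalue [l^-1 ^+ 2] of the squared inverse, so
    [l^-1 <= opnorm]. The eigenvalues being bounded, the supremum in [opnorm] does dominate it. *)
Lemma opnorm_invmx_ge_rayleigh a : dot a a <= opnorm (invmx G) * dot a (G *m a).
Proof.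
have [l /eigenvalueP[v vE v0] hl] := rayleigh_eigenvalue Gs
  (fun a => le_trans (mulr_ge0 (ltW c0) (dot_ge0 a)) (Gc a)).
have vv : 0 < dot v^T v^T by apply: dot_gt0; rewrite trmx_eq0.
have GvE : G *m v^T = l *: v^T by rewrite -{1}Gs -trmx_mul vE linearZ.
have lc : c <= l.
  have := Gc v^T; rewrite GvE dotZr.
  by rewrite ler_pM2r.
have l0 : 0 < l by exact: lt_le_trans lc.
have ivE : v *m invmx G = l^-1 *: v.
  rewrite -{1}(scale1r v) -(mulVf (lt0r_neq0 l0)) -scalerA -vE -scalemxAl.
  by rewrite mulmxK.
have lsup : l^-1 <= opnorm (invmx G).
  rewrite /opnorm -{1}(ger0_norm (x := l^-1)) ?invr_ge0 ?(ltW l0)// -sqrtr_sqr ler_wsqrtr//.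
  apply: ub_le_sup; first by exists (c^-1 ^+ 2) => x; exact: eigenvalue_inv_sqr_le.
  apply/eigenvalueP; exists v => //.
  by rewrite invmx_sym mulmxA ivE -scalemxAl ivE scalerA expr2.
have := hl a => h.
have : dot a a <= l^-1 * dot a (G *m a) by rewrite ler_pdivlMl.
move=> /le_trans; apply; rewrite ler_wpM2r//.
by apply: le_trans (Gc a); rewrite mulr_ge0 ?(ltW c0) ?dot_ge0.
Qed.

Lemma opnorm_invmx_le : opnorm (invmx G) <= c^-1.
Proof.
rewrite /opnorm -(ger0_norm (x := c^-1)) ?invr_ge0 ?(ltW c0)// -sqrtr_sqr ler_wsqrtr//.
have [[x hx]|h] := pselect ([set a | eigenvalue ((invmx G)^T *m invmx G) a] !=set0).
  apply: ge_sup; first by exists x.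
  by move=> y; exact: eigenvalue_inv_sqr_le.
(* The supremum of the empty set is 0 by convention. *)
rewrite (_ : [set a | _] = set0) ?sup0 ?sqr_ge0//.
by apply/seteqP; split => // y hy; case: h; exists y.
Qed.

End opnorm_inverse.
End quadratic_forms.

(** * Bounded measurable functions *)

Section bounded_measurable.
Context {R : realType} {d : measure_display} {T : measurableType d}.
Implicit Types g h : T -> R.

(** This class is closed under every operation used below and integrable for finite measures, so
    linearity of the integral carries no integrability conditions. *)
Definition bdm g := measurable_fun setT g /\ exists C, forall x, `|g x| <= C.

Lemma bdm_cst (c : R) : bdm (fun=> c).
Proof. by split => //; exists `|c|. Qed.

Lemma bdmD g h : bdm g -> bdm h -> bdm (fun x => g x + h x).
Proof.
move=> [mg [C gC]] [mh [D hD]]; split; first exact: measurable_funD.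
by exists (C + D) => x; rewrite (le_trans (ler_normD _ _))// lerD.
Qed.

Lemma bdmM g h : bdm g -> bdm h -> bdm (fun x => g x * h x).
Proof.
move=> [mg [C gC]] [mh [D hD]]; split; first exact: measurable_funM.
by exists (C * D) => x; rewrite normrM ler_pM.
Qed.

Lemma bdmN g : bdm g -> bdm (fun x => - g x).
Proof.
move=> [mg [C gC]]; split; first exact: measurableT_comp.
by exists C => x; rewrite normrN.
Qed.

Lemma bdmB g h : bdm g -> bdm h -> bdm (fun x => g x - h x).
Proof. by move=> bg bh; apply: bdmD => //; exact: bdmN. Qed.

Lemma bdmZ c g : bdm g -> bdm (fun x => c * g x).
Proof. by move=> bg; apply: bdmM => //; exact: bdm_cst. Qed.

Lemma bdmX g k : bdm g -> bdm (fun x => g x ^+ k).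
Proof.
move=> [mg [C gC]]; split; first exact: measurable_funX.
by exists (C ^+ k) => x; rewrite normrX lerXn2r// nnegrE// (le_trans _ (gC x)).
Qed.

Lemma bdm_sum (I : Type) (s : seq I) (g : I -> T -> R) :
  (forall i, bdm (g i)) -> bdm (fun x => \sum_(i <- s) g i x).
Proof.
move=> bg; elim: s => [|i s IH].
  by rewrite (_ : (fun _ => _) = fun=> 0) ?funeqE => [|x]; [exact: bdm_cst|rewrite big_nil].
rewrite (_ : (fun _ => _) = fun x => g i x + \sum_(j <- s) g j x).
  exact: bdmD.
by rewrite funeqE => x; rewrite big_cons.
Qed.

Lemma bdm_prod (I : Type) (s : seq I) (p : pred I) (g : I -> T -> R) :
  (forall i, bdm (g i)) -> bdm (fun x => \prod_(i <- s | p i) g i x).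
Proof.
move=> bg; elim: s => [|i s IH].
  by rewrite (_ : (fun _ => _) = fun=> 1) ?funeqE => [|x]; [exact: bdm_cst|rewrite big_nil].
rewrite (_ : (fun _ => _) =
    if p i then (fun x => g i x * \prod_(j <- s | p j) g j x)
    else (fun x => \prod_(j <- s | p j) g j x)).
  by case: ifP => // _; exact: bdmM.
by rewrite funeqE => x; rewrite big_cons; case: (p i).
Qed.

Lemma bdm_indic (A : set T) : measurable A -> bdm (\1_A : T -> R).
Proof.
move=> mA; split; first exact: measurable_indic.
by exists 1 => x; rewrite indicE; case: (_ \in _); rewrite ?normr1 ?normr0 ?ler01.
Qed.

Section integral.
Variables (mu : {measure set T -> \bar R}) (D : set T).
Hypotheses (mD : measurable D) (muD : (mu D < +oo)%E).

Lemma bdm_integrable g : bdm g -> mu.-integrable D (EFin \o g).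
Proof.
move=> [mg [C gC]]; apply: measurable_bounded_integrable => //.
  exact: measurable_funS mg.
exists C; split; first exact: num_real.
by move=> M CM x _ /=; rewrite (le_trans (gC x))// ltW.
Qed.

Lemma bdm_integralE g : bdm g ->
  (\int[mu]_(x in D) (g x)%:E)%E = (\int[mu]_(x in D) g x)%:E.
Proof.
by move=> bg; rewrite /Rintegral fineK//; exact: (integrable_fin_num mD (bdm_integrable bg)).
Qed.

Lemma bdm_RintegralD g h : bdm g -> bdm h ->
  \int[mu]_(x in D) (g x + h x) = \int[mu]_(x in D) g x + \int[mu]_(x in D) h x.
Proof. by move=> bg bh; apply: RintegralD => //; exact: bdm_integrable. Qed.

Lemma bdm_RintegralB g h : bdm g -> bdm h ->
  \int[mu]_(x in D) (g x - h x) = \int[mu]_(x in D) g x - \int[mu]_(x in D) h x.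
Proof. by move=> bg bh; apply: RintegralB => //; exact: bdm_integrable. Qed.

Lemma bdm_RintegralZ c g : bdm g ->
  \int[mu]_(x in D) (c * g x) = c * \int[mu]_(x in D) g x.
Proof. by move=> bg; apply: RintegralZl => //; exact: bdm_integrable. Qed.

Lemma bdm_Rintegral_sum (I : Type) (s : seq I) (g : I -> T -> R) :
  (forall i, bdm (g i)) ->
  \int[mu]_(x in D) (\sum_(i <- s) g i x) = \sum_(i <- s) \int[mu]_(x in D) g i x.
Proof.
move=> bg; elim: s => [|i s IH].
  rewrite big_nil (@eq_Rintegral _ _ _ mu D (fun=> 0)); last by move=> x _; rewrite big_nil.
  by rewrite Rintegral_cst// mul0r.
rewrite big_cons -IH -bdm_RintegralD//; last exact: bdm_sum.
by apply: eq_Rintegral => x _; rewrite big_cons.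
Qed.

Lemma bdm_le_Rintegral g h : bdm g -> bdm h -> (forall x, D x -> g x <= h x) ->
  \int[mu]_(x in D) g x <= \int[mu]_(x in D) h x.
Proof. by move=> bg bh gh; apply: le_Rintegral => //; exact: bdm_integrable. Qed.

Lemma bdm_Rintegral_abs_le g c : bdm g -> (forall x, D x -> `|g x| <= c) ->
  `|\int[mu]_(x in D) g x| <= fine (mu D) * c.
Proof.
move=> bg gc; apply: le_trans (le_normr_Rintegral mD (bdm_integrable bg)) _.
rewrite mulrC -Rintegral_cst//; apply: bdm_le_Rintegral => //; last exact: bdm_cst.
case: bg => mg [C gC]; split; last by exists C => x; rewrite normr_id.
exact: measurableT_comp.
Qed.

End integral.

(** The sum is the integer part of [y]: a discrete layer-cake formula. *)
Lemma indicator_layer_count (N : nat) (y : R) : 0 <= y <= N%:R ->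
  y - 1 <= \sum_(j < N) ((j.+1)%:R <= y)%R%:R <= y.
Proof.
elim: N => [|N IH] /andP[y0 yN]; first by rewrite big_ord0; lra.
rewrite big_ord_recr /=; have [yN'|yN'] := leP y N%:R.
  have -> : (N.+1%:R <= y)%R = false by apply/negbTE; rewrite -ltNge (le_lt_trans yN')// ltr_nat.
  by rewrite addr0 IH// y0.
have -> : \sum_(i < N) ((i.+1)%:R <= y)%R%:R = N%:R :> R.
  rewrite (eq_bigr (fun=> 1)) ?sumr_const ?card_ord// => i _.
  by rewrite (_ : (_ <= _)%R = true)//; apply: le_trans (ltW yN'); rewrite ler_nat.
have N1 : N.+1%:R = N%:R + 1 :> R by rewrite -natr1.
by rewrite N1 in yN *; case: (leP (N%:R + 1) y) => h /=; apply/andP; split; lra.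
Qed.

(* Bounded measurable functions are uniform limits of combinations of indicators,
   so a bounded linear functional is determined by its values on indicators. *)
Lemma bdm_functional_eq0 (Phi : (T -> R) -> R) :
  (forall g h, bdm g -> bdm h -> Phi (fun x => g x + h x) = Phi g + Phi h) ->
  (forall c g, bdm g -> Phi (fun x => c * g x) = c * Phi g) ->
  (exists K, forall g c, bdm g -> (forall x, `|g x| <= c) -> `|Phi g| <= K * c) ->
  (forall A, measurable A -> Phi \1_A = 0) ->
  forall g, bdm g -> Phi g = 0.
Proof.
move=> PhiD PhiZ [K PhiK] Phi1 g bg.
have Phi_cst c : Phi (fun=> c) = 0.
  have := PhiZ c \1_setT (bdm_indic measurableT); rewrite Phi1// mulr0 => <-.
  by congr Phi; apply/funext => x; rewrite indicE in_setT mulr1.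
have Phi_sum (I : Type) (s : seq I) (h : I -> T -> R) : (forall i, bdm (h i)) ->
    Phi (fun x => \sum_(i <- s) h i x) = \sum_(i <- s) Phi (h i).
  move=> bh; elim: s => [|i s IH].
    by rewrite big_nil -[RHS](Phi_cst 0); congr Phi; apply/funext => x; rewrite big_nil.
  rewrite big_cons -IH -PhiD//; last exact: bdm_sum.
  by congr Phi; apply/funext => x; rewrite big_cons.
have [mg [C gC]] := bg.
pose k0 := `|K|.
(* The shifted range of [g] is cut into slices of height [1 / (k + 1)]. The resulting step function
   stays within one slice of [g + C], and [Phi] vanishes on it and on constants, so only the
   remainder [q] is seen by [Phi]. *)
have key (k : nat) : `|Phi g| <= k0 * k.+1%:R^-1.
  pose h x := k.+1%:R * (g x + C).
  pose N := (Num.trunc (k.+1%:R * (C + C))).+1.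
  have mh : measurable_fun setT h.
    by apply: measurable_funM => //; apply: measurable_funD.
  have hN x : 0 <= h x <= N%:R.
    have := gC x; rewrite ler_norml => /andP[g1 g2]; apply/andP; split.
      by rewrite mulr_ge0//; lra.
    rewrite (@le_trans _ _ (k.+1%:R * (C + C)))//.
      by rewrite ler_wpM2l//; lra.
    exact/ltW/truncnS_gt.
  pose A (j : 'I_N) := [set x | (j.+1)%:R <= h x].
  have mA j : measurable (A j).
    rewrite (_ : A j = h @^-1` `[(j.+1)%:R, +oo[); first by rewrite -[X in measurable X]setTI; exact: mh.
    by apply/seteqP; split => x /=; rewrite in_itv /= andbT.
  pose q x := g x + (C - k.+1%:R^-1 * \sum_(j < N) \1_(A j) x).
  have bA : bdm (fun x => \sum_(j < N) \1_(A j) x).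
    by apply: bdm_sum => j; exact: bdm_indic.
  have -> : Phi g = Phi q.
    rewrite PhiD//; last by apply: bdmB; [exact: bdm_cst|exact: bdmZ].
    rewrite (_ : (fun x => C - _) =
      (fun x => C + - k.+1%:R^-1 * \sum_(j < N) \1_(A j) x)); last first.
      by apply/funext => x; rewrite mulNr.
    rewrite PhiD; [|exact: bdm_cst|exact: bdmZ].
    rewrite PhiZ// Phi_sum; last by move=> j; exact: bdm_indic.
    by rewrite Phi_cst add0r big1 ?mulr0 ?addr0// => j _; exact: Phi1.
  have qb x : `|q x| <= k.+1%:R^-1.
    have := indicator_layer_count (hN x).
    have -> : \sum_(j < N) ((j.+1)%:R <= h x)%R%:R = \sum_(j < N) \1_(A j) x :> R.
      by apply: eq_bigr => j _; rewrite indicE (_ : (x \in A j) = (j.+1%:R <= h x))//; apply/idP/idP; rewrite inE.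
    have -> : q x = k.+1%:R^-1 * (h x - \sum_(j < N) \1_(A j) x).
      by rewrite /q /h mulrBr mulKf ?pnatr_eq0//; ring.
    move=> hs; rewrite normrM ger0_norm ?invr_ge0// ger_pMr ?invr_gt0 ?ltr0n//.
    by rewrite ler_norml; move: hs => /andP[h1 h2]; apply/andP; split; lra.
  apply: le_trans (PhiK q _ _ qb) _.
    by apply: bdmD => //; apply: bdmB; [exact: bdm_cst|exact: bdmZ].
  by rewrite ler_wpM2r ?invr_ge0// ler_norm.
apply/eqP; rewrite -normr_eq0 eq_le normr_ge0 andbT.
apply/ler_addgt0Pr => e e0; rewrite add0r.
pose k := Num.trunc (k0 / e).
apply: le_trans (key k) _; rewrite ler_pdivrMr ?ltr0n// mulrC -ler_pdivrMr//.
exact/ltW/truncnS_gt.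
Qed.

End bounded_measurable.

Lemma bdm_comp {R : realType} d1 d2 (T1 : measurableType d1) (T2 : measurableType d2)
    (Z : T1 -> T2) (g : T2 -> R) :
  measurable_fun setT Z -> bdm g -> bdm (fun w => g (Z w)).
Proof.
move=> mZ [mg [C gC]]; split; last by exists C => w.
exact: measurableT_comp.
Qed.

(** * Independent samples and the fourth moment of a degenerate U-statistic *)

Section independent_sequence.
Context {R : realType} {d dT : measure_display} {Om : measurableType d}
  {T : measurableType dT}.
Variables (P : probability Om R) (n : nat) (Z : nat -> Om -> T).
Hypothesis mZ : forall i, measurable_fun setT (Z i).
Hypothesis indep : forall C : nat -> set T, (forall i, measurable (C i)) ->
  P (\bigcap_(i in `I_n) (Z i @^-1` C i)) = (\prod_(i < n) P (Z i @^-1` C i))%E.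

Local Notation E F := (\int[P]_w F w)%R.

Let Pfin : (P setT < +oo)%E.
Proof. by rewrite probability_setT ltry. Qed.

Let ED := bdm_RintegralD measurableT Pfin.
Let EZ := bdm_RintegralZ measurableT Pfin.
Let Esum := bdm_Rintegral_sum measurableT Pfin.

Lemma bdm_sample (g : T -> R) i : bdm g -> bdm (fun w => g (Z i w)).
Proof. exact: bdm_comp. Qed.

Lemma mean_cst (c : R) : E (fun=> c) = c.
Proof.
transitivity (c * fine (P setT)); first exact: Rintegral_cst.
by rewrite probability_setT mulr1.
Qed.

Lemma mean_le (F G : Om -> R) : bdm F -> bdm G -> (forall w, F w <= G w) ->
  E F <= E G.
Proof. by move=> bF bG FG; apply: bdm_le_Rintegral. Qed.

Lemma mean_norm_le (F : Om -> R) c : bdm F -> (forall w, `|F w| <= c) ->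
  `|E F| <= c.
Proof.
move=> bF Fc; apply: le_trans (bdm_Rintegral_abs_le measurableT Pfin bF (fun w _ => Fc w)) _.
have -> : fine (P setT) = 1 by rewrite probability_setT.
by rewrite mul1r.
Qed.

Lemma mean_indic (A : set Om) : measurable A -> E (\1_A) = fine (P A).
Proof. by move=> mA; rewrite /Rintegral integral_indic// setIT. Qed.

Lemma preimage_measurable i A : measurable A -> measurable (Z i @^-1` A).
Proof. by move=> mA; rewrite -[X in measurable X]setTI; exact: mZ. Qed.

Let mean_prod_indic (C : nat -> set T) : (forall i, measurable (C i)) ->
  E (fun w => \prod_(i < n) \1_(C i) (Z i w)) =
  \prod_(i < n) E (fun w => \1_(C i) (Z i w)).
Proof.
move=> mC.
have -> : (fun w => \prod_(i < n) \1_(C i) (Z i w)) =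
    \1_(\bigcap_(i in `I_n) (Z i @^-1` C i)) :> (Om -> R).
  apply/funext => w; rewrite indicE; have [h|h] := boolP (w \in _).
    move: h; rewrite inE => h.
    by rewrite big1// => i _; rewrite indicE mem_set//; apply: (h i) => /=.
  move: h; rewrite notin_setE /bigcap /= => /existsNP[i /not_implyP[ilt hi]].
  rewrite (bigD1 (Ordinal ilt))//= indicE memNset ?mul0r//.
rewrite mean_indic; last first.
  by apply: bigcap_measurableType => i _; exact: preimage_measurable.
rewrite indep// (_ : (\prod_(i < n) P (Z i @^-1` C i))%E =
   (\prod_(i < n) E (fun w => \1_(C i) (Z i w)))%:E)//.
rewrite -prodEFin; apply: eq_bigr => i _.
rewrite (_ : (fun w => _) = \1_(Z i @^-1` C i)); last first.
  by apply/funext => w; rewrite !indicE.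
rewrite mean_indic; last exact: preimage_measurable.
by rewrite fineK// fin_num_measure//; exact: preimage_measurable.
Qed.

(** Coordinates pass from indicators to bounded functions one at a time: in step [k] those from [k]
    on are indicators. With the others frozen, the difference of the two sides is linear in the
    [k]-th function and vanishes on indicators, so [bdm_functional_eq0] applies. *)
Lemma mean_prod (g : nat -> T -> R) : (forall i, bdm (g i)) ->
  E (fun w => \prod_(i < n) g i (Z i w)) = \prod_(i < n) E (fun w => g i (Z i w)).
Proof.
suff main k : forall g : nat -> T -> R, (forall i, bdm (g i)) ->
    (forall i, (k <= i < n)%N -> exists2 A, measurable A & g i = \1_A) ->
    E (fun w => \prod_(i < n) g i (Z i w)) = \prod_(i < n) E (fun w => g i (Z i w)).
  by move=> bg; apply: (main n) => // i; rewrite leqNgt andNb.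
elim: k => [|k IH] {}g bg ig.
  have /choice[A hA] : forall i, exists A, measurable A /\ ((i < n)%N -> g i = \1_A).
    move=> i; case: (ltnP i n) => ni; last by exists setT.
    by have [A mA gA] := ig i ni; exists A.
  have gA (i : 'I_n) : g i = \1_(A i) by apply: (hA i).2.
  under eq_Rintegral do under eq_bigr do rewrite gA.
  under [RHS]eq_bigr do rewrite gA.
  by apply: mean_prod_indic => i; exact: (hA i).1.
have [nk|kn] := leqP n k.
  apply: IH => // i /andP[ki ni].
  by have := leq_trans ni (leq_trans nk ki); rewrite ltnn.
pose upd h i := if i == k then h else g i.
pose ok := Ordinal kn.
pose Q w := \prod_(i < n | i != ok) g i (Z i w).
pose q := \prod_(i < n | i != ok) E (fun w => g i (Z i w)).
have bQ : bdm Q by apply: bdm_prod => i; exact: bdm_sample.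
have updL h w : \prod_(i < n) upd h i (Z i w) = h (Z k w) * Q w.
  rewrite (bigD1 ok)//= /upd eqxx; congr (_ * _); apply: eq_bigr => i ik.
  by rewrite (negbTE (_ : nat_of_ord i != k)).
have updR h : \prod_(i < n) E (fun w => upd h i (Z i w)) = E (fun w => h (Z k w)) * q.
  rewrite (bigD1 ok)//= /upd eqxx; congr (_ * _); apply: eq_bigr => i ik.
  by rewrite (negbTE (_ : nat_of_ord i != k)).
pose Phi h := E (fun w => h (Z k w) * Q w) - E (fun w => h (Z k w)) * q.
suff : Phi (g k) = 0.
  move=> /eqP; rewrite subr_eq0 => /eqP; rewrite -updR.
  rewrite (_ : (fun w => _) = (fun w => \prod_(i < n) upd (g k) i (Z i w))); last first.
    by apply/funext => w; rewrite updL.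
  have -> // : upd (g k) = g.
  by apply/funext => i; rewrite /upd; case: eqP => [->|].
apply: bdm_functional_eq0 (bg k).
- move=> h1 h2 b1 b2; rewrite /Phi.
  rewrite (_ : (fun w => (h1 _ + h2 _) * _) =
    (fun w => h1 (Z k w) * Q w + h2 (Z k w) * Q w)); last first.
    by apply/funext => w; rewrite mulrDl.
  by rewrite !ED; [ring|exact: bdm_sample|exact: bdm_sample|
    apply: bdmM => //; exact: bdm_sample|apply: bdmM => //; exact: bdm_sample].
- move=> c h bh; rewrite /Phi.
  rewrite (_ : (fun w => c * h _ * _) = (fun w => c * (h (Z k w) * Q w))); last first.
    by apply/funext => w; rewrite mulrA.
  by rewrite !EZ; [ring|exact: bdm_sample|apply: bdmM => //; exact: bdm_sample].
- have [_ [C QC]] := bQ; exists (`|C| + `|q|) => h c bh hc.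
  rewrite /Phi (le_trans (ler_normB _ _))// normrM mulrDl lerD//.
    apply: mean_norm_le; first by apply: bdmM => //; exact: bdm_sample.
    by move=> w; rewrite normrM mulrC ler_pM// (le_trans (QC w))// ler_norm.
  rewrite mulrC ler_wpM2l//; apply: mean_norm_le => //.
  exact: bdm_sample.
- move=> A mA; apply/eqP; rewrite subr_eq0 -updR.
  rewrite (_ : (fun w => _) = (fun w => \prod_(i < n) upd \1_A i (Z i w))); last first.
    by apply/funext => w; rewrite updL.
  apply/eqP; apply: IH => i; rewrite /upd; case: eqP => [_|/eqP ik] //.
  + by exact: bdm_indic.
  + by exists A.
  + by move=> /andP[ki ni]; apply: ig; rewrite ltn_neqAle eq_sym ik ki.
Qed.

Lemma mean_prod_le k (g : nat -> T -> R) : (k <= n)%N -> (forall i, bdm (g i)) ->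
  E (fun w => \prod_(i < k) g i (Z i w)) = \prod_(i < k) E (fun w => g i (Z i w)).
Proof.
move=> kn bg; pose g' i := if (i < k)%N then g i else fun=> 1.
have bg' i : bdm (g' i) by rewrite /g'; case: ifP => // _; exact: bdm_cst.
have := mean_prod bg'.
have ext (h : nat -> R) : (forall i, (k <= i)%N -> h i = 1) ->
    \prod_(i < n) h i = \prod_(i < k) h i.
  move=> h1; rewrite -!(big_mkord xpredT h) (big_cat_nat (n := k))//=.
  rewrite [X in _ * X]big_nat [X in _ * X]big1 ?mulr1// => i /andP[ki _].
  exact: h1.
rewrite (ext (fun i => E (fun w => g' i (Z i w)))); last first.
  by move=> i ki; rewrite /g' ltnNge ki /= mean_cst.
rewrite (_ : (fun w => \prod_(i < n) _) = (fun w => \prod_(i < k) g i (Z i w))); last first.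
  apply/funext => w; rewrite (ext (fun i => g' i (Z i w))); last first.
    by move=> i ki; rewrite /g' ltnNge ki.
  by apply: eq_bigr => i _; rewrite /g' ltn_ord.
by move=> ->; apply: eq_bigr => i _; rewrite /g' ltn_ord.
Qed.

(* Sums of products of functions of [Z_0, ..., Z_(k-1)]: an algebra of variables
   adapted to the first [k] samples, on which independence of [Z_k] reduces to
   [mean_prod]. *)
Inductive poly k : (Om -> R) -> Prop :=
| poly_mon c (g : nat -> T -> R) : (forall i, bdm (g i)) -> poly k (fun w => c * \prod_(i < k) g i (Z i w))
| poly_add F G : poly k F -> poly k G -> poly k (fun w => F w + G w).

Lemma poly_bdm k F : poly k F -> bdm F.
Proof.
elim=> [c g bg|F' G' _ bF _ bG]; last exact: bdmD.
by apply: bdmZ; apply: bdm_prod => i; exact: bdm_sample.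
Qed.

Lemma eq_poly k F G : F =1 G -> poly k F -> poly k G.
Proof. by move=> /funext ->. Qed.

Lemma poly_cst k c : poly k (fun=> c).
Proof.
have := @poly_mon k c (fun _ _ => 1) (fun=> bdm_cst 1).
by apply: eq_poly => w; rewrite big1 ?mulr1.
Qed.

Lemma polyM k F G : poly k F -> poly k G -> poly k (fun w => F w * G w).
Proof.
move=> pF pG; elim: pF => [c g bg|F1 F2 _ p1 _ p2]; last first.
  by apply: eq_poly (poly_add p1 p2) => w; rewrite mulrDl.
elim: pG => [c' h bh|G1 G2 _ p1 _ p2]; last first.
  by apply: eq_poly (poly_add p1 p2) => w; rewrite mulrDr.
have := @poly_mon k (c * c') (fun i z => g i z * h i z) (fun i => bdmM (bg i) (bh i)).
by apply: eq_poly => w; rewrite big_split /=; ring.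
Qed.

Lemma polyX k F m : poly k F -> poly k (fun w => F w ^+ m).
Proof.
move=> pF; elim: m => [|m IH]; first exact: (poly_cst k 1).
by apply: eq_poly (polyM pF IH) => w; rewrite exprS.
Qed.

Lemma poly_sum k (I : Type) (s : seq I) (F : I -> Om -> R) :
  (forall i, poly k (F i)) -> poly k (fun w => \sum_(i <- s) F i w).
Proof.
move=> pF; elim: s => [|i s IH].
  by apply: eq_poly (poly_cst k 0) => w; rewrite big_nil.
by apply: eq_poly (poly_add (pF i) IH) => w; rewrite big_cons.
Qed.

Lemma poly_sample k i g : (i < k)%N -> bdm g -> poly k (fun w => g (Z i w)).
Proof.
move=> ik bg.
have bg' j : bdm (if j == i then g else fun=> 1) by case: ifP => // _; exact: bdm_cst.
apply: eq_poly (@poly_mon k 1 _ bg') => w.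
rewrite mul1r (bigD1 (Ordinal ik))//= eqxx big1 ?mulr1// => j ji.
by have /negbTE -> : (nat_of_ord j != i)%N := ji.
Qed.

Lemma poly_widen k F : poly k F -> poly k.+1 F.
Proof.
elim=> [c g bg|F' G' _ bF _ bG]; last exact: poly_add.
apply: polyM; first exact: poly_cst.
have bg' j : bdm (if j == k then fun=> 1 else g j) by case: ifP => // _; exact: bdm_cst.
apply: eq_poly (@poly_mon k.+1 1 _ bg') => w.
rewrite mul1r big_ord_recr /= eqxx mulr1; apply: eq_bigr => j _.
by rewrite ltn_eqF.
Qed.

Lemma mean_poly_sample k F g : (k < n)%N -> poly k F -> bdm g ->
  E (fun w => F w * g (Z k w)) = E F * E (fun w => g (Z k w)).
Proof.
move=> kn pF bg; elim: pF => [c h bh|F1 F2 p1 IH1 p2 IH2]; last first.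
  rewrite (ED (poly_bdm p1) (poly_bdm p2)) mulrDl -IH1 -IH2 -ED.
  - by apply: eq_Rintegral => w _; rewrite mulrDl.
  - by apply: bdmM; [exact: poly_bdm p1|exact: bdm_sample].
  - by apply: bdmM; [exact: poly_bdm p2|exact: bdm_sample].
have bprod : bdm (fun w => \prod_(i < k) h i (Z i w)).
  by apply: bdm_prod => i; exact: bdm_sample.
rewrite EZ// -mulrA (mean_prod_le (ltnW kn) bh).
pose h' i := if (i < k)%N then h i else g.
have bh' i : bdm (h' i) by rewrite /h'; case: ifP.
have hh' (i : 'I_k) : h' i = h i by rewrite /h' ltn_ord.
have h'k : h' k = g by rewrite /h' ltnn.
have := mean_prod_le kn bh'; rewrite big_ord_recr /= h'k.
under [X in _ = X * _]eq_bigr do rewrite hh'.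
move=> <-; rewrite -EZ; last by apply: bdm_prod => i; exact: bdm_sample.
apply: eq_Rintegral => w _; rewrite big_ord_recr /= h'k -!mulrA.
by under [X in _ = _ * (X * _)]eq_bigr do rewrite hh'.
Qed.

(** * Moment recursions for the martingale of the U-statistic *)

Section degenerate_U_statistic.
Variables (D : nat) (xi : 'I_D -> T -> R) (B v : R).
Hypothesis bxi : forall a, bdm (xi a).
Hypothesis Exi : forall a i, (i < n)%N -> E (fun w => xi a (Z i w)) = 0.
Hypothesis xiB : forall z, \sum_a xi a z ^+ 2 <= B.
Hypothesis xiv : forall i (c : 'I_D -> R), (i < n)%N ->
  E (fun w => (\sum_a c a * xi a (Z i w)) ^+ 2) <= v * \sum_a c a ^+ 2.
Hypotheses (v0 : 0 < v) (vB : v <= B).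

Definition psum k a w := \sum_(i < k) xi a (Z i w).
(** The martingale increment: given the first [k] samples it is centred and has variance at most
    [v * sqn k]. *)
Definition incr k w := \sum_a psum k a w * xi a (Z k w).
Definition ustat k w := \sum_(j < k) incr j w.
Definition sqn k w := \sum_a psum k a w ^+ 2.

Lemma psumS k a w : psum k.+1 a w = psum k a w + xi a (Z k w).
Proof. by rewrite /psum big_ord_recr. Qed.

Lemma ustatS k w : ustat k.+1 w = ustat k w + incr k w.
Proof. by rewrite /ustat big_ord_recr. Qed.

Lemma sqn_ustat k w :
  sqn k w = \sum_(i < k) \sum_a xi a (Z i w) ^+ 2 + 2 * ustat k w.
Proof.
elim: k => [|k IH].
  by rewrite /sqn /ustat !big_ord0 mulr0 addr0 big1// => a _; rewrite /psum big_ord0 expr0n.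
rewrite big_ord_recr /= ustatS mulrDr addrACA -IH /sqn /incr mulr_sumr -!big_split /=.
by apply: eq_bigr => a _; rewrite psumS; ring.
Qed.

Lemma sqn_le k w : sqn k w <= k%:R * B + 2 * ustat k w.
Proof.
rewrite sqn_ustat lerD2r mulrC.
rewrite (le_trans (ler_sum _ (fun (i : 'I_k) _ => xiB (Z i w))))//.
by rewrite sumr_const card_ord mulr_natr.
Qed.

Lemma sqn_ge0 k w : 0 <= sqn k w.
Proof. by apply: sumr_ge0 => a _; exact: sqr_ge0. Qed.

Lemma poly_psum k a : poly k (psum k a).
Proof.
elim: k => [|k IH]; first by apply: eq_poly (poly_cst 0 0) => w; rewrite /psum big_ord0.
apply: eq_poly (poly_add (poly_widen IH) (poly_sample (ltnSn k) (bxi a))) => w.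
by rewrite psumS.
Qed.

Lemma poly_incr k : poly k.+1 (incr k).
Proof.
apply: poly_sum => a; apply: polyM; first exact/poly_widen/poly_psum.
exact: poly_sample.
Qed.

Lemma poly_ustat k : poly k (ustat k).
Proof.
elim: k => [|k IH]; first by apply: eq_poly (poly_cst 0 0) => w; rewrite /ustat big_ord0.
apply: eq_poly (poly_add (poly_widen IH) (poly_incr k)) => w.
by rewrite ustatS.
Qed.

Lemma poly_sqn k : poly k (sqn k).
Proof. by apply: poly_sum => a; apply: polyX; exact: poly_psum. Qed.

Lemma mean_incr k F : (k < n)%N -> poly k F -> E (fun w => F w * incr k w) = 0.
Proof.
move=> kn pF.
have -> : (fun w => F w * incr k w) =
    (fun w => \sum_a (F w * psum k a w) * xi a (Z k w)).
  by apply/funext => w; rewrite mulr_sumr; apply: eq_bigr => a _; rewrite mulrA.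
rewrite Esum; last first.
  move=> a; apply: bdmM; last exact: bdm_sample.
  exact: (poly_bdm (polyM pF (poly_psum k a))).
rewrite big1// => a _; rewrite (mean_poly_sample kn (polyM pF (poly_psum k a)))//.
by rewrite Exi// mulr0.
Qed.

(** Expanding the square leaves adapted factors times [xi_a xi_b] at the new sample, whose means
    factor through the covariances [C a b]. The weak variance bound is then used for each [w] with
    coefficients [psum k a w]. *)
Lemma mean_incr_sqr k F : (k < n)%N -> poly k F -> (forall w, 0 <= F w) ->
  E (fun w => F w * incr k w ^+ 2) <= v * E (fun w => F w * sqn k w).
Proof.
move=> kn pF F0.
pose C a b := E (fun w => xi a (Z k w) * xi b (Z k w)).
have bxx a b : bdm (fun z => xi a z * xi b z) by exact: bdmM.
have pFS a b : poly k (fun w => F w * (psum k a w * psum k b w)).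
  by apply: polyM => //; apply: polyM; exact: poly_psum.
have sq (c : 'I_D -> R) (w : Om) : (\sum_a c a * xi a (Z k w)) ^+ 2 =
    \sum_a \sum_b (c a * c b) * (xi a (Z k w) * xi b (Z k w)).
  rewrite expr2 mulr_suml; apply: eq_bigr => a _; rewrite mulr_sumr.
  by apply: eq_bigr => b _; ring.
have bterm (c : R) a b : bdm (fun w => c * (xi a (Z k w) * xi b (Z k w))).
  by apply: bdmZ; apply: bdmM; exact: bdm_sample.
have CE (c : 'I_D -> R) : \sum_a \sum_b (c a * c b) * C a b =
    E (fun w => (\sum_a c a * xi a (Z k w)) ^+ 2).
  under [in RHS]eq_Rintegral do rewrite sq.
  rewrite Esum; last by move=> a; apply: bdm_sum => b; exact: bterm.
  apply: eq_bigr => a _; rewrite Esum; last by move=> b; exact: bterm.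
  by apply: eq_bigr => b _; rewrite EZ//; apply: bdmM; exact: bdm_sample.
have -> : E (fun w => F w * incr k w ^+ 2) =
    E (fun w => \sum_a \sum_b F w * (psum k a w * psum k b w) * C a b).
  have -> : (fun w => F w * incr k w ^+ 2) =
      (fun w => \sum_a \sum_b F w * (psum k a w * psum k b w) * (xi a (Z k w) * xi b (Z k w))).
    apply/funext => w; rewrite /incr sq mulr_sumr; apply: eq_bigr => a _.
    by rewrite mulr_sumr; apply: eq_bigr => b _; ring.
  have b1 a b : bdm (fun w => F w * (psum k a w * psum k b w) * (xi a (Z k w) * xi b (Z k w))).
    by apply: bdmM; [exact: (poly_bdm (pFS a b))|exact: (bdm_sample _ (bxx a b))].
  have b2 a b : bdm (fun w => F w * (psum k a w * psum k b w) * C a b).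
    by apply: bdmM; [exact: (poly_bdm (pFS a b))|exact: bdm_cst].
  rewrite !Esum; try by move=> a; apply: bdm_sum => b.
  apply: eq_bigr => a _; rewrite !Esum//; apply: eq_bigr => b _.
  rewrite (mean_poly_sample kn (pFS a b) (bxx a b)) mulrC -EZ; last exact: (poly_bdm (pFS a b)).
  by apply: eq_Rintegral => w _; rewrite mulrC.
rewrite -EZ; last by apply: bdmM; [exact: (poly_bdm pF)|exact: (poly_bdm (poly_sqn k))].
apply: mean_le.
- apply: bdm_sum => a; apply: bdm_sum => b.
  by apply: bdmM; [exact: (poly_bdm (pFS a b))|exact: bdm_cst].
- by apply: bdmZ; apply: bdmM; [exact: (poly_bdm pF)|exact: (poly_bdm (poly_sqn k))].
move=> w; rewrite mulrCA (_ : \sum_a _ = F w * \sum_a \sum_b (psum k a w * psum k b w) * C a b); last first.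
  by rewrite mulr_sumr; apply: eq_bigr => a _; rewrite mulr_sumr; apply: eq_bigr => b _; ring.
rewrite ler_wpM2l// CE; exact: xiv.
Qed.

Lemma incr_sqr_le k w : incr k w ^+ 2 <= B * sqn k w.
Proof.
pose a : 'cV[R]_D := \col_i psum k i w.
pose b : 'cV[R]_D := \col_i xi i (Z k w).
have := dot_cauchy_schwarz a b.
have -> : dot a b = incr k w by apply: eq_bigr => i _; rewrite !mxE.
have -> : dot a a = sqn k w by apply: eq_bigr => i _; rewrite !mxE expr2.
have -> : dot b b = \sum_i xi i (Z k w) ^+ 2 by apply: eq_bigr => i _; rewrite !mxE expr2.
move=> /le_trans; apply; rewrite mulrC ler_wpM2r ?sqn_ge0//; exact: xiB.
Qed.

Lemma mean_ustat k : (k <= n)%N -> E (ustat k) = 0.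
Proof.
elim: k => [_|k IH kn].
  rewrite (_ : ustat 0 = fun=> 0) ?mean_cst//.
  by apply/funext => w; rewrite /ustat big_ord0.
rewrite (_ : ustat k.+1 = fun w => ustat k w + 1 * incr k w); last first.
  by apply/funext => w; rewrite ustatS mul1r.
rewrite ED; [|exact: (poly_bdm (poly_ustat k))|by apply: bdmZ; exact: (poly_bdm (poly_incr k))].
by rewrite IH ?(ltnW kn)// add0r (mean_incr kn (poly_cst k 1)).
Qed.

Lemma mean_sqn_le k : (k <= n)%N -> E (sqn k) <= k%:R * B.
Proof.
move=> kn; have bu := poly_bdm (poly_ustat k).
apply: (@le_trans _ _ (E (fun w => k%:R * B + 2 * ustat k w))).
  apply: mean_le; [exact: (poly_bdm (poly_sqn k))| |exact: sqn_le].
  by apply: bdmD; [exact: bdm_cst|exact: bdmZ].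
rewrite ED; [|exact: bdm_cst|exact: bdmZ].
by rewrite mean_cst EZ// mean_ustat// mulr0 addr0.
Qed.

Lemma mean_ustat_sqr k : (k <= n)%N ->
  E (fun w => ustat k w ^+ 2) <= k%:R ^+ 2 * (v * B).
Proof.
have B0 : 0 <= B by rewrite (le_trans (ltW v0)).
elim: k => [_|k IH kn].
  rewrite (_ : (fun w => _) = fun=> 0) ?mean_cst ?expr0n ?mul0r//.
  by apply/funext => w; rewrite /ustat big_ord0 expr0n.
have bu := poly_bdm (poly_ustat k); have bi := poly_bdm (poly_incr k).
rewrite (_ : (fun w => _) = fun w => ustat k w ^+ 2 +
    ((2 * ustat k w) * incr k w + 1 * incr k w ^+ 2)); last first.
  by apply/funext => w; rewrite ustatS; ring.
rewrite !ED; [|by apply: bdmM => //; exact: bdmZ|by apply: bdmZ; exact: bdmX|exact: bdmX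
  |by apply: bdmD; [apply: bdmM => //; exact: bdmZ|apply: bdmZ; exact: bdmX]].
rewrite (mean_incr kn (polyM (poly_cst k 2) (poly_ustat k))) add0r.
have := mean_incr_sqr kn (poly_cst k 1) (fun=> ler01).
rewrite (_ : (fun w => 1 * sqn k w) = sqn k); last by apply/funext => w; rewrite mul1r.
have := IH (ltnW kn); have := mean_sqn_le (ltnW kn).
move: (E (sqn k)) (E (fun w => ustat k w ^+ 2)) (E (fun w => 1 * incr k w ^+ 2)) => x y z hx hy hz.
rewrite -natr1; have k0 : 0 <= k%:R :> R by [].
have := ler_wpM2l (ltW v0) hx.
have : 0 <= v * B by rewrite mulr_ge0// ltW.
move: k%:R k0 hy => K K0 hy vb0 h.
apply: le_trans (lerD hy (le_trans hz h)) _.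
by nra.
Qed.

Lemma mean_sqn_sqr k : (k <= n)%N ->
  E (fun w => sqn k w ^+ 2) <= 5 * (n%:R ^+ 2 * B ^+ 2).
Proof.
move=> kn; have bu := poly_bdm (poly_ustat k).
have B0 : 0 <= B by rewrite (le_trans (ltW v0)).
(* Squaring [sqn <= k B + 2 M]: the linear term has mean zero and
   [4 E M^2 <= 4 k^2 v B <= 4 k^2 B^2], which makes the factor 5. *)
apply: (@le_trans _ _ (E (fun w => (k%:R * B) ^+ 2 + ((4 * k%:R * B) * ustat k w + 4 * ustat k w ^+ 2)))).
  apply: mean_le.
  - by apply: bdmX; exact: (poly_bdm (poly_sqn k)).
  - apply: bdmD; first exact: bdm_cst.
    by apply: bdmD; [exact: bdmZ|apply: bdmZ; exact: bdmX].
  move=> w; have -> : (k%:R * B) ^+ 2 + ((4 * k%:R * B) * ustat k w + 4 * ustat k w ^+ 2) =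
    (k%:R * B + 2 * ustat k w) ^+ 2 by ring.
  by rewrite lerXn2r ?nnegrE ?sqn_ge0 ?sqn_le// (le_trans _ (sqn_le k w))// sqn_ge0.
rewrite !ED; [|exact: bdmZ|by apply: bdmZ; exact: bdmX|exact: bdm_cst
  |by apply: bdmD; [exact: bdmZ|apply: bdmZ; exact: bdmX]].
rewrite mean_cst (EZ _ bu) (EZ _ (bdmX 2 bu)) mean_ustat// mulr0 add0r.
have := mean_ustat_sqr kn; move: (E (fun w => ustat k w ^+ 2)) => x hx.
have kn' : k%:R ^+ 2 <= n%:R ^+ 2 :> R by rewrite lerXn2r ?nnegrE// ler_nat.
have : 0 <= k%:R ^+ 2 :> R by rewrite exprn_ge0.
rewrite exprMn; move: (k%:R ^+ 2) (n%:R ^+ 2) kn' hx => K N KN hx K0.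
have h1 : v * B <= B ^+ 2 by rewrite expr2 ler_wpM2r.
have h2 : x <= K * B ^+ 2 by rewrite (le_trans hx)// ler_wpM2l.
have h3 : K * B ^+ 2 <= N * B ^+ 2 by rewrite ler_wpM2r// exprn_ge0.
by lra.
Qed.

(** One factor [incr^2] is bounded surely by [B * sqn], the other is integrated and contributes the
    small variance [v]. The result is [v B^3] instead of [B^4]. *)
Lemma mean_incr4 k : (k < n)%N ->
  E (fun w => incr k w ^+ 4) <= 5 * v * (n%:R ^+ 2 * B ^+ 3).
Proof.
move=> kn; have B0 : 0 <= B by rewrite (le_trans (ltW v0)).
have bi := poly_bdm (poly_incr k); have bs := poly_bdm (poly_sqn k).
apply: (@le_trans _ _ (E (fun w => (B * sqn k w) * incr k w ^+ 2))).
  apply: mean_le; [exact: bdmX|by apply: bdmM; [exact: bdmZ|exact: bdmX]|].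
  move=> w; rewrite (_ : 4%N = (2 + 2)%N)// exprD ler_wpM2r ?sqr_ge0//.
  exact: incr_sqr_le.
have := mean_incr_sqr kn (polyM (poly_cst k B) (poly_sqn k))
  (fun w => mulr_ge0 B0 (sqn_ge0 k w)).
rewrite (_ : (fun w => B * sqn k w * sqn k w) = fun w => B * sqn k w ^+ 2); last first.
  by apply/funext => w; rewrite expr2 mulrA.
move=> /le_trans; apply; rewrite EZ; last exact: bdmX.
have := mean_sqn_sqr (ltnW kn); move: (E (fun w => sqn k w ^+ 2)) => x hx.
have -> : 5 * v * (n%:R ^+ 2 * B ^+ 3) = v * (B * (5 * (n%:R ^+ 2 * B ^+ 2))) by ring.
by rewrite ler_wpM2l ?(ltW v0)// ler_wpM2l.
Qed.

(** The term [M^3 y] is centred and [M^2 y^2] integrates to at most [v M^2 sqn]. Its product form is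
    split with weight [v n], so [E M^4] is only multiplied by [1 + 1 / n], whose [n]-th power stays
    below [e]. *)
Lemma mean_ustat4_rec k : (k < n)%N ->
  E (fun w => ustat k.+1 w ^+ 4) <= (1 + n%:R^-1) * E (fun w => ustat k w ^+ 4) +
   (80 * (v ^+ 2 * n%:R ^+ 3 * B ^+ 2) + 15 * (v * n%:R ^+ 2 * B ^+ 3)).
Proof.
move=> kn; have B0 : 0 <= B by rewrite (le_trans (ltW v0)).
have bi := poly_bdm (poly_incr k); have bs := poly_bdm (poly_sqn k).
have bu := poly_bdm (poly_ustat k).
have N0 : 0 < n%:R :> R by rewrite ltr0n (leq_ltn_trans _ kn).
have h1 : E (fun w => ustat k.+1 w ^+ 4) <=
    E (fun w => ustat k w ^+ 4 + ((4 * ustat k w ^+ 3) * incr k w +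
      ((8 * ustat k w ^+ 2) * incr k w ^+ 2 + 3 * incr k w ^+ 4))).
  apply: mean_le.
  - by apply: bdmX; exact: (poly_bdm (poly_ustat k.+1)).
  - apply: bdmD; first exact: bdmX.
    apply: bdmD; first by apply: bdmM => //; apply: bdmZ; exact: bdmX.
    apply: bdmD; last by apply: bdmZ; exact: bdmX.
    by apply: bdmM; [apply: bdmZ; exact: bdmX|exact: bdmX].
  move=> w; rewrite ustatS; move: (ustat k w) (incr k w) => M y.
  (* The odd term is removed by [4 M y^3 <= 2 M^2 y^2 + 2 y^4], written as a dropped square; this
     turns 6 and 1 into 8 and 3. *)
  have -> : (M + y) ^+ 4 = M ^+ 4 + (4 * M ^+ 3 * y + (8 * M ^+ 2 * y ^+ 2 + 3 * y ^+ 4))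
    - 2 * (y * (M - y)) ^+ 2 by ring.
  by rewrite gerBl mulr_ge0// sqr_ge0.
apply: le_trans h1 _.
rewrite !ED; first last.
- apply: bdmD; first by apply: bdmM => //; apply: bdmZ; exact: bdmX.
  apply: bdmD; last by apply: bdmZ; exact: bdmX.
  by apply: bdmM; [apply: bdmZ; exact: bdmX|exact: bdmX].
- exact: bdmX.
- apply: bdmD; last by apply: bdmZ; exact: bdmX.
  by apply: bdmM; [apply: bdmZ; exact: bdmX|exact: bdmX].
- by apply: bdmM => //; apply: bdmZ; exact: bdmX.
- by apply: bdmZ; exact: bdmX.
- by apply: bdmM; [apply: bdmZ; exact: bdmX|exact: bdmX].
rewrite (mean_incr kn (polyM (poly_cst k 4) (polyX 3 (poly_ustat k)))) add0r.
rewrite EZ; last exact: bdmX.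
have := mean_incr4 kn.
have := mean_incr_sqr kn (polyM (poly_cst k 8) (polyX 2 (poly_ustat k)))
  (fun w => mulr_ge0 (ler0n _ _) (sqr_ge0 _)).
(* AM-GM: 8 M^2 s <= M^4 / (v n) + 16 v n s^2 *)
have : E (fun w => 8 * ustat k w ^+ 2 * sqn k w) <=
    E (fun w => (v * n%:R)^-1 * ustat k w ^+ 4 + (16 * v * n%:R) * sqn k w ^+ 2).
  apply: mean_le.
  - by apply: bdmM => //; apply: bdmZ; exact: bdmX.
  - by apply: bdmD; apply: bdmZ; exact: bdmX.
  move=> w; move: (ustat k w) (sqn k w) => M s.
  have vn : 0 < v * n%:R by rewrite mulr_gt0.
  have -> : (v * n%:R)^-1 * M ^+ 4 + (16 * v * n%:R) * s ^+ 2 =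
    8 * M ^+ 2 * s + (v * n%:R)^-1 * (M ^+ 2 - 4 * (v * n%:R) * s) ^+ 2.
    by field; rewrite !lt0r_neq0.
  by rewrite lerDl mulr_ge0 ?invr_ge0 ?sqr_ge0// ltW.
rewrite ED; [|by apply: bdmZ; exact: bdmX|by apply: bdmZ; exact: bdmX].
rewrite !EZ; [|exact: bdmX|exact: bdmX].
have := mean_sqn_sqr (ltnW kn).
move: (E (fun w => sqn k w ^+ 2)) (E (fun w => ustat k w ^+ 4))
  (E (fun w => 8 * ustat k w ^+ 2 * sqn k w))
  (E (fun w => 8 * ustat k w ^+ 2 * incr k w ^+ 2)) (E (fun w => incr k w ^+ 4)).
move=> s4 a q r t hs hq hr ht.
have e1 : r <= v * ((v * n%:R)^-1 * a + 16 * v * n%:R * (5 * (n%:R ^+ 2 * B ^+ 2))).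
  apply: le_trans hr _; rewrite ler_wpM2l ?(ltW v0)//; apply: le_trans hq _.
  by rewrite lerD2l ler_wpM2l// !mulr_ge0// ltW.
have e2 : v * ((v * n%:R)^-1 * a + 16 * v * n%:R * (5 * (n%:R ^+ 2 * B ^+ 2))) =
  n%:R^-1 * a + 80 * (v ^+ 2 * n%:R ^+ 3 * B ^+ 2) by field; rewrite !lt0r_neq0.
have e3 : 3 * (5 * v * (n%:R ^+ 2 * B ^+ 3)) = 15 * (v * n%:R ^+ 2 * B ^+ 3) by ring.
rewrite e2 in e1; rewrite mulrDl mul1r.
have e4 : 3 * t <= 15 * (v * n%:R ^+ 2 * B ^+ 3) by rewrite -e3 ler_wpM2l.
lra.
Qed.

Theorem mean_ustat4_le :
  E (fun w => ustat n w ^+ 4) <= expR 1 *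
   (80 * (v ^+ 2 * n%:R ^+ 4 * B ^+ 2) + 15 * (v * n%:R ^+ 3 * B ^+ 3)).
Proof.
have B0 : 0 <= B by rewrite (le_trans (ltW v0)).
pose c := 80 * (v ^+ 2 * n%:R ^+ 3 * B ^+ 2) + 15 * (v * n%:R ^+ 2 * B ^+ 3).
have c0 : 0 <= c by rewrite /c addr_ge0// !mulr_ge0// ?exprn_ge0// ltW.
have key k : (k <= n)%N -> E (fun w => ustat k w ^+ 4) <= (1 + n%:R^-1) ^+ k * (k%:R * c).
  elim: k => [_|k IH kn].
    rewrite (_ : (fun w => _) = fun=> 0) ?mean_cst ?expr0n ?mul0r ?mulr0//.
    by apply/funext => w; rewrite /ustat big_ord0 expr0n.
  apply: le_trans (mean_ustat4_rec kn) _; rewrite -/c.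
  set r := 1 + n%:R^-1.
  have r1 : 1 <= r by rewrite lerDl invr_ge0.
  have -> : r ^+ k.+1 * (k.+1%:R * c) = r * (r ^+ k * (k%:R * c)) + r ^+ k.+1 * c.
    by rewrite exprS -natr1; ring.
  apply: lerD; last by rewrite ler_peMl// exprn_ege1.
  rewrite ler_wpM2l ?(le_trans ler01)//; exact: (IH (ltnW kn)).
apply: le_trans (key n (leqnn n)) _.
have -> : 80 * (v ^+ 2 * n%:R ^+ 4 * B ^+ 2) + 15 * (v * n%:R ^+ 3 * B ^+ 3) = n%:R * c.
  by rewrite /c; ring.
rewrite ler_wpM2r ?mulr_ge0//.
have [->|n0] := eqVneq n 0%N; first by rewrite expr0 -expR0 ler_expR.
have -> : expR 1 = expR (n%:R^-1) ^+ n :> R.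
  by rewrite -expRM_natl mulfV// pnatr_eq0.
by rewrite lerXn2r ?nnegrE ?addr_ge0 ?invr_ge0 ?expR_ge0// expR_ge1Dx.
Qed.

End degenerate_U_statistic.
End independent_sequence.

(** * A one-sided Hoeffding bound *)

Section hoeffding.
Context {R : realType}.

(** [expR u] is at most [1 / (1 - u)], and the quadratic dominates that as long as
    [1 - 2 u >= 0]. *)
Lemma expR_le_quadratic (u : R) : u <= 2^-1 -> expR u <= 1 + u + 2 * u ^+ 2.
Proof.
move=> u2; have h := expR_ge1Dx (- u).
have u1 : 0 < 1 - u by lra.
have : expR u <= (1 - u)^-1.
  by rewrite -[u in expR u]opprK expRN lef_pV2 ?posrE ?expR_gt0.
move=> /le_trans; apply; rewrite -[leLHS]mul1r ler_pdivrMr//.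
have -> : (1 + u + 2 * u ^+ 2) * (1 - u) = 1 + u ^+ 2 * (1 - 2 * u) by ring.
by rewrite lerDl mulr_ge0 ?sqr_ge0//; lra.
Qed.

(** Cube of [1 + y / 3 <= expR (y / 3)]. The third power is the one that leaves [1 / n] after
    multiplication by the bound of order [n^2] on the truncated loss. *)
Lemma expRN_le_cube (y : R) : 0 < y -> expR (- y) <= 27 / y ^+ 3.
Proof.
move=> y0; have h := expR_ge1Dx (y / 3).
have : (y / 3) ^+ 3 <= expR y.
  rewrite [leRHS](_ : _ = expR (y / 3) ^+ 3); last first.
    by rewrite -expRM_natl; congr expR; field.
  rewrite lerXn2r ?nnegrE ?expR_ge0 ?divr_ge0 ?(ltW y0)//; lra.
move=> h2; rewrite expRN -[leLHS]mul1r ler_pdivrMr ?expR_gt0//.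
rewrite mulrAC ler_pdivlMr ?exprn_gt0// mul1r.
have -> : y ^+ 3 = 27 * (y / 3) ^+ 3 by field.
by rewrite ler_pM2l.
Qed.

Context {d dT : measure_display} {Om : measurableType d} {T : measurableType dT}.
Variables (P : probability Om R) (n : nat) (Z : nat -> Om -> T).
Hypothesis mZ : forall i, measurable_fun setT (Z i).
Hypothesis indep : forall C : nat -> set T, (forall i, measurable (C i)) ->
  P (\bigcap_(i in `I_n) (Z i @^-1` C i)) = (\prod_(i < n) P (Z i @^-1` C i))%E.

Local Notation E F := (\int[P]_w F w)%R.

Variables (A : set T) (p e : R).
Hypothesis mA : measurable A.
Hypothesis EA : forall i, (i < n)%N -> E (fun w => \1_A (Z i w)) = p.
Hypotheses (p01 : 0 <= p <= 1) (e0 : 0 < e) (e1 : e <= 1).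

(** A bounded majorant of the indicator that the frequency of [A] is at most [p - e]. Working with
    it in place of the event turns Markov's inequality and the union bound into sums of means. *)
Definition chernoff_prod w := \prod_(i < n) expR (e / 4 * (p - \1_A (Z i w) - e)).

Lemma chernoff_prod_ge0 w : 0 <= chernoff_prod w.
Proof. by apply: prodr_ge0 => i _; exact: expR_ge0. Qed.

Let bexp : bdm (fun z : T => expR (e / 4 * (p - \1_A z - e))).
Proof.
have [mi _] := bdm_indic mA (R := R).
split.
  apply: measurableT_comp; first exact: measurable_expR.
  by apply: measurable_funM => //; apply: measurable_funB => //; apply: measurable_funB.
exists (expR (e / 4 * (p - 0 - e))) => z; rewrite ger0_norm ?expR_ge0// ler_expR.
rewrite ler_wpM2l ?divr_ge0 ?(ltW e0)// lerD2r lerD2l lerN2 indicE.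
by case: (_ \in _).
Qed.

Lemma chernoff_prod_bdm : bdm chernoff_prod.
Proof. by apply: bdm_prod => i; exact: (bdm_sample mZ i bexp). Qed.

Lemma chernoff_prod_ge1 w : n%:R^-1 * (\sum_(i < n) \1_A (Z i w)) <= p - e -> (0 < n)%N ->
  1 <= chernoff_prod w.
Proof.
move=> h n0; rewrite /chernoff_prod -expR_sum -expR0 ler_expR -mulr_sumr.
rewrite mulr_ge0 ?divr_ge0 ?(ltW e0)//.
rewrite (eq_bigr (fun i : 'I_n => (p - e) - \1_A (Z i w))); last by move=> i _; ring.
rewrite sumrB sumr_const card_ord subr_ge0 -mulr_natl.
by rewrite mulrC -ler_pdivrMr ?ltr0n// mulrC.
Qed.

Lemma chernoff_prod_le : E chernoff_prod <= expR (- (n%:R * (e ^+ 2 / 8))).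
Proof.
rewrite (mean_prod mZ indep (g := fun=> _) (fun=> bexp)).
rewrite -mulrN expRM_natl.
have -> : expR (- (e ^+ 2 / 8)) ^+ n = \prod_(i < n) expR (- (e ^+ 2 / 8)) :> R.
  by rewrite prodr_const card_ord.
rewrite ler_prod// => i _.
have bi := bdm_indic mA (R := R); have biZ := bdm_sample mZ i bi.
have Pfin : (P setT < +oo)%E by rewrite probability_setT ltry.
apply/andP; split.
  by apply: Rintegral_ge0 => w _; exact: expR_ge0.
(* The minimiser of [2 s^2 - s e], with value [- e^2 / 8]; since [e <= 1] the exponent also stays in
   the range of the quadratic bound. *)
pose s := e / 4.
apply: (@le_trans _ _ (E (fun w => expR (- (s * e)) * ((1 + s * p + 2 * s ^+ 2) - s * \1_A (Z i w))))).
  apply: mean_le.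
  - exact: (bdm_sample mZ i bexp).
  - by apply: bdmZ; apply: bdmB; [exact: bdm_cst|exact: bdmZ].
  move=> w; rewrite -/s.
  have -> : s * (p - \1_A (Z i w) - e) = - (s * e) + s * (p - \1_A (Z i w)) by ring.
  rewrite expRD ler_wpM2l ?expR_ge0//.
  have ind01 : 0 <= (\1_A (Z i w) : R) <= 1 by rewrite indicE; case: (_ \in _) => /=; lra.
  have s0 : 0 < s by rewrite divr_gt0.
  have s4 : s <= 4^-1 by rewrite /s ler_pdivrMr// mulVf.
  move: (\1_A (Z i w)) ind01 => y /andP[y0 y1]; have /andP[p0 p1] := p01.
  apply: le_trans (expR_le_quadratic _) _.
    by apply: (@le_trans _ _ s); [rewrite ler_piMr ?(ltW s0)//; lra|lra].
  have : (p - y) ^+ 2 <= 1 by nra.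
  rewrite exprMn => h; have : s ^+ 2 * (p - y) ^+ 2 <= s ^+ 2 by rewrite ler_piMr ?sqr_ge0.
  by lra.
rewrite (bdm_RintegralZ measurableT Pfin); last by apply: bdmB; [exact: bdm_cst|exact: bdmZ].
rewrite (bdm_RintegralB measurableT Pfin); [|exact: bdm_cst|exact: bdmZ].
rewrite mean_cst (bdm_RintegralZ measurableT Pfin)// EA//.
have -> : 1 + s * p + 2 * s ^+ 2 - s * p = 1 + 2 * s ^+ 2 by ring.
apply: (@le_trans _ _ (expR (- (s * e)) * expR (2 * s ^+ 2))).
  by rewrite ler_wpM2l ?expR_ge0// expR_ge1Dx.
by rewrite -expRD ler_expR /s; lra.
Qed.

End hoeffding.

(** * The trigonometric basis *)

Section trigonometric_basis.
Variable R : realType.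

Lemma measurable_circ : measurable (circ : set R).
Proof. exact: measurable_itv. Qed.

Lemma leb_circ : lebesgue_measure (circ : set R) = (pi *+ 2)%:E.
Proof.
by rewrite /circ lebesgue_measure_itv /= lte_fin mulrn_wgt0 ?pi_gt0// sube0.
Qed.

Lemma leb_circ_fin : (lebesgue_measure (circ : set R) < +oo)%E.
Proof. by rewrite leb_circ ltry. Qed.

Let mc := measurable_circ.
Let lc := leb_circ_fin.

Lemma circ_integrable (g : R -> R) : bdm g -> leb.-integrable circ (EFin \o g).
Proof. exact: (@bdm_integrable R _ _ (@lebesgue_measure R) circ mc lc). Qed.

Lemma IcircD (g h : R -> R) : bdm g -> bdm h ->
  Icirc (fun x => g x + h x) = Icirc g + Icirc h.
Proof. exact: (@bdm_RintegralD R _ _ (@lebesgue_measure R) circ mc lc). Qed.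

Lemma IcircB (g h : R -> R) : bdm g -> bdm h ->
  Icirc (fun x => g x - h x) = Icirc g - Icirc h.
Proof. exact: (@bdm_RintegralB R _ _ (@lebesgue_measure R) circ mc lc). Qed.

Lemma IcircZ c (g : R -> R) : bdm g -> Icirc (fun x => c * g x) = c * Icirc g.
Proof. exact: (@bdm_RintegralZ R _ _ (@lebesgue_measure R) circ mc lc). Qed.

Lemma Icirc_sum (I : Type) (s : seq I) (g : I -> R -> R) : (forall i, bdm (g i)) ->
  Icirc (fun x => \sum_(i <- s) g i x) = \sum_(i <- s) Icirc (g i).
Proof. exact: (@bdm_Rintegral_sum R _ _ (@lebesgue_measure R) circ mc lc). Qed.

Lemma Icirc_le (g h : R -> R) : bdm g -> bdm h -> (forall x, circ x -> g x <= h x) ->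
  Icirc g <= Icirc h.
Proof. exact: (@bdm_le_Rintegral R _ _ (@lebesgue_measure R) circ mc lc). Qed.

Lemma Icirc_ge0 (g : R -> R) : (forall x, circ x -> 0 <= g x) -> 0 <= Icirc g.
Proof. by move=> g0; exact: (@Rintegral_ge0 _ _ _ (@lebesgue_measure R)). Qed.

Lemma eq_Icirc (g h : R -> R) : (forall x, circ x -> g x = h x) -> Icirc g = Icirc h.
Proof. by move=> gh; apply: eq_Rintegral => x; rewrite inE => /gh. Qed.

Lemma cont_bdm_cos (r : R) : bdm (fun x => cos (r * x)).
Proof.
split; last by exists 1 => x; exact: cos_max.
apply: continuous_measurable_fun => x.
apply: (@continuous_comp _ _ _ (fun x => r * x) (@cos R)); last exact: continuous_cos.
exact: mulrl_continuous.
Qed.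

Lemma cont_bdm_sin (r : R) : bdm (fun x => sin (r * x)).
Proof.
split; last by exists 1 => x; exact: sin_max.
apply: continuous_measurable_fun => x.
apply: (@continuous_comp _ _ _ (fun x => r * x) (@sin R)); last exact: continuous_sin.
exact: mulrl_continuous.
Qed.

Lemma Icirc_FTC (g G : R -> R) : continuous g -> continuous G -> bdm g ->
  (forall x : R, is_derive x 1 G (g x)) -> Icirc g = G (pi *+ 2) - G 0.
Proof.
move=> cg cG bg dG.
rewrite /Icirc /circ Rintegral_itv_bndo_bndc; last exact: (circ_integrable bg).
rewrite /Rintegral (@continuous_FTC2 _ g G)//.
- by rewrite mulrn_wgt0 ?pi_gt0.
- by apply: continuous_subspaceT => x; exact: cg.
- split.
  + by move=> x _; exact: ex_derive.
  + by apply/cvg_at_right_filter; exact: cG.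
  + by apply/cvg_at_left_filter; exact: cG.
- by move=> x _; rewrite derive1E; exact: derive_val.
Qed.

Lemma is_derive_scale (c : R) (g : R -> R) (x dg : R) :
  is_derive x 1 g dg -> is_derive x 1 (fun y => c * g y) (c * dg).
Proof. by move=> dgx; exact: (is_deriveZ c dgx). Qed.

Lemma is_derive_comp_scale (r : R) (g : R -> R) (x dg : R) :
  is_derive (r * x) 1 g dg -> is_derive x 1 (fun y => g (r * y)) (dg * (r * 1)).
Proof.
move=> dgx; have d0 := is_derive_scale r (is_derive_id x (1 : R)).
exact: (@is_derive1_comp _ g (fun y => r * y) x dg (r * 1) dgx d0).
Qed.

Lemma Icirc_cos (r : R) : r != 0 -> Icirc (fun x => cos (r * x)) = sin (r * (pi *+ 2)) / r.
Proof.
move=> r0.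
transitivity (r^-1 * sin (r * (pi *+ 2)) - r^-1 * sin (r * 0)); last first.
  by rewrite mulr0 sin0 mulr0 subr0 mulrC.
apply: (@Icirc_FTC (fun x => cos (r * x)) (fun x => r^-1 * sin (r * x))).
- move=> x; apply: (@continuous_comp _ _ _ (fun x => r * x) (@cos R)); last exact: continuous_cos.
  exact: mulrl_continuous.
- move=> x; apply: (@continuous_comp _ _ _ (fun x => sin (r * x)) (fun y => r^-1 * y)).
    apply: (@continuous_comp _ _ _ (fun x => r * x) (@sin R)); last exact: continuous_sin.
    exact: mulrl_continuous.
  exact: mulrl_continuous.
- exact: cont_bdm_cos.
- move=> x; apply: is_derive_eq (is_derive_scale r^-1 (is_derive_comp_scale (is_derive_sin (r * x)))) _.
  by field.
Qed.

Lemma Icirc_sin (r : R) : r != 0 -> Icirc (fun x => sin (r * x)) = (1 - cos (r * (pi *+ 2))) / r.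
Proof.
move=> r0.
transitivity (- r^-1 * cos (r * (pi *+ 2)) - - r^-1 * cos (r * 0)); last first.
  by rewrite mulr0 cos0; field.
apply: (@Icirc_FTC (fun x => sin (r * x)) (fun x => (- r^-1) * cos (r * x))).
- move=> x; apply: (@continuous_comp _ _ _ (fun x => r * x) (@sin R)); last exact: continuous_sin.
  exact: mulrl_continuous.
- move=> x; apply: (@continuous_comp _ _ _ (fun x => cos (r * x)) (fun y => - r^-1 * y)).
    apply: (@continuous_comp _ _ _ (fun x => r * x) (@cos R)); last exact: continuous_cos.
    exact: mulrl_continuous.
  exact: mulrl_continuous.
- exact: cont_bdm_sin.
- move=> x; apply: is_derive_eq (is_derive_scale (- r^-1) (is_derive_comp_scale (is_derive_cos (r * x)))) _.
  by field.
Qed.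

Lemma sin_nat2pi (k : nat) : sin (k%:R * (pi *+ 2)) = 0 :> R.
Proof.
by rewrite mulr_natl -[X in sin X]add0r (periodicn (@sinD2pi R)) sin0.
Qed.

Lemma cos_nat2pi (k : nat) : cos (k%:R * (pi *+ 2)) = 1 :> R.
Proof.
by rewrite mulr_natl -[X in cos X]add0r (periodicn (@cosD2pi R)) cos0.
Qed.

Lemma Icirc_cst (c : R) : Icirc (fun=> c) = c * (pi *+ 2).
Proof.
rewrite /Icirc (@Rintegral_cst _ _ _ (@lebesgue_measure R) circ mc).
by congr (_ * _); exact: (congr1 fine leb_circ).
Qed.

Lemma Icirc_cos_add (j k : nat) : (0 < j)%N ->
  Icirc (fun x : R => cos ((j%:R + k%:R) * x)) = 0.
Proof.
move=> j0; rewrite Icirc_cos; last by rewrite -natrD pnatr_eq0 -lt0n addn_gt0 j0.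
by rewrite -natrD sin_nat2pi mul0r.
Qed.

Lemma Icirc_cos_sub (j k : nat) :
  Icirc (fun x : R => cos ((j%:R - k%:R) * x)) = (pi *+ 2) *+ (j == k).
Proof.
have [->|jk] := eqVneq j k.
  under eq_Icirc do rewrite subrr mul0r cos0.
  by rewrite Icirc_cst mul1r.
rewrite Icirc_cos; last by rewrite subr_eq0 eqr_nat.
by rewrite mulrBl sinB !sin_nat2pi mulr0 mul0r subr0 mul0r.
Qed.

Lemma Icirc_sin_add (j k : nat) : Icirc (fun x : R => sin ((j%:R + k%:R) * x)) = 0.
Proof.
have [e|jk] := eqVneq (j%:R + k%:R : R) 0.
  under eq_Icirc do rewrite e mul0r sin0.
  by rewrite Icirc_cst mul0r.
by rewrite Icirc_sin// -natrD cos_nat2pi subrr mul0r.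
Qed.

Lemma Icirc_sin_sub (j k : nat) : Icirc (fun x : R => sin ((j%:R - k%:R) * x)) = 0.
Proof.
have [e|jk] := eqVneq (j%:R - k%:R : R) 0.
  under eq_Icirc do rewrite e mul0r sin0.
  by rewrite Icirc_cst mul0r.
rewrite Icirc_sin// [X in cos X]mulrBl cosB !cos_nat2pi !sin_nat2pi.
by rewrite mulr0 addr0 mulr1 subrr mul0r.
Qed.

Lemma Icirc_cos_cos (j k : nat) : (0 < j)%N ->
  Icirc (fun x : R => cos (j%:R * x) * cos (k%:R * x)) = pi *+ (j == k).
Proof.
move=> j0.
have -> : (fun x : R => cos (j%:R * x) * cos (k%:R * x)) =
    (fun x => 2^-1 * (cos ((j%:R - k%:R) * x) + cos ((j%:R + k%:R) * x))).
  by apply/funext => x; rewrite mulrBl mulrDl cosB cosD; lra.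
rewrite IcircZ; last by apply: bdmD; exact: cont_bdm_cos.
rewrite IcircD; [|exact: cont_bdm_cos..].
rewrite Icirc_cos_sub Icirc_cos_add// addr0.
by case: (j == k); rewrite ?mulr0n ?mulr0// !mulr1n; field.
Qed.

Lemma Icirc_sin_sin (j k : nat) : (0 < j)%N ->
  Icirc (fun x : R => sin (j%:R * x) * sin (k%:R * x)) = pi *+ (j == k).
Proof.
move=> j0.
have -> : (fun x : R => sin (j%:R * x) * sin (k%:R * x)) =
    (fun x => 2^-1 * (cos ((j%:R - k%:R) * x) - cos ((j%:R + k%:R) * x))).
  by apply/funext => x; rewrite mulrBl mulrDl cosB cosD; lra.
rewrite IcircZ; last by apply: bdmB; exact: cont_bdm_cos.
rewrite IcircB; [|exact: cont_bdm_cos..].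
rewrite Icirc_cos_sub Icirc_cos_add// subr0.
by case: (j == k); rewrite ?mulr0n ?mulr0// !mulr1n; field.
Qed.

Lemma Icirc_sin_cos (j k : nat) :
  Icirc (fun x : R => sin (j%:R * x) * cos (k%:R * x)) = 0.
Proof.
have -> : (fun x : R => sin (j%:R * x) * cos (k%:R * x)) =
    (fun x => 2^-1 * (sin ((j%:R - k%:R) * x) + sin ((j%:R + k%:R) * x))).
  by apply/funext => x; rewrite mulrBl mulrDl sinB sinD; lra.
rewrite IcircZ; last by apply: bdmD; exact: cont_bdm_sin.
rewrite IcircD; [|exact: cont_bdm_sin..].
by rewrite Icirc_sin_sub Icirc_sin_add addr0 mulr0.
Qed.

Lemma phi_bdm k : bdm (@phi R k).
Proof.
rewrite /phi; case: (k == 0)%N; first exact: bdm_cst.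
case: (odd k).
  by apply: bdmM; [exact: cont_bdm_cos|exact: bdm_cst].
by apply: bdmM; [exact: cont_bdm_sin|exact: bdm_cst].
Qed.

Let sqrtpi : Num.sqrt pi * Num.sqrt pi = pi :> R.
Proof. by rewrite -expr2 sqr_sqrtr ?pi_ge0. Qed.

Lemma phi0E x : phi 0 x = (Num.sqrt (pi *+ 2))^-1 :> R. Proof. by []. Qed.

Lemma phi_cosE j x : phi (j.*2.+1) x = cos (j.+1%:R * x) / Num.sqrt pi :> R.
Proof. by rewrite /phi /= odd_double /= doubleK. Qed.

Lemma phi_sinE j x : phi (j.+1.*2) x = sin (j.+1%:R * x) / Num.sqrt pi :> R.
Proof. by rewrite /phi doubleS /= odd_double /= doubleK. Qed.

Lemma phi_case k : [\/ k = 0%N, exists j, k = j.*2.+1 | exists j, k = j.+1.*2].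
Proof.
case: k => [|k]; first by constructor 1.
have := odd_double_half k; case: (odd k) => /= h.
  by constructor 3; exists k./2; rewrite -{1}h doubleS.
by constructor 2; exists k./2; rewrite -{1}h.
Qed.

Lemma Icirc_scale2 (c1 c2 : R) g h : bdm g -> bdm h ->
  Icirc (fun x => (g x * c1) * (h x * c2)) = (c1 * c2) * Icirc (fun x => g x * h x).
Proof.
move=> bg bh; rewrite -IcircZ; last exact: bdmM.
by apply: eq_Icirc => x _; ring.
Qed.

Lemma phi_orthonormal a b : Icirc (fun x : R => phi a x * phi b x) = (a == b)%:R.
Proof.
wlog ab : a b / (a <= b)%N.
  move=> h; have [/h//|/ltnW/h] := leqP a b; rewrite eq_sym => <-.
  by apply: eq_Icirc => x _; rewrite mulrC.
have pi_n0 : pi != 0 :> R by rewrite gt_eqF ?pi_gt0.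
have sq2 : Num.sqrt (pi *+ 2) * Num.sqrt (pi *+ 2) = pi *+ 2 :> R.
  by rewrite -expr2 sqr_sqrtr// mulrn_wge0// pi_ge0.
case: (phi_case a) => [aE|[j aE]|[j aE]]; case: (phi_case b) => [bE|[k bE]|[k bE]];
  rewrite aE bE in ab *.
- under eq_Icirc do rewrite phi0E.
  by rewrite Icirc_cst -invfM sq2 mulVf// gt_eqF// mulrn_wgt0// pi_gt0.
- under eq_Icirc do rewrite phi0E phi_cosE -[X in X * (_ * _)]mul1r.
  rewrite Icirc_scale2; [|exact: (bdm_cst 1)|exact: cont_bdm_cos].
  under eq_Icirc do rewrite mul1r.
  by rewrite Icirc_cos ?pnatr_eq0// sin_nat2pi mul0r mulr0.
- under eq_Icirc do rewrite phi0E phi_sinE -[X in X * (_ * _)]mul1r.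
  rewrite Icirc_scale2; [|exact: (bdm_cst 1)|exact: cont_bdm_sin].
  under eq_Icirc do rewrite mul1r.
  by rewrite Icirc_sin ?pnatr_eq0// cos_nat2pi subrr mul0r mulr0.
- by rewrite leqn0 in ab.
- under eq_Icirc do rewrite !phi_cosE.
  rewrite Icirc_scale2; [|exact: cont_bdm_cos..].
  rewrite Icirc_cos_cos// -invfM sqrtpi eqSS (eqSS j.*2) -!muln2 eqn_pmul2r//.
  by case: (j == k); rewrite ?mulr0// mulVf.
- under eq_Icirc do rewrite phi_cosE phi_sinE.
  rewrite Icirc_scale2; [|exact: cont_bdm_cos|exact: cont_bdm_sin].
  under eq_Icirc do rewrite mulrC.
  rewrite Icirc_sin_cos mulr0.
  by rewrite (_ : _ == _ = false)//; apply/negbTE/eqP => /(congr1 odd); rewrite /= !odd_double.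
- by rewrite leqn0 double_eq0 in ab.
- under eq_Icirc do rewrite phi_cosE phi_sinE.
  rewrite Icirc_scale2; [|exact: cont_bdm_sin|exact: cont_bdm_cos].
  rewrite Icirc_sin_cos mulr0.
  by rewrite (_ : _ == _ = false)//; apply/negbTE/eqP => /(congr1 odd); rewrite /= !odd_double.
- under eq_Icirc do rewrite !phi_sinE.
  rewrite Icirc_scale2; [|exact: cont_bdm_sin..].
  rewrite Icirc_sin_sin// -invfM sqrtpi -!muln2 eqn_pmul2r//.
  by case: (_ == _); rewrite ?mulr0// mulVf.
Qed.

(** Each frequency contributes [cos^2 + sin^2 = 1]. That the sum does not depend on [x] makes the
    diagonal deterministically bounded and is the source of [D_m / (2 pi)] in the penalty. *)
Lemma phi_sumsq m x : \sum_(a < Dm m) phi a x ^+ 2 = (Dm m)%:R / (pi *+ 2) :> R.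
Proof.
have pi_n0 : pi != 0 :> R by rewrite gt_eqF ?pi_gt0.
rewrite /Dm; elim: m => [|m IH].
  rewrite big_ord_recl big_ord0 addr0 phi0E exprVn sqr_sqrtr ?mul1r//.
  by rewrite mulrn_wge0// pi_ge0.
rewrite doubleS 2!big_ord_recr /= IH -doubleS phi_cosE phi_sinE.
rewrite !exprMn !exprVn sqr_sqrtr ?pi_ge0// -addrA -mulrDl cos2Dsin2.
rewrite (_ : m.*2.+3%:R = m.*2.+1%:R + 2 :> R); last by rewrite -natrD addn2.
by move: pi pi_n0 => c c0; field.
Qed.

End trigonometric_basis.

(** * Square norms and arcs on the circle *)

Section circle_L2.
Variable R : realType.
Implicit Types (g h : R -> R) (c : nat -> R).

Lemma Icirc_cauchy_schwarz g h : bdm g -> bdm h ->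
  Icirc (fun x => g x * h x) ^+ 2 <= L2sq g * L2sq h.
Proof.
move=> bg bh; apply: discriminant_le0.
- by apply: Icirc_ge0 => x _; exact: sqr_ge0.
- by apply: Icirc_ge0 => x _; exact: sqr_ge0.
move=> t; have b1 := bdmX 2 bg; have b2 := bdmX 2 bh; have b3 := bdmM bg bh.
have -> : L2sq g + t * Icirc (fun x => g x * h x) *+ 2 + t ^+ 2 * L2sq h =
    Icirc (fun x => g x ^+ 2 + 2 * t * (g x * h x) + t ^+ 2 * h x ^+ 2).
  rewrite (IcircD (bdmD b1 (bdmZ (2 * t) b3)) (bdmZ (t ^+ 2) b2)).
  rewrite (IcircD b1 (bdmZ (2 * t) b3)) (IcircZ _ b3) (IcircZ _ b2) /L2sq.
  by ring.
apply: Icirc_ge0 => x _.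
have -> : g x ^+ 2 + 2 * t * (g x * h x) + t ^+ 2 * h x ^+ 2 = (g x + t * h x) ^+ 2 by ring.
exact: sqr_ge0.
Qed.

(** Coefficients are sequences on [nat], so that elements of different [S_m] can be compared without
    casts between ordinals. *)
Definition trigpoly (m : nat) c (x : R) : R := \sum_(a < Dm m) c a * phi a x.

Lemma trigpoly_bdm m c : bdm (trigpoly m c).
Proof. by apply: bdm_sum => a; apply: bdmZ; exact: phi_bdm. Qed.

Lemma Icirc_trigpoly_mul m c g : bdm g ->
  Icirc (fun x => trigpoly m c x * g x) = \sum_(a < Dm m) c a * Icirc (fun x => g x * phi a x).
Proof.
move=> bg.
have -> : (fun x => trigpoly m c x * g x) =
    (fun x => \sum_(a < Dm m) c a * (g x * phi a x)).
  by apply/funext => x; rewrite mulr_suml; apply: eq_bigr => a _; ring.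
have b a : bdm (fun x => g x * phi a x) by apply: bdmM => //; exact: phi_bdm.
rewrite Icirc_sum; last by move=> a; exact: bdmZ.
by apply: eq_bigr => a _; rewrite IcircZ.
Qed.

Lemma parseval m c : L2sq (trigpoly m c) = \sum_(a < Dm m) c a ^+ 2.
Proof.
have -> : L2sq (trigpoly m c) = Icirc (fun x => trigpoly m c x * trigpoly m c x).
  by apply: eq_Icirc => x _; rewrite expr2.
rewrite Icirc_trigpoly_mul; last exact: trigpoly_bdm.
apply: eq_bigr => a _; rewrite Icirc_trigpoly_mul; last exact: phi_bdm.
rewrite (bigD1 a)//= phi_orthonormal eqxx mulr1 big1 ?addr0 ?expr2// => b ba.
by rewrite phi_orthonormal eq_sym (_ : _ == _ = false) ?mulr0//; apply/negbTE.
Qed.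

Lemma bessel m g : bdm g -> \sum_(a < Dm m) Icirc (fun x => g x * phi a x) ^+ 2 <= L2sq g.
Proof.
move=> bg; pose c (a : nat) := Icirc (fun x => g x * phi a x).
have bt := trigpoly_bdm m c.
have h : 0 <= L2sq (fun x => g x - trigpoly m c x).
  by apply: Icirc_ge0 => x _; exact: sqr_ge0.
have e : L2sq (fun x => g x - trigpoly m c x) =
    L2sq g - \sum_(a < Dm m) c a ^+ 2.
  have -> : L2sq (fun x => g x - trigpoly m c x) =
     Icirc (fun x => (g x ^+ 2 - 2 * (trigpoly m c x * g x)) + trigpoly m c x ^+ 2).
    by apply: eq_Icirc => x _; ring.
  have b1 := bdmX 2 bg; have b2 := bdmX 2 bt; have b3 := bdmM bt bg.
  rewrite IcircD//; last by apply: bdmB => //; exact: bdmZ.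
  rewrite IcircB//; last exact: bdmZ.
  rewrite IcircZ// Icirc_trigpoly_mul// -/(L2sq (trigpoly m c)) parseval -/(L2sq g).
  under eq_bigr do rewrite -expr2.
  by rewrite /c; ring.
by move: h; rewrite e subr_ge0.
Qed.

Lemma L2sq_ge0 g : 0 <= L2sq g.
Proof. by apply: Icirc_ge0 => x _; exact: sqr_ge0. Qed.

Lemma L2sqB_le g h : bdm g -> bdm h -> L2sq (fun x => g x - h x) <= 2 * L2sq g + 2 * L2sq h.
Proof.
move=> bg bh; have b1 := bdmX 2 bg; have b2 := bdmX 2 bh.
rewrite -!IcircZ// -IcircD; [|exact: bdmZ..].
apply: Icirc_le.
- by apply: bdmX; exact: bdmB.
- by apply: bdmD; exact: bdmZ.
move=> x _; rewrite -subr_ge0.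
have -> : 2 * g x ^+ 2 + 2 * h x ^+ 2 - (g x - h x) ^+ 2 = (g x + h x) ^+ 2 by ring.
exact: sqr_ge0.
Qed.

(** The joint graph in the point and the end points: its measurability serves all sections, in [x]
    for fixed arcs and in the arc for fixed [x]. *)
Definition arc_set : set (R * (R * R)) := [set z | arc z.2.1 z.2.2 z.1].

Lemma measurable_le_set d (T : measurableType d) (g h : T -> R) :
  measurable_fun setT g -> measurable_fun setT h -> measurable [set x | g x <= h x].
Proof.
move=> mg mh; have := measurable_fun_ler mg mh => /(_ measurableT [set true]).
by rewrite setTI => /(_ _)H; apply: H.
Qed.

Lemma measurable_lt_set d (T : measurableType d) (g h : T -> R) :
  measurable_fun setT g -> measurable_fun setT h -> measurable [set x | g x < h x].
Proof.
move=> mg mh; have := measurable_fun_ltr mg mh => /(_ measurableT [set true]).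
by rewrite setTI => /(_ _)H; apply: H.
Qed.

Lemma arcE (l u x : R) : arc l u x <->
  (l <= u /\ (l <= x /\ x <= u)) \/ (u < l /\ ((l <= x /\ x < pi *+ 2) \/ (0 <= x /\ x <= u))).
Proof.
rewrite /arc; case: (leP l u) => lu /=; split.
- by rewrite in_itv /= => /andP[? ?]; left.
- by case=> [[_ [? ?]]|[//]]; rewrite in_itv /=; apply/andP.
- by case=> /=; rewrite in_itv /= => /andP[? ?]; right; split => //; [left|right].
- case=> [[//]|[_ [[? ?]|[? ?]]]]; [left|right] => /=; rewrite in_itv /=; exact/andP.
Qed.

Lemma measurable_arc_set : measurable arc_set.
Proof.
have m1 : measurable_fun setT (fun z : R * (R * R) => z.1) by exact: measurable_fst.
have m21 : measurable_fun setT (fun z : R * (R * R) => z.2.1).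
  exact: (measurableT_comp measurable_fst measurable_snd).
have m22 : measurable_fun setT (fun z : R * (R * R) => z.2.2).
  exact: (measurableT_comp measurable_snd measurable_snd).
have mc (c : R) : measurable_fun setT (fun _ : R * (R * R) => c) by exact: measurable_cst.
have -> : arc_set =
  ([set z | z.2.1 <= z.2.2] `&` ([set z | z.2.1 <= z.1] `&` [set z | z.1 <= z.2.2])) `|`
  ([set z | z.2.2 < z.2.1] `&` (([set z | z.2.1 <= z.1] `&` [set z | z.1 < pi *+ 2]) `|`
     ([set z | 0 <= z.1] `&` [set z | z.1 <= z.2.2]))).
  by apply/seteqP; split => z; [move/arcE|move=> h; apply/arcE].
apply: measurableU; apply: measurableI; [exact: measurable_le_set| |exact: measurable_lt_set|].
  by apply: measurableI; exact: measurable_le_set.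
apply: measurableU; apply: measurableI;
  [exact: measurable_le_set|exact: measurable_lt_set|exact: measurable_le_set..].
Qed.

Lemma arc_indicE (l u x : R) : \1_(arc l u) x = \1_arc_set (x, (l, u)) :> R.
Proof. by rewrite !indicE. Qed.

Lemma arc_indic_bdm (l u : R) : bdm (\1_(arc l u) : R -> R).
Proof.
have -> : (\1_(arc l u) : R -> R) = (fun x => \1_arc_set (x, (l, u))).
  by apply/funext => x; rewrite arc_indicE.
apply: (@bdm_comp R _ _ _ _ (fun x : R => (x, (l, u)))).
  exact: measurable_fun_pair.
apply: bdm_indic; exact: measurable_arc_set.
Qed.

Lemma arc_sub_circ (l u : R) : circ l -> circ u -> arc l u `<=` circ.
Proof.
rewrite /circ /= !in_itv /= => /andP[l0 l1] /andP[u0 u1] x /arcE h /=.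
by rewrite in_itv /=; move: (pi *+ 2) l1 u1 h => p l1 u1 h; case: h => [[_ [? ?]]|[_ [[? ?]|[? ?]]]]; apply/andP; split; lra.
Qed.

Lemma Rintegral_arc (l u : R) g : circ l -> circ u ->
  Rintegral leb (arc l u) g = Icirc (fun x => \1_(arc l u) x * g x).
Proof.
move=> cl cu; rewrite /Icirc Rintegral_mkcond [RHS]Rintegral_mkcond.
apply: eq_Rintegral => x _; rewrite !patchE indicE.
have [h|h] := boolP (x \in arc l u); last by rewrite mul0r; case: ifP.
rewrite mul1r ifT//; move: h; rewrite !inE; exact: arc_sub_circ.
Qed.

End circle_L2.
Arguments arc_set {R}.

(** * The law of the sample *)

Section product_laws.
Context {R : realType}.

Lemma prod_measure_eq d1 d2 (T1 : measurableType d1) (T2 : measurableType d2)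
    (m1 m2 : {measure set (T1 * T2) -> \bar R}) :
  (m1 setT < +oo)%E ->
  (forall A B, measurable A -> measurable B -> m1 (A `*` B) = m2 (A `*` B)) ->
  forall C, measurable C -> m1 C = m2 C.
Proof.
move=> m1fin h C mC.
apply: (@measure_unique _ _ _ [set A `*` B | A in @measurable _ T1 & B in @measurable _ T2]
  (fun=> setT)) => //.
- exact: measurable_prod_measurableType.
- move=> _ _ [A1 mA1 [B1 mB1 <-]] [A2 mA2 [B2 mB2 <-]].
  exists (A1 `&` A2); first exact: measurableI.
  by exists (B1 `&` B2); [exact: measurableI|rewrite setXI].
- by move=> i; exists setT => //; exists setT => //; rewrite setXTT.
- exact: bigcup_const.
- by move=> _ [A mA [B mB <-]]; exact: h.
Qed.

Context {d : measure_display} {Om : measurableType d} (P : probability Om R).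

Definition rv_of {dT} {T : measurableType dT} (Z : Om -> T)
  (mZ : measurable_fun setT Z) : {RV P >-> T} := mfun_Sub (mem_set mZ).

(** In [C] both sides are finite measures, push-forwards of [P] restricted to [D] and of [q] times
    [P], and rectangles determine a finite measure. *)
Lemma indep_rect_measurable d1 d2 (T1 : measurableType d1) (T2 : measurableType d2)
    (Z : Om -> T1 * T2) (D : set Om) (q : R) : measurable_fun setT Z -> measurable D -> 0 <= q ->
  (forall A B, measurable A -> measurable B ->
     P (D `&` Z @^-1` (A `*` B)) = (q%:E * P (Z @^-1` (A `*` B)))%E) ->
  forall C, measurable C -> P (D `&` Z @^-1` C) = (q%:E * P (Z @^-1` C))%E.
Proof.
move=> mZ mD q0 h C mC.
pose m1 := measure_function_pushforward__canonical__measure_function_Measure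
  (mrestr P mD) mZ.
pose m2 := measure_function_pushforward__canonical__measure_function_Measure
  (mscale (NngNum q0) P) mZ.
have m1E A : m1 A = P (D `&` Z @^-1` A) by rewrite /m1 /= /pushforward /mrestr setIC.
have m2E A : m2 A = (q%:E * P (Z @^-1` A))%E by rewrite /m2 /= /pushforward /mscale.
rewrite -m1E -m2E; apply: prod_measure_eq => //.
  rewrite m1E preimage_setT setIT.
  by apply: le_lt_trans (probability_le1 P mD) _; rewrite ltry.
by move=> A B mA mB; rewrite m1E m2E; exact: h.
Qed.

End product_laws.

Section sample_law.
Context {R : realType} {d : measure_display} {Om : measurableType d}.
Variables (P : probability Om R) (n : nat) (X L U : nat -> Om -> R)
  (f : R -> R) (nu : probability (R * R)%type R) (v : R).
Hypothesis n0 : (0 < n)%N.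
Hypotheses (mX : forall i, measurable_fun setT (X i))
  (mL : forall i, measurable_fun setT (L i)) (mU : forall i, measurable_fun setT (U i)).
Hypotheses (mf : measurable_fun setT f) (f0 : forall x, 0 <= f x) (fv : forall x, f x <= v).
Hypothesis law : forall (A : nat -> set R) (B : nat -> set (R * R)%type),
  (forall i, measurable (A i)) -> (forall i, measurable (B i)) ->
  P (\bigcap_(i in `I_n) [set w | A i (X i w) /\ B i (L i w, U i w)]) =
  (\prod_(i < n) ((\int[leb]_(x in A i `&` circ) (f x)%:E) * nu (B i)))%E.

Definition sample i w : R * (R * R) := (X i w, (L i w, U i w)).

Lemma msample i : measurable_fun setT (sample i).
Proof. by apply: measurable_fun_pair => //; exact: measurable_fun_pair. Qed.

Lemma f_bdm : bdm f.
Proof. by split => //; exists v => x; rewrite ger0_norm. Qed.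

Lemma density_integral (A : set R) : measurable A ->
  (\int[leb]_(x in A `&` circ) (f x)%:E)%E = (Icirc (fun x => \1_A x * f x))%:E.
Proof.
move=> mA.
have bAf : bdm (fun x => \1_A x * f x) by apply: bdmM; [exact: bdm_indic|exact: f_bdm].
have := @bdm_integralE R _ _ (@lebesgue_measure R) circ (@measurable_circ R)
  (@leb_circ_fin R) _ bAf.
move=> /esym; rewrite /Icirc => ->.
rewrite /leb [LHS]integral_mkcond [RHS]integral_mkcond.
apply: (@eq_integral _ _ _ (@lebesgue_measure R)) => x _.
rewrite !patchE in_setI indicE.
by case: (x \in A) => /=; rewrite ?mul1r ?mul0r//; case: ifP.
Qed.

Lemma rect_law (A : nat -> set R) (B : nat -> set (R * R)%type) :
  (forall i, measurable (A i)) -> (forall i, measurable (B i)) ->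
  P (\bigcap_(i in `I_n) (sample i @^-1` (A i `*` B i))) =
  (\prod_(i < n) (Icirc (fun x => \1_(A i) x * f x) * fine (nu (B i))))%:E.
Proof.
move=> mA mB; rewrite -[LHS]/(P (\bigcap_(i in `I_n) [set w | A i (X i w) /\ B i (L i w, U i w)])).
rewrite law// -prodEFin; apply: eq_bigr => i _.
by rewrite density_integral// EFinM; congr (_ * _)%E; rewrite fineK// fin_num_measure.
Qed.

(** Full sets in the product formula for the law give [(Icirc f) ^ n = 1]. *)
Lemma Icirc_density : Icirc f = 1.
Proof.
have := @rect_law (fun=> setT) (fun=> setT) (fun=> measurableT) (fun=> measurableT).
rewrite (_ : \bigcap_(i in `I_n) _ = setT); last first.
  by apply/seteqP; split => // w _ i _.
rewrite probability_setT prodr_const card_ord.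
have -> : Icirc (fun x => \1_setT x * f x) = Icirc f.
  by apply: eq_Icirc => x _; rewrite indicE in_setT mul1r.
have -> : fine (nu setT) = 1 by rewrite probability_setT.
rewrite mulr1 => -[] /esym/eqP.
by rewrite pexpr_eq1 ?Icirc_ge0// => /eqP.
Qed.

Lemma sample_rect i A B : (i < n)%N -> measurable A -> measurable B ->
  P (sample i @^-1` (A `*` B)) = (Icirc (fun x => \1_A x * f x) * fine (nu B))%:E.
Proof.
move=> ni mA mB.
pose A' j := if j == i then A else setT; pose B' j := if j == i then B else setT.
have mA' j : measurable (A' j) by rewrite /A'; case: ifP.
have mB' j : measurable (B' j) by rewrite /B'; case: ifP.
have := rect_law mA' mB'.
rewrite (_ : \bigcap_(j in `I_n) _ = sample i @^-1` (A `*` B)); last first.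
  apply/seteqP; split => w.
    by move=> /(_ i ni); rewrite /A' /B' eqxx.
  by move=> h j _; rewrite /A' /B'; case: eqP => [->|].
move=> ->; congr EFin; rewrite (bigD1 (Ordinal ni))//= /A' /B' eqxx big1 ?mulr1// => j ji.
have /negbTE -> : (nat_of_ord j != i)%N := ji.
rewrite probability_setT mulr1 -[RHS]Icirc_density.
by apply: eq_Icirc => x _; rewrite indicE in_setT mul1r.
Qed.

(** The law is given on rectangles only. Coordinates are released one at a time to arbitrary
    measurable sets, the others being frozen in [D], and [indep_rect_measurable] performs each
    release. *)
Lemma sample_indep (C : nat -> set (R * (R * R))) : (forall i, measurable (C i)) ->
  P (\bigcap_(i in `I_n) (sample i @^-1` C i)) = (\prod_(i < n) P (sample i @^-1` C i))%E.
Proof.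
pose p i D := fine (P (sample i @^-1` D)).
have mpre i D : measurable D -> measurable (sample i @^-1` D).
  by move=> mD; rewrite -[X in measurable X]setTI; exact: msample.
have pE i D : measurable D -> P (sample i @^-1` D) = (p i D)%:E.
  by move=> mD; rewrite fineK// fin_num_measure//; exact: mpre.
suff main k : forall C : nat -> set (R * (R * R)), (forall i, measurable (C i)) ->
    (forall i, (k <= i < n)%N -> exists A B, [/\ measurable A, measurable B & C i = A `*` B]) ->
    P (\bigcap_(i in `I_n) (sample i @^-1` C i)) = (\prod_(i < n) p i (C i))%:E.
  move=> mC; rewrite (main n)//; last by move=> i; rewrite leqNgt andNb.
  by rewrite -prodEFin; apply: eq_bigr => i _; rewrite pE.
elim: k => [|k IH] {}C mC rC.
  have /choice[AB hAB] : forall i, exists AB : set R * set (R * R),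
      [/\ measurable AB.1, measurable AB.2 & (i < n)%N -> C i = AB.1 `*` AB.2].
    move=> i; case: (ltnP i n) => ni.
      by have [A [B [mA mB CE]]] := rC i ni; exists (A, B).
    exists (setT, setT); split; [exact: (@measurableT _ R)|exact: (@measurableT _ (R * R)%type)|by []].
  have mA i : measurable (AB i).1 by case: (hAB i).
  have mB i : measurable (AB i).2 by case: (hAB i).
  rewrite (_ : \bigcap_(i in `I_n) _ =
      \bigcap_(i in `I_n) (sample i @^-1` ((AB i).1 `*` (AB i).2))); last first.
    by apply: eq_bigcapr => i /= ni; have [_ _ ->] := hAB i.
  rewrite rect_law//; congr EFin; apply: eq_bigr => i _.
  by have [_ _ ->//] := hAB i; rewrite /p sample_rect.
have [nk|kn] := leqP n k.
  apply: IH => // i /andP[ki ni].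
  by have := leq_trans ni (leq_trans nk ki); rewrite ltnn.
pose ok := Ordinal kn.
pose D := \bigcap_(i in `I_n) (sample i @^-1` (if i == k then setT else C i)).
pose q := \prod_(i < n | i != ok) p i (C i).
have updE E : measurable E -> P (\bigcap_(i in `I_n) (sample i @^-1` (if i == k then E else C i))) =
     (\prod_(i < n) p i (if i == k :> nat then E else C i))%:E ->
   P (\bigcap_(i in `I_n) (sample i @^-1` (if i == k then E else C i))) = (q%:E * P (sample k @^-1` E))%E.
  move=> mE ->; rewrite pE// -EFinM; congr EFin; rewrite (bigD1 ok)//= eqxx mulrC; congr (_ * _).
  by apply: eq_bigr => i ik; have /negbTE -> : (nat_of_ord i != k)%N := ik.
have DE E : \bigcap_(i in `I_n) (sample i @^-1` (if i == k then E else C i)) =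
    D `&` sample k @^-1` E.
  apply/seteqP; split => w.
    move=> h; split; last by have := h k kn; rewrite eqxx.
    by move=> i ni; have := h i ni; case: eqP.
  move=> [h1 h2] i ni; case: eqP => [->//|/eqP ik].
  by have := h1 i ni; rewrite (negbTE ik).
have mD : measurable D.
  by apply: bigcap_measurableType => i _; apply: mpre; case: ifP.
have q0 : 0 <= q.
  by apply: prodr_ge0 => i _; rewrite /p fine_ge0.
have rectD A B : measurable A -> measurable B ->
    P (D `&` sample k @^-1` (A `*` B)) = (q%:E * P (sample k @^-1` (A `*` B)))%E.
  move=> mA mB; have mAB : measurable (A `*` B) by exact: measurableX.
  rewrite -DE updE//; apply: (IH (fun i => if i == k then A `*` B else C i)) => i.
    by case: ifP.
  case: eqP => [_ _|/eqP ik /andP[ki ni]]; first by exists A, B.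
  by apply: rC; rewrite ltn_neqAle eq_sym ik ki.
have := indep_rect_measurable (msample k) mD q0 rectD (mC k).
rewrite -DE => e.
rewrite (_ : \bigcap_(i in `I_n) (sample i @^-1` C i) =
   \bigcap_(i in `I_n) (sample i @^-1` (if i == k then C k else C i))); last first.
  by apply: eq_bigcapr => i _; case: eqP => [->|].
rewrite e pE// -EFinM; congr EFin; rewrite [RHS](bigD1 ok)//= mulrC.
by [].
Qed.

End sample_law.

(** * Moments of the centred noise *)

Section sample_moments.
Context {R : realType} {d : measure_display} {Om : measurableType d}.
Variables (P : probability Om R) (n : nat) (X L U : nat -> Om -> R)
  (f : R -> R) (nu : probability (R * R)%type R) (v : R).
Hypothesis n0 : (0 < n)%N.
Hypotheses (mX : forall i, measurable_fun setT (X i))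
  (mL : forall i, measurable_fun setT (L i)) (mU : forall i, measurable_fun setT (U i)).
Hypotheses (mf : measurable_fun setT f) (f0 : forall x, 0 <= f x) (fv : forall x, f x <= v).
Hypothesis law : forall (A : nat -> set R) (B : nat -> set (R * R)%type),
  (forall i, measurable (A i)) -> (forall i, measurable (B i)) ->
  P (\bigcap_(i in `I_n) [set w | A i (X i w) /\ B i (L i w, U i w)]) =
  (\prod_(i < n) ((\int[leb]_(x in A i `&` circ) (f x)%:E) * nu (B i)))%E.

Local Notation E F := (\int[P]_w F w)%R.
Local Notation sample := (sample X L U).
Local Notation LU i := (fun w => (L i w, U i w)).

Let bf : bdm f := f_bdm mf f0 fv.
Let Pfin : (P setT < +oo)%E.
Proof. by rewrite probability_setT ltry. Qed.
Let ms i : measurable_fun setT (sample i) := msample mX mL mU i.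
Let mLU i : measurable_fun setT (LU i).
Proof. exact: measurable_fun_pair. Qed.
Let v0 : 0 <= v := le_trans (f0 0) (fv 0).

Lemma density_bound_gt0 : 0 < v.
Proof.
rewrite lt_neqAle v0 andbT eq_sym; apply/eqP => vE.
have := Icirc_density n0 mf f0 fv law.
have -> : Icirc f = Icirc (fun=> 0).
  by apply: eq_Icirc => x _; apply/le_anti; rewrite f0 -vE fv.
by rewrite Icirc_cst mul0r => /esym/eqP; rewrite oner_eq0.
Qed.

Lemma L2sq_density : L2sq f <= v.
Proof.
rewrite -[leRHS]mulr1 -(Icirc_density n0 mf f0 fv law) -IcircZ//.
apply: Icirc_le; [exact: bdmX|exact: bdmZ|].
by move=> x _; rewrite expr2 ler_wpM2r.
Qed.

Lemma law_X i A : (i < n)%N -> measurable A ->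
  P (X i @^-1` A) = (Icirc (fun x => \1_A x * f x))%:E.
Proof.
move=> ni mA; have := sample_rect n0 mf f0 fv law ni mA (@measurableT _ (R * R)%type).
rewrite probability_setT mulr1 => <-; congr (P _).
by apply/seteqP; split => w //= -[].
Qed.

Lemma law_LU i B : (i < n)%N -> measurable B -> P (LU i @^-1` B) = nu B.
Proof.
move=> ni mB; have := sample_rect n0 mf f0 fv law ni (@measurableT _ R) mB.
have -> : Icirc (fun x => \1_setT x * f x) = 1.
  rewrite -[RHS](Icirc_density n0 mf f0 fv law).
  by apply: eq_Icirc => x _; rewrite indicE in_setT mul1r.
rewrite mul1r fineK ?fin_num_measure// => <-; congr (P _).
by apply/seteqP; split => w //= -[].
Qed.

Lemma mean_X i g : (i < n)%N -> bdm g -> E (fun w => g (X i w)) = Icirc (fun x => g x * f x).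
Proof.
move=> ni bg; apply/eqP; rewrite -subr_eq0; apply/eqP.
pose Phi (g : R -> R) := E (fun w => g (X i w)) - Icirc (fun x => g x * f x).
rewrite -/(Phi g); apply: bdm_functional_eq0 bg; rewrite /Phi.
- move=> g1 g2 b1 b2; rewrite (bdm_RintegralD measurableT Pfin); [|exact: bdm_comp..].
  rewrite (_ : (fun x => (g1 x + g2 x) * f x) = (fun x => g1 x * f x + g2 x * f x)); last first.
    by apply/funext => x; rewrite mulrDl.
  rewrite IcircD; [ring|exact: bdmM..].
- move=> c g1 b1; rewrite (bdm_RintegralZ measurableT Pfin); last exact: bdm_comp.
  rewrite (_ : (fun x => c * g1 x * f x) = (fun x => c * (g1 x * f x))); last first.
    by apply/funext => x; rewrite mulrA.
  rewrite IcircZ; [ring|exact: bdmM].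
- exists (1 + fine (lebesgue_measure (circ : set R)) * v) => g1 c b1 g1c.
  rewrite (le_trans (ler_normB _ _))// mulrDl mul1r lerD//.
    by apply: mean_norm_le => //; exact: bdm_comp.
  have bgf := bdmM b1 bf.
  have := @bdm_Rintegral_abs_le R _ _ (@lebesgue_measure R) circ (@measurable_circ R)
    (@leb_circ_fin R) _ (v * c) bgf.
  rewrite mulrA; apply => x _; rewrite normrM mulrC ler_pM// ger0_norm//.
- move=> A mA; apply/eqP; rewrite subr_eq0; apply/eqP.
  rewrite -[LHS]/(E (\1_(X i @^-1` A))) mean_indic; last first.
    by rewrite -[X in measurable X]setTI; exact: mX.
  by rewrite law_X.
Qed.

Lemma section_bdm (h : R * (R * R) -> R) p : bdm h -> bdm (fun x => h (x, p)).
Proof. by move=> bh; apply: (bdm_comp (Z := fun x : R => (x, p))) => //; exact: measurable_fun_pair. Qed.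

(** Conditional mean of [h] given that the arc is [p], since [X_i] is independent of
    [(L_i, U_i)]. *)
Definition partial_mean (h : R * (R * R) -> R) p := Icirc (fun x => h (x, p) * f x).

(** The law of the triple is the product of the laws of [X_i] and [(L_i, U_i)], so both the
    measurability and the identity come from Tonelli's theorem. *)
Let partial_mean_ge0 (h : R * (R * R) -> R) i : (i < n)%N -> bdm h -> (forall z, 0 <= h z) ->
  measurable_fun setT (partial_mean h) /\
  (\int[P]_w (h (sample i w))%:E = \int[P]_w (partial_mean h (LU i w))%:E)%E.
Proof.
move=> ni bh h0.
pose m1 : probability R R := distribution P (rv_of P (mX i)).
pose m2 : probability (R * R)%type R := distribution P (rv_of P (mLU i)).
pose m' : probability (R * (R * R))%type R := distribution P (rv_of P (ms i)).
have mh : measurable_fun setT (EFin \o h) by apply/measurable_EFinP; exact: bh.1.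
have GE p : fubini_G m1 (EFin \o h) p = (partial_mean h p)%:E.
  rewrite /fubini_G /m1 ge0_integral_distribution//=; last first.
  - by move=> x; rewrite lee_fin.
  - by apply/measurable_EFinP; exact: (section_bdm p bh).1.
  rewrite (bdm_integralE measurableT Pfin); last first.
    exact: (bdm_comp (mX i) (section_bdm p bh)).
  by rewrite (mean_X ni (section_bdm p bh)).
have mG : measurable_fun setT (partial_mean h).
  apply/measurable_EFinP.
  have -> : EFin \o partial_mean h = fubini_G m1 (EFin \o h).
    by apply/funext => p; rewrite /= GE.
  by apply: measurable_fun_fubini_tonelli_G => // z; rewrite lee_fin.
split => //.
have <- : (\int[m']_z (h z)%:E = \int[P]_w (h (sample i w))%:E)%E.
  by rewrite /m' ge0_integral_distribution// => z; rewrite lee_fin.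
have -> : (\int[m']_z (h z)%:E = \int[m1 \x m2]_z (h z)%:E)%E.
  apply: eq_measure_integral => A mA _; apply/esym.
  apply: product_measure_unique mA => A1 B1 mA1 mB1.
  have e : P (sample i @^-1` (A1 `*` B1)) = (P (X i @^-1` A1) * P (LU i @^-1` B1))%E.
    rewrite (sample_rect n0 mf f0 fv law ni mA1 mB1) law_X// law_LU// EFinM.
    by congr (_ * _)%E; rewrite fineK// fin_num_measure.
  exact: e.
have h0' z : (0 <= (EFin \o h) z)%E by rewrite lee_fin.
have mG' : measurable_fun setT (EFin \o partial_mean h) by exact/measurable_EFinP.
have G0' p : (0 <= (EFin \o partial_mean h) p)%E.
  by rewrite lee_fin; apply: Icirc_ge0 => x _; rewrite mulr_ge0.
rewrite (fubini_tonelli2 _ mh h0').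
under eq_integral do rewrite GE.
exact: (ge0_integral_distribution (rv_of P (mLU i)) mG' G0').
Qed.

Lemma partial_mean_bound h c p : bdm h -> (forall z, `|h z| <= c) ->
  `|partial_mean h p| <= fine (lebesgue_measure (circ : set R)) * (c * v).
Proof.
move=> bh hc; have bgf := bdmM (section_bdm p bh) bf.
apply: (@bdm_Rintegral_abs_le R _ _ (@lebesgue_measure R) circ (@measurable_circ R)
    (@leb_circ_fin R) _ (c * v) bgf) => x _.
by rewrite normrM ler_pM// ger0_norm.
Qed.

Lemma partial_meanP (h : R * (R * R) -> R) : bdm h ->
  bdm (partial_mean h) /\
  forall i, (i < n)%N -> E (fun w => h (sample i w)) = E (fun w => partial_mean h (LU i w)).
Proof.
have pos (k : R * (R * R) -> R) : bdm k -> (forall z, 0 <= k z) -> bdm (partial_mean k) /\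
  forall i, (i < n)%N -> E (fun w => k (sample i w)) = E (fun w => partial_mean k (LU i w)).
  move=> bk k0; have bp : bdm (partial_mean k).
    split; first exact: (partial_mean_ge0 n0 bk k0).1.
    have [_ [c kc]] := bk; eexists => p; exact: (partial_mean_bound p bk kc).
  by split => // i ni; rewrite /Rintegral (partial_mean_ge0 ni bk k0).2.
move=> bh; have [_ [c hc]] := bh.
have bc : bdm (fun _ : R * (R * R) => `|c|) by exact: bdm_cst.
(* A bounded [h] becomes nonnegative after adding [|c|]; the nonnegative case is then applied twice
   and subtracted. *)
have bhc := bdmD bh bc.
have [p1 e1] := pos _ bc (fun=> normr_ge0 c).
have hc0 z : 0 <= h z + `|c|.
  by have := hc z; rewrite ler_norml => /andP[]; have := ler_norm c; lra.
have [p2 e2] := pos _ bhc hc0.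
have hE : partial_mean h = (fun p => partial_mean (fun z => h z + `|c|) p - partial_mean (fun=> `|c|) p).
  apply/funext => p; rewrite /partial_mean -IcircB; last 2 first.
  - by apply: bdmM => //; exact: (section_bdm p bhc).
  - by apply: bdmM => //; exact: bdm_cst.
  by apply: eq_Icirc => x _; ring.
split; first by rewrite hE; exact: bdmB.
move=> i ni; rewrite hE (bdm_RintegralB measurableT Pfin); [|exact: bdm_comp..].
rewrite -e1// -e2// -(bdm_RintegralB measurableT Pfin).
- by apply: eq_Rintegral => w _; ring.
- exact: (bdm_comp (ms i) bhc).
- exact: (bdm_comp (ms i) bc).
Qed.

(** Centring given the arc, rather than fully, makes the sample average of [xi] equal to
    [emp_noise], where [f] is weighted by the empirical coverage and not by [sigma]. *)
Definition xi (a : nat) (z : R * (R * R)) : R :=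
  \1_arc_set z * phi a z.1 - partial_mean (fun z => \1_arc_set z * phi a z.1) z.2.

Let baphi (a : nat) : bdm (fun z : R * (R * R) => \1_arc_set z * phi a z.1 : R).
Proof.
apply: bdmM; first by apply: bdm_indic; exact: measurable_arc_set.
exact: (bdm_comp measurable_fst (phi_bdm R a)).
Qed.

Lemma xi_bdm a : bdm (xi a).
Proof.
apply: bdmB; first exact: baphi.
exact: (bdm_comp measurable_snd (partial_meanP (baphi a)).1).
Qed.

Lemma xi_mean0 a i : (i < n)%N -> E (fun w => xi a (sample i w)) = 0.
Proof.
move=> ni; have [bp e] := partial_meanP (baphi a).
rewrite /xi (bdm_RintegralB measurableT Pfin); last 2 first.
- exact: (bdm_comp (ms i) (baphi a)).
- exact: (bdm_comp (mLU i) bp).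
by rewrite e// subrr.
Qed.

Let arcf_bdm p : bdm (fun x : R => \1_arc_set (x, p) * f x).
Proof.
apply: bdmM => //; apply: (section_bdm p); apply: bdm_indic; exact: measurable_arc_set.
Qed.

Let arcf_L2 p : L2sq (fun x : R => \1_arc_set (x, p) * f x) <= v.
Proof.
apply: le_trans L2sq_density; apply: Icirc_le; [exact/bdmX/arcf_bdm|exact: bdmX|].
move=> x _; rewrite indicE; case: (_ \in _); rewrite ?mul1r// mul0r expr0n /= sqr_ge0//.
Qed.

(** The uncentred part is [phi_sumsq], the centring part is Bessel's inequality for [f] restricted
    to the arc. The additive constant is [4 v] so that the variance constant of [xi_variance] lies
    below this bound, as the U-statistic estimates require. *)
Lemma xi_sumsq_le m z : \sum_(a < Dm m) xi a z ^+ 2 <= (Dm m)%:R / pi + 4 * v.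
Proof.
have h1 : \sum_(a < Dm m) xi a z ^+ 2 <=
    2 * \sum_(a < Dm m) phi a z.1 ^+ 2 +
    2 * \sum_(a < Dm m) Icirc (fun x => (\1_arc_set (x, z.2) * f x) * phi a x) ^+ 2.
  rewrite !mulr_sumr -big_split /=; apply: ler_sum => a _.
  have -> : xi a z = \1_arc_set z * phi a z.1 -
      Icirc (fun x => (\1_arc_set (x, z.2) * f x) * phi a x).
    by rewrite /xi /partial_mean; congr (_ - _); apply: eq_Icirc => x _; rewrite /=; ring.
  move: (Icirc _) (phi a z.1) => I y.
  have := sqr_ge0 (y + I); have := sqr_ge0 I; have := sqr_ge0 y.
  by rewrite indicE; case: (_ \in _) => /=; rewrite !expr2; nra.
apply: le_trans h1 _; rewrite phi_sumsq.
have := bessel m (arcf_bdm z.2) => h; have := le_trans h (arcf_L2 z.2) => h2.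
have -> : 2 * ((Dm m)%:R / (pi *+ 2)) = (Dm m)%:R / pi :> R.
  have : pi != 0 :> R by rewrite gt_eqF ?pi_gt0.
  by move: pi => c c0; field.
move: (\sum_(a < Dm m) _) ((Dm m)%:R / pi) h2 => s t h2.
by have := v0; lra.
Qed.

(** A combination of the [xi_a] is the centred value of one trigonometric polynomial [t] on the arc,
    so its second moment is at most [4 v |t|^2], whatever the dimension. This gap to the norm bound
    of order [D_m] is what makes the martingale small. *)
Lemma xi_variance m i (c : 'I_(Dm m) -> R) : (i < n)%N ->
  E (fun w => (\sum_a c a * xi a (sample i w)) ^+ 2) <= 4 * v * \sum_a c a ^+ 2.
Proof.
move=> ni.
pose c' (a : nat) := if insub a is Some j then c j else 0.
have cc' (a : 'I_(Dm m)) : c' a = c a by rewrite /c' valK.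
have tE x : \sum_a c a * phi a x = trigpoly m c' x.
  by apply: eq_bigr => a _; rewrite cc'.
have bt := trigpoly_bdm m c'.
have cs : \sum_a c a ^+ 2 = L2sq (trigpoly m c').
  by rewrite parseval; apply: eq_bigr => a _; rewrite cc'.
have xE w : \sum_a c a * xi a (sample i w) = \1_arc_set (sample i w) * trigpoly m c' (X i w) -
    Icirc (fun x => trigpoly m c' x * (\1_arc_set (x, LU i w) * f x)).
  rewrite Icirc_trigpoly_mul// /trigpoly mulr_sumr -sumrB; apply: eq_bigr => a _.
  rewrite cc' /xi /partial_mean mulrBr mulrCA; congr (_ - _ * _).
  by apply: eq_Icirc => x _ /=; ring.
have Ile w : Icirc (fun x => trigpoly m c' x * (\1_arc_set (x, LU i w) * f x)) ^+ 2
    <= v * L2sq (trigpoly m c').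
  apply: le_trans (Icirc_cauchy_schwarz bt (arcf_bdm (LU i w))) _.
  by rewrite mulrC ler_wpM2r ?L2sq_ge0// arcf_L2.
have btX : bdm (fun w => trigpoly m c' (X i w) ^+ 2) by apply: bdmX; exact: bdm_comp.
apply: (@le_trans _ _ (E (fun w => 2 * trigpoly m c' (X i w) ^+ 2 + 2 * (v * L2sq (trigpoly m c'))))).
  apply: mean_le.
  - apply: bdmX; apply: bdm_sum => a; apply: bdmZ.
    exact: (bdm_comp (ms i) (xi_bdm a)).
  - by apply: bdmD; [exact: bdmZ|exact: bdm_cst].
  move=> w; rewrite xE; have := Ile w; move: (Icirc _) (trigpoly m c' (X i w)) (v * _) => I y t.
  have := sqr_ge0 (y + I); have := sqr_ge0 y.
  by rewrite indicE; case: (_ \in _) => /=; rewrite !expr2; nra.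
rewrite (bdm_RintegralD measurableT Pfin); [|exact: bdmZ|exact: bdm_cst].
rewrite mean_cst (bdm_RintegralZ measurableT Pfin)//.
have := mean_X ni (bdmX 2 bt) => ->.
have : Icirc (fun x => trigpoly m c' x ^+ 2 * f x) <= v * L2sq (trigpoly m c').
  rewrite -IcircZ; last exact: bdmX.
  apply: Icirc_le; [by apply: bdmM => //; exact: bdmX|by apply: bdmZ; exact: bdmX|].
  by move=> x _; rewrite mulrC ler_wpM2r ?sqr_ge0.
rewrite cs; move: (Icirc _) (L2sq _) => I s h.
by rewrite -mulrA; lra.
Qed.

Theorem mean_ustat4_sample m :
  E (fun w => ustat sample (fun a : 'I_(Dm m) => xi a) n w ^+ 4) <=
  expR 1 * (80 * ((4 * v) ^+ 2 * n%:R ^+ 4 * ((Dm m)%:R / pi + 4 * v) ^+ 2) +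
            15 * (4 * v * n%:R ^+ 3 * ((Dm m)%:R / pi + 4 * v) ^+ 3)).
Proof.
apply: (mean_ustat4_le ms (sample_indep n0 mX mL mU mf f0 fv law)).
- by move=> a; exact: xi_bdm.
- by move=> a i; exact: xi_mean0.
- by move=> z; exact: xi_sumsq_le.
- by move=> i c; exact: xi_variance.
- by rewrite mulr_gt0// density_bound_gt0.
- by rewrite lerDr divr_ge0// pi_ge0.
Qed.

End sample_moments.

(** * Quantile cells *)

Section quantile_cells.
Variable R : realType.

(** Continuity from below along slightly shrunk intervals; atoms at [s] and [t] stay outside. *)
Lemma open_itv_mass (m : {measure set R -> \bar R}) (s t : R) (e : \bar R) :
  (forall a b, s < a -> a < b -> b < t -> (m `]a, b]%classic <= e)%E) -> (0 <= e)%E ->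
  (m `]s, t[%classic <= e)%E.
Proof.
move=> h e0.
pose A k := `]s + k.+1%:R^-1, t - k.+1%:R^-1]%classic : set R.
have AE : `]s, t[%classic = \bigcup_k A k.
  apply/seteqP; split => x /=; rewrite ?in_itv /=.
    move=> /andP[sx xt].
    pose r := Num.min (x - s) (t - x).
    have r0 : 0 < r by rewrite lt_min !subr_gt0 sx.
    exists (Num.trunc r^-1) => //; rewrite /A /= in_itv /=.
    have hk : (Num.trunc r^-1).+1%:R^-1 < r.
      rewrite invf_plt ?posrE ?ltr0n//; exact: truncnS_gt.
    have : r <= x - s by rewrite ge_min lexx.
    have : r <= t - x by rewrite ge_min lexx orbT.
    by move: (_^-1) hk => y hk h1 h2; apply/andP; split; lra.
  move=> [k _]; rewrite /A /= in_itv /= => /andP[].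
  have : 0 < k.+1%:R^-1 :> R by rewrite invr_gt0 ltr0n.
  by move: (_^-1) => y hk h1 h2; apply/andP; split; lra.
have mA k : measurable (A k) by exact: measurable_itv.
have ndA : nondecreasing_seq A.
  move=> k l kl; apply/subsetPset => x; rewrite /A /= !in_itv /= => /andP[].
  have : l.+1%:R^-1 <= k.+1%:R^-1 :> R by rewrite lef_pV2 ?posrE ?ltr0n// ler_nat.
  by move: (l.+1%:R^-1) (k.+1%:R^-1) => y z yz h1 h2; apply/andP; split; lra.
have Ae k : (m (A k) <= e)%E.
  rewrite /A; have [ab|ba] := ltP (s + k.+1%:R^-1) (t - k.+1%:R^-1).
    by apply: h => //; rewrite ?ltrDl ?gtrBl invr_gt0 ltr0n.
  by rewrite set_itv_ge ?measure0// -leNgt bnd_simp.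
rewrite AE; have cA : m \o A @ \oo --> m (\bigcup_k A k).
  by apply: nondecreasing_cvg_mu => //; exact: bigcup_measurable.
rewrite -(cvg_lim _ cA)//; apply: lime_le; last exact: nearW.
by apply/cvg_ex; exists (m (\bigcup_k A k)).
Qed.

(** Without an end point in the open cell, [c] and [y] compare in the same way with [l] and with
    [u]. *)
Lemma arc_cell (l u s t c y : R) : circ c -> circ y -> s < c -> c < t -> s < y -> y < t ->
  ~ (s < l /\ l < t) -> ~ (s < u /\ u < t) -> arc l u c -> arc l u y.
Proof.
rewrite /circ /= !in_itv /= => /andP[c0 c1] /andP[y0 y1] sc ct sy yt nl nu.
have hl : l <= c -> l <= y.
  by move=> lc; rewrite leNgt; apply/negP => yl; apply: nl; split; lra.
have hu : c <= u -> y <= u.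
  by move=> cu; rewrite leNgt; apply/negP => uy; apply: nu; split; lra.
move=> /arcE h; apply/arcE.
case: h => [[h1 [h2 h3]]|[h1 [[h2 h3]|[h2 h3]]]].
- by left; do 2!split => //; [exact: hl|exact: hu].
- by right; split => //; left; split => //; exact: hl.
- by right; split => //; right; split => //; exact: hu.
Qed.

Variables (nu : probability (R * R)%type R) (s0 e : R) (N : nat).
Hypotheses (e0 : 0 < e) (eN : 2 <= N%:R * e).
Hypothesis nus0 : forall x, circ x -> (s0%:E <= sigma nu x)%E.

Let mfst : measurable_fun setT (fst : R * R -> R) := measurable_fst.
Let msnd : measurable_fun setT (snd : R * R -> R) := measurable_snd.

Let m1 := measure_function_pushforward__canonical__measure_function_Measure nu mfst.
Let m2 := measure_function_pushforward__canonical__measure_function_Measure nu msnd.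
(** Sum of the laws of the two end points, of total mass 2; hence the requirement [2 <= N * e]. *)
Let m : {measure set R -> \bar R} := measure_add m1 m2.

Let mE A : m A = (nu (fst @^-1` A) + nu (snd @^-1` A))%E.
Proof. by rewrite /m /= /measure_add /= /msum !big_ord_recr big_ord0 /= add0e. Qed.

Let mpre1 A : measurable A -> measurable ((fst : R * R -> R) @^-1` A).
Proof. by move=> mA; rewrite -[X in measurable X]setTI; exact: mfst. Qed.
Let mpre2 A : measurable A -> measurable ((snd : R * R -> R) @^-1` A).
Proof. by move=> mA; rewrite -[X in measurable X]setTI; exact: msnd. Qed.

Let m_fin A : measurable A -> m A \is a fin_num.
Proof.
move=> mA; rewrite mE fin_numD; apply/andP; split; apply: fin_num_measure.
  exact: mpre1.
exact: mpre2.
Qed.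

Let F x := fine (m `]-oo, x]%classic).

Let F_le2 x : F x <= 2.
Proof.
rewrite -lee_fin fineK ?m_fin// mE (_ : 2%:E = 1 + 1)%E; last by rewrite -EFinD.
by apply: leeD; apply: probability_le1; [exact: mpre1|exact: mpre2].
Qed.

Let F_ge0 x : 0 <= F x.
Proof. by rewrite fine_ge0. Qed.

Let FB a b : a < b -> m `]a, b]%classic = (F b - F a)%:E.
Proof.
move=> ab.
have disj : `]-oo, a]%classic `&` `]a, b]%classic = set0 :> set R.
  by apply/seteqP; split => // x /=; rewrite !in_itv /= => -[xa /andP[ax _]]; lra.
have h : m `]-oo, b]%classic = (m `]-oo, a]%classic + m `]a, b]%classic)%E.
  rewrite -(measureU m (@measurable_itv _ `]-oo, a]) (@measurable_itv _ `]a, b]) disj).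
  by rewrite -itv_bndbnd_setU// bnd_simp ltW.
by rewrite EFinB !fineK ?m_fin// h [X in (X - _)%E]addeC addeK// m_fin.
Qed.

Let F_mono a b : a <= b -> F a <= F b.
Proof.
rewrite le_eqVlt => /predU1P[->//|ab].
by rewrite -subr_ge0 -lee_fin -FB.
Qed.

Let S k := [set x : R | (0 <= x <= pi *+ 2) /\ F x <= k%:R * e].
(** The value -1 at index 0 lies to the left of the circle, so that the first open cell can contain
    0. If no point of the circle qualifies, the supremum of the empty set gives 0. *)
Definition quantile k : R := if k is k'.+1 then sup (S k') else -1.

Let S_ub k : has_ubound (S k).
Proof. by exists (pi *+ 2) => x [/andP[]]. Qed.

Let q_ge0 k : 0 <= quantile k.+1.
Proof.
rewrite /=; have [[x Sx]|h] := pselect (S k !=set0).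
  apply: le_trans (ub_le_sup (S_ub k) Sx).
  by case: Sx => /andP[].
rewrite (_ : S k = set0) ?sup0//.
by apply/seteqP; split => // y Sy; case: h; exists y.
Qed.

Let q_le k : quantile k.+1 <= pi *+ 2.
Proof.
rewrite /=; have [h|h] := pselect (S k !=set0).
  by apply: ge_sup => // x [/andP[]].
have p0 : 0 <= pi *+ 2 :> R by rewrite mulrn_wge0// pi_ge0.
rewrite (_ : S k = set0) ?sup0//.
by apply/seteqP; split => // y Sy; case: h; exists y.
Qed.

Let F_lt_quantile k b : 0 < quantile k.+1 -> b < quantile k.+1 -> F b <= k%:R * e.
Proof.
move=> q0 bq.
have [h|h] := pselect (S k !=set0); last first.
  move: q0; rewrite /= (_ : S k = set0) ?sup0 ?ltxx//.
  by apply/seteqP; split => // y Sy; case: h; exists y.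
have [y [Sy1 Sy2] by_] := sup_gt h bq.
exact: le_trans (F_mono (ltW by_)) Sy2.
Qed.

Let F_gt_quantile k a : quantile k.+1 < a -> a <= pi *+ 2 -> k%:R * e < F a.
Proof.
move=> qa ap; rewrite ltNge; apply/negP => Fa.
have : S k a.
  by split => //; rewrite ap andbT (le_trans (q_ge0 k) (ltW qa)).
by move=> /(ub_le_sup (S_ub k)); rewrite leNgt qa.
Qed.

(** To the left of a quantile [F] is at most its level, to the right of the previous one it exceeds
    the previous level, and levels differ by [e]. *)
Let cell_mass k : 0 < quantile k.+1 ->
  (m `]quantile k, quantile k.+1[%classic <= e%:E)%E.
Proof.
move=> q0; apply: open_itv_mass; last by rewrite lee_fin ltW.
move=> a b qa ab bq; rewrite FB// lee_fin.
have Fb := F_lt_quantile q0 bq.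
case: k q0 qa bq Fb => [|k] q0 qa bq Fb.
  by have := F_ge0 a; have := e0; rewrite mul0r in Fb; move: (F b) (F a) Fb => x y *; lra.
have ap : a <= pi *+ 2 by apply: le_trans (q_le k.+1); apply/ltW/(lt_trans ab bq).
have := F_gt_quantile qa ap; rewrite -natr1 mulrDl mul1r in Fb.
by move: (F b) (F a) Fb => x y *; lra.
Qed.

Let quantile_top : quantile N.+1 = pi *+ 2.
Proof.
apply/le_anti; rewrite q_le /=; apply: ub_le_sup => //; split.
  by rewrite lexx mulrn_wge0// pi_ge0.
exact: le_trans (F_le2 _) eN.
Qed.

Let quantile_cover x : circ x ->
  exists k, (k <= N)%N /\ (x = quantile k.+1 \/ quantile k < x < quantile k.+1).
Proof.
rewrite /circ /= in_itv /= => /andP[x0 x1].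
have ex : exists k, (x <= quantile k.+1) by exists N; rewrite quantile_top ltW.
case: (ex_minnP ex) => k xk kmin.
exists k; split; first by apply: kmin; rewrite quantile_top ltW.
move: xk; rewrite le_eqVlt => /predU1P[->|xk]; first by left.
right; rewrite xk andbT; case: k kmin xk => [|k] kmin xk.
  by rewrite /=; lra.
by rewrite ltNge; apply/negP => /kmin; rewrite ltnn.
Qed.

Let marc x : measurable [set p : R * R | arc p.1 p.2 x].
Proof.
have mp : measurable_fun setT (fun p : R * R => (x, p)) by exact: measurable_fun_pair.
by have := mp measurableT _ (@measurable_arc_set R); rewrite setTI.
Qed.

Let s01 : s0 <= 1.
Proof.
have c0 : circ (0 : R) by rewrite /circ /= in_itv /= lexx mulrn_wgt0// pi_gt0.
rewrite -lee_fin; apply: le_trans (nus0 c0) _.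
by apply: probability_le1; exact: marc.
Qed.

(** For an open cell with a chosen point [c], [B] is the event that the arc contains [c] and has no
    end point in the cell; it loses mass at most [e] and forces the arc to contain the cell. For a
    quantile on the circle, [B] is the event that the arc contains it. Vacuous cases take the full
    set. *)
Lemma cells_exist : exists B : nat -> set (R * R),
  [/\ forall j, measurable (B j),
      forall j, s0 - e <= fine (nu (B j)) &
      forall x, circ x -> exists2 j, (j < N.+1.*2)%N & forall p, B j p -> arc p.1 p.2 x].
Proof.
have key k (b : bool) : exists Bk : set (R * R), [/\ measurable Bk, s0 - e <= fine (nu Bk) &
    forall x, circ x ->
      (if b then x = quantile k.+1 else quantile k < x < quantile k.+1) ->
      forall p, Bk p -> arc p.1 p.2 x].
  have triv : s0 - e <= fine (nu setT).
    by rewrite probability_setT /=; have := s01; have := e0; lra.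
  case: b => /=.
    have [cq|ncq] := pselect (circ (quantile k.+1)).
      exists [set p | arc p.1 p.2 (quantile k.+1)]; split.
      - exact: (marc (quantile k.+1)).
      - rewrite (@le_trans _ _ s0) ?gerBl ?(ltW e0)//.
        rewrite -lee_fin fineK; first exact: nus0.
        by apply: fin_num_measure; exact: (marc (quantile k.+1)).
      - by move=> x _ ->.
    by exists setT; split => // x cx xq; rewrite xq in cx.
  have [[c [cc /andP[qc cq]]]|nc] := pselect (exists c, circ c /\ quantile k < c < quantile k.+1); last first.
    by exists setT; split => // x cx xq; case: nc; exists x.
  pose J := `]quantile k, quantile k.+1[%classic : set R.
  have mJ : measurable J by exact: measurable_itv.
  have q0 : 0 < quantile k.+1.
    by apply: le_lt_trans cq; move: cc; rewrite /circ /= in_itv /= => /andP[].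
  have hJ := cell_mass q0; rewrite -/J mE in hJ.
  pose A := [set p : R * R | arc p.1 p.2 c].
  exists (A `\` (fst @^-1` J `|` snd @^-1` J)); split.
  - apply: measurableD; first exact: marc.
    by apply: measurableU; [exact: mpre1|exact: mpre2].
  - have mJJ : measurable ((fst @^-1` J `|` snd @^-1` J) : set (R * R)).
      by apply: measurableU; [exact: mpre1|exact: mpre2].
    have fJJ : (nu (fst @^-1` J `|` snd @^-1` J) <= e%:E)%E.
      by apply: le_trans hJ; apply: measureU2; [exact: mpre1|exact: mpre2].
    have mAD : measurable (A `\` (fst @^-1` J `|` snd @^-1` J)).
      by apply: measurableD => //; exact: marc.
    rewrite lerBlDr -lee_fin EFinD fineK; last exact: fin_num_measure.
    apply: le_trans (nus0 cc) _; rewrite /sigma -/A.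
    apply: (@le_trans _ _ (nu ((A `\` (fst @^-1` J `|` snd @^-1` J)) `|` (fst @^-1` J `|` snd @^-1` J)))).
      apply: le_measure; rewrite ?inE.
      + exact: marc.
      + exact: measurableU.
      by move=> p Ap; have [h|h] := pselect ((fst @^-1` J `|` snd @^-1` J) p); [right|left].
    apply: le_trans (measureU2 _ mAD mJJ) _; exact: leeD2l.
  - move=> x cx /andP[qx xq] p [Ap nJ].
    apply: arc_cell (Ap) => //; [exact: qc|exact: cq|exact: qx|exact: xq| |].
      by move=> [h1 h2]; apply: nJ; left; rewrite /J /= in_itv /= h1 h2.
    by move=> [h1 h2]; apply: nJ; right; rewrite /J /= in_itv /= h1 h2.
have /choice[B hB] : forall kb : nat * bool, exists Bk : set (R * R), [/\ measurable Bk, s0 - e <= fine (nu Bk) &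
    forall x, circ x ->
      (if kb.2 then x = quantile kb.1.+1 else quantile kb.1 < x < quantile kb.1.+1) ->
      forall p, Bk p -> arc p.1 p.2 x].
  by move=> [k b]; exact: key.
(* Even indices stand for open cells, odd ones for the quantiles. *)
exists (fun j => B (j./2, odd j)); split.
- by move=> j; have [] := hB (j./2, odd j).
- by move=> j; have [] := hB (j./2, odd j).
move=> x cx; have [k [kN [xk|xk]]] := quantile_cover cx.
  exists k.*2.+1; first by rewrite doubleS ltnS ltnS leq_double.
  by rewrite /= odd_double uphalf_double /=; have [_ _ ] := hB (k, true); apply.
exists k.*2; first by rewrite doubleS ltnS ltnW// ltnS leq_double.
by rewrite odd_double doubleK; have [_ _ ] := hB (k, false); apply.
Qed.

End quantile_cells.

(** * The oracle inequality for a fixed sample *)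

Section oracle_inequality.
Variables (R : realType) (n : nat) (X L U : nat -> R) (f : R -> R) (s : R).
Hypothesis n0 : (0 < n)%N.
Hypotheses (cL : forall i, circ (L i)) (cU : forall i, circ (U i)).
Hypothesis bf : bdm f.
Implicit Types (t : R -> R) (c : nat -> R).

Definition coverage x : R := n%:R^-1 * \sum_(i < n) \1_(arc (L i) (U i)) x.
Hypotheses (s0 : 0 < s) (s_cov : forall x, circ x -> s <= coverage x).

Definition emp_sqnorm t := Icirc (fun x => coverage x * t x ^+ 2).
Definition emp_mean t := n%:R^-1 * \sum_(i < n) Delta X L U i * t (X i).
Definition emp_noise t := emp_mean t - Icirc (fun x => coverage x * (t x * f x)).
(** The squared supremum of the noise over the unit ball of [S_m], called [chi^2_m] in the
    overview. *)
Definition noise_energy m := \sum_(a < Dm m) emp_noise (phi a) ^+ 2.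

Lemma coverage_bdm : bdm coverage.
Proof. by apply: bdmZ; apply: bdm_sum => i; exact: arc_indic_bdm. Qed.

Lemma coverage_ge0 x : 0 <= coverage x.
Proof. by rewrite mulr_ge0 ?invr_ge0// sumr_ge0// => i _; rewrite indicE. Qed.

Lemma coverage_le1 x : coverage x <= 1.
Proof.
rewrite ler_pdivrMl ?ltr0n// mulr1 -[leRHS]mulr1n -[X in _ <= X%:R](card_ord n).
rewrite -sumr_const; apply: ler_sum => i _.
by rewrite indicE; case: (_ \in _).
Qed.

Lemma sum_Rintegral_arc t : bdm t ->
  n%:R^-1 * \sum_(i < n) Rintegral leb (arc (L i) (U i)) t = Icirc (fun x => coverage x * t x).
Proof.
move=> bt.
have b i : bdm (fun x => \1_(arc (L i) (U i)) x * t x) by apply: bdmM => //; exact: arc_indic_bdm.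
under eq_bigr do rewrite Rintegral_arc//.
rewrite -Icirc_sum// -IcircZ; last exact: bdm_sum.
by apply: eq_Icirc => x _; rewrite /coverage -mulrA mulr_suml.
Qed.

Lemma zeta_decomp t : bdm t -> zeta n X L U t = emp_sqnorm t - 2 * emp_mean t.
Proof.
move=> bt; rewrite /zeta sumrB mulrBr sum_Rintegral_arc; last exact: bdmX.
congr (_ - _); rewrite /emp_mean [RHS]mulrCA [X in _ = _ * X]mulr_sumr; congr (_ * _).
(* The placeholder [- pi] occurs only where [Delta] is 0, so the value of [t] there is multiplied by
   0. *)
apply: eq_bigr => i _; rewrite /Delta /Xprime; case: ifP => _; last by rewrite !(mulr0, mul0r).
by rewrite mulr1 mul1r.
Qed.

Let bcov t : bdm t -> bdm (fun x => coverage x * t x).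
Proof. by move=> bt; apply: bdmM => //; exact: coverage_bdm. Qed.

Lemma zeta_noise t : bdm t ->
  zeta n X L U t = emp_sqnorm (fun x => t x - f x) - emp_sqnorm f - 2 * emp_noise t.
Proof.
move=> bt; rewrite zeta_decomp// /emp_noise.
have -> : emp_sqnorm (fun x => t x - f x) =
   emp_sqnorm t - 2 * Icirc (fun x => coverage x * (t x * f x)) + emp_sqnorm f.
  have b1 := bcov (bdmX 2 bt); have b2 := bcov (bdmX 2 bf); have b3 := bcov (bdmM bt bf).
  rewrite /emp_sqnorm -(IcircZ _ b3) -(IcircB b1 (bdmZ 2 b3)) -IcircD//; last first.
    by apply: bdmB => //; exact: bdmZ.
  by apply: eq_Icirc => x _; ring.
by ring.
Qed.

Lemma emp_sqnorm_ge t : bdm t -> s * L2sq t <= emp_sqnorm t.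
Proof.
move=> bt; rewrite -IcircZ; last exact: bdmX.
apply: Icirc_le; [by apply: bdmZ; exact: bdmX|exact/bcov/bdmX|].
by move=> x cx; rewrite ler_wpM2r ?sqr_ge0// s_cov.
Qed.

Lemma emp_sqnorm_le t : bdm t -> emp_sqnorm t <= L2sq t.
Proof.
move=> bt; apply: Icirc_le; [exact/bcov/bdmX|exact: bdmX|].
by move=> x cx; rewrite ler_piMl ?sqr_ge0// coverage_le1.
Qed.

Definition vec_of m c : 'cV[R]_(Dm m) := \col_a c a.
Definition seq_of m (b : 'cV[R]_(Dm m)) (a : nat) : R :=
  if insub a is Some j then b j ord0 else 0.

Lemma seq_ofK m (b : 'cV[R]_(Dm m)) : vec_of m (seq_of b) = b.
Proof. by apply/matrixP => i j; rewrite mxE /seq_of valK (ord1 j). Qed.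

Lemma seq_ofE m (b : 'cV[R]_(Dm m)) (a : 'I_(Dm m)) : seq_of b a = b a ord0.
Proof. by rewrite /seq_of valK. Qed.

Lemma dot_vec_of m c : dot (vec_of m c) (vec_of m c) = L2sq (trigpoly m c).
Proof. by rewrite parseval; apply: eq_bigr => a _; rewrite mxE expr2. Qed.

Lemma GhatE m (a b : 'I_(Dm m)) :
  Ghat n L U m a b = Icirc (fun x => coverage x * (phi a x * phi b x)).
Proof. by rewrite mxE sum_Rintegral_arc//; apply: bdmM; exact: phi_bdm. Qed.

Lemma Ghat_sym m : (Ghat n L U m)^T = Ghat n L U m.
Proof.
apply/matrixP => a b; rewrite mxE !GhatE.
by apply: eq_Icirc => x _; rewrite [phi b x * _]mulrC.
Qed.

Lemma Ghat_form m c :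
  dot (vec_of m c) (Ghat n L U m *m vec_of m c) = emp_sqnorm (trigpoly m c).
Proof.
have b a a' : bdm (fun x : R => coverage x * (phi a x * phi a' x)).
  by apply: bcov; apply: bdmM; exact: phi_bdm.
have -> : emp_sqnorm (trigpoly m c) = Icirc (fun x =>
    \sum_(a < Dm m) \sum_(a' < Dm m) (c a * c a') * (coverage x * (phi a x * phi a' x))).
  apply: eq_Icirc => x _; rewrite expr2 /trigpoly mulr_suml mulr_sumr.
  apply: eq_bigr => a _; rewrite mulr_sumr mulr_sumr; apply: eq_bigr => a' _; ring.
rewrite Icirc_sum; last by move=> a; apply: bdm_sum => a'; exact: bdmZ.
apply: eq_bigr => a _; rewrite Icirc_sum; last by move=> a'; exact: bdmZ.
rewrite mxE mxE mulr_sumr; apply: eq_bigr => a' _.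
by rewrite GhatE mxE IcircZ//; ring.
Qed.

Lemma Ghat_coercive m b : s * dot b b <= dot b (Ghat n L U m *m b).
Proof.
rewrite -(seq_ofK b) Ghat_form dot_vec_of; apply: emp_sqnorm_ge.
exact: trigpoly_bdm.
Qed.

Lemma emp_mean_trigpoly m c :
  emp_mean (trigpoly m c) = \sum_(a < Dm m) c a * emp_mean (phi a).
Proof.
rewrite /emp_mean.
under [RHS]eq_bigr do rewrite mulrCA mulr_sumr.
rewrite -mulr_sumr exchange_big /=; congr (_ * _); apply: eq_bigr => i _.
by rewrite /trigpoly mulr_sumr; apply: eq_bigr => a _; ring.
Qed.

Lemma emp_noise_trigpoly m c :
  emp_noise (trigpoly m c) = \sum_(a < Dm m) c a * emp_noise (phi a).
Proof.
rewrite /emp_noise emp_mean_trigpoly.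
have -> : Icirc (fun x => coverage x * (trigpoly m c x * f x)) =
    \sum_(a < Dm m) c a * Icirc (fun x => coverage x * (phi a x * f x)).
  have -> : Icirc (fun x => coverage x * (trigpoly m c x * f x)) =
      Icirc (fun x => trigpoly m c x * (coverage x * f x)).
    by apply: eq_Icirc => x _; ring.
  rewrite Icirc_trigpoly_mul; last exact: bcov.
  by apply: eq_bigr => a _; congr (_ * _); apply: eq_Icirc => x _; ring.
by rewrite -sumrB; apply: eq_bigr => a _; ring.
Qed.

Lemma emp_noise_sqr_le m c :
  emp_noise (trigpoly m c) ^+ 2 <= L2sq (trigpoly m c) * noise_energy m.
Proof.
have := dot_cauchy_schwarz (vec_of m c) (vec_of m (fun a => emp_noise (phi a))).
rewrite dot_vec_of emp_noise_trigpoly.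
have -> : dot (vec_of m c) (vec_of m (fun a => emp_noise (phi a))) =
    \sum_(a < Dm m) c a * emp_noise (phi a).
  by apply: eq_bigr => a _; rewrite !mxE.
move=> /le_trans; apply; rewrite le_eqVlt; apply/orP; left; apply/eqP; congr (_ * _).
by apply: eq_bigr => a _; rewrite !mxE expr2.
Qed.

Definition fhat m : nat -> R := seq_of (invmx (Ghat n L U m) *m Uhat n X L U m).

Lemma fcircE m : fcirc n X L U m = trigpoly m (fhat m).
Proof. by apply/funext => x; apply: eq_bigr => a _; rewrite /fhat seq_ofE. Qed.

Lemma fcirc_minimizes m c :
  zeta n X L U (fcirc n X L U m) <= zeta n X L U (trigpoly m c).
Proof.
have Gu : Ghat n L U m \in unitmx.
  exact: (coercive_unitmx (k := m.*2) (@Ghat_sym m) s0 (@Ghat_coercive m)).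
rewrite fcircE !zeta_decomp; [|exact: trigpoly_bdm..].
set G := Ghat n L U m; set V := Uhat n X L U m.
have meanE c' : emp_mean (trigpoly m c') = dot (vec_of m c') V.
  by rewrite emp_mean_trigpoly; apply: eq_bigr => a _; rewrite !mxE.
rewrite -!Ghat_form !meanE -/G /fhat seq_ofK -/G -/V.
set b := vec_of m c; set b' := invmx G *m V.
have GbV : G *m b' = V by rewrite /b' mulKVmx.
rewrite -GbV.
(* Since [G b' = V], the difference of the two contrasts is the form of [G] at [b - b']. *)
have := le_trans (mulr_ge0 (ltW s0) (dot_ge0 (b + (-1) *: b'))) (Ghat_coercive (b + (-1) *: b')).
rewrite -/G mulmxDr -scalemxAr !dotDl !dotDr !dotZl !dotZr.
have -> : dot b' (G *m b) = dot b (G *m b') by rewrite dot_mulmxr Ghat_sym dotC.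
by lra.
Qed.

Lemma trigpoly_widen m m' c : (m <= m')%N ->
  trigpoly m c = trigpoly m' (fun a => if (a < Dm m)%N then c a else 0).
Proof.
move=> mm'; apply/funext => x; rewrite /trigpoly.
have DD : (Dm m <= Dm m')%N by rewrite /Dm ltnS leq_double.
rewrite (big_ord_widen _ (fun a => c a * phi a x) DD) big_mkcond /=.
by apply: eq_bigr => a _; case: ifP => _; rewrite ?mul0r.
Qed.

Lemma trigpoly_sub m m' c c' : exists c'',
  (fun x => trigpoly m c x - trigpoly m' c' x) = trigpoly (maxn m m') c''.
Proof.
rewrite (trigpoly_widen c (leq_maxl m m')) (trigpoly_widen c' (leq_maxr m m')).
exists (fun a => (if (a < Dm m)%N then c a else 0) - (if (a < Dm m')%N then c' a else 0)).
apply/funext => x; rewrite /trigpoly -sumrB.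
by apply: eq_bigr => a _; rewrite -mulrBl.
Qed.

Variable kappa : R.
Hypothesis kappa32 : 32 <= kappa.

Local Notation rho m := (opnorm (invmx (Ghat n L U m))).
Local Notation H m := ((Dm m)%:R / ((pi *+ 2) * n%:R)).

Let p2 : 0 < pi *+ 2 :> R.
Proof. by rewrite mulrn_wgt0 ?pi_gt0. Qed.
Let nR : 0 < n%:R :> R.
Proof. by rewrite ltr0n. Qed.

Lemma penE m : pen kappa n L U m = kappa * rho m * H m.
Proof. by rewrite /pen; move: (pi *+ 2) p2 => p p0; field; rewrite !gt_eqF. Qed.

Lemma rho_ge0 m : 0 <= rho m.
Proof. exact: sqrtr_ge0. Qed.

Lemma rho_le m : rho m <= s^-1.
Proof. exact: (opnorm_invmx_le (k := m.*2) (@Ghat_sym m) s0 (@Ghat_coercive m)). Qed.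

(** The random [rho m] is used instead of [1 / s] so that the noise is of the size of the random
    penalty, with a numerical factor only. *)
Lemma L2sq_le_rho m c : L2sq (trigpoly m c) <= rho m * emp_sqnorm (trigpoly m c).
Proof.
rewrite -dot_vec_of -Ghat_form.
exact: (opnorm_invmx_ge_rayleigh (k := m.*2) (@Ghat_sym m) s0 (@Ghat_coercive m)).
Qed.

Lemma H_ge0 m : 0 <= H m :> R.
Proof. by rewrite divr_ge0// mulr_ge0// ltW. Qed.

Lemma emp_sqnorm_ge0 t : 0 <= emp_sqnorm t.
Proof. by apply: Icirc_ge0 => x _; rewrite mulr_ge0 ?coverage_ge0 ?sqr_ge0. Qed.

(* Since [maxn m mh] is [m] or [mh], the noise over [S_(maxn m mh)] is absorbed by
   [pen m + pen mh]: the factor 4 of AM-GM times 8 is the 32 required of [kappa]. *)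
Lemma oracle_emp m mh T (c : nat -> R) : 0 <= T ->
  crit kappa n X L U mh <= crit kappa n X L U m ->
  noise_energy m <= 8 * H m + T -> noise_energy mh <= 8 * H mh + T ->
  emp_sqnorm (fun x => fcirc n X L U mh x - f x) <=
  3 * emp_sqnorm (fun x => trigpoly m c x - f x) + 4 * pen kappa n L U m + 8 / s * T.
Proof.
move=> T0 hc e1 e2.
have bmh : bdm (fcirc n X L U mh) by rewrite fcircE; exact: trigpoly_bdm.
have bm := trigpoly_bdm m c.
have h1 : zeta n X L U (fcirc n X L U mh) + pen kappa n L U mh <=
    zeta n X L U (trigpoly m c) + pen kappa n L U m.
  by apply: le_trans hc _; rewrite lerD2r; exact: fcirc_minimizes.
rewrite !zeta_noise// in h1.
set M := maxn m mh.
have [c'' tE] : exists c'', (fun x => fcirc n X L U mh x - trigpoly m c x) = trigpoly M c''.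
  by rewrite fcircE /M maxnC; exact: trigpoly_sub.
have noiseB : emp_noise (trigpoly M c'') = emp_noise (fcirc n X L U mh) - emp_noise (trigpoly m c).
  rewrite -tE /emp_noise /emp_mean.
  have -> : Icirc (fun x => coverage x * ((fcirc n X L U mh x - trigpoly m c x) * f x)) =
    Icirc (fun x => coverage x * (fcirc n X L U mh x * f x)) -
    Icirc (fun x => coverage x * (trigpoly m c x * f x)).
    rewrite -IcircB; [|by apply: bcov; exact: bdmM..].
    by apply: eq_Icirc => x _; ring.
  under eq_bigr do rewrite mulrBr.
  by rewrite sumrB mulrBr; ring.
have sqB : emp_sqnorm (trigpoly M c'') <= 2 * emp_sqnorm (fun x => fcirc n X L U mh x - f x) +
    2 * emp_sqnorm (fun x => trigpoly m c x - f x).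
  have b1 := bcov (bdmX 2 (bdmB bmh bf)); have b2 := bcov (bdmX 2 (bdmB bm bf)).
  rewrite -(IcircZ _ b1) -(IcircZ _ b2) -IcircD; [|exact: bdmZ..].
  apply: Icirc_le; [exact/bcov/bdmX/trigpoly_bdm|by apply: bdmD; exact: bdmZ|].
  move=> x _; rewrite -tE.
  have -> : 2 * (coverage x * (fcirc n X L U mh x - f x) ^+ 2) +
      2 * (coverage x * (trigpoly m c x - f x) ^+ 2) =
      coverage x * (2 * (fcirc n X L U mh x - f x) ^+ 2 + 2 * (trigpoly m c x - f x) ^+ 2) by ring.
  rewrite ler_wpM2l ?coverage_ge0//.
  by have := sqr_ge0 (fcirc n X L U mh x - f x + (trigpoly m c x - f x)); nra.
have amgm : 2 * emp_noise (trigpoly M c'') <=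
    4^-1 * emp_sqnorm (trigpoly M c'') + 4 * (rho M * noise_energy M).
  have h := emp_noise_sqr_le M c''; have h2 := L2sq_le_rho M c''.
  have q0 := emp_sqnorm_ge0 (trigpoly M c''); have r0 := rho_ge0 M.
  have E0 : 0 <= noise_energy M by apply: sumr_ge0 => a _; exact: sqr_ge0.
  have h3 : emp_noise (trigpoly M c'') ^+ 2 <= emp_sqnorm (trigpoly M c'') * (rho M * noise_energy M).
    apply: le_trans h _; by rewrite mulrA ler_wpM2r// [leRHS]mulrC.
  have w0 := mulr_ge0 r0 E0.
  move: (emp_noise _) (emp_sqnorm _) (rho M * _) q0 w0 h3 => z q w q0 w0 h3.
  have : (2 * z) ^+ 2 <= (4^-1 * q + 4 * w) ^+ 2.
    have -> : (4^-1 * q + 4 * w) ^+ 2 = 4 * (q * w) + (4^-1 * q - 4 * w) ^+ 2 - 2 * (q * w) + 0 + 2 * (q * w) by field.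
    have := sqr_ge0 (4^-1 * q - 4 * w); rewrite exprMn; lra.
  have rhs0 : 0 <= 4^-1 * q + 4 * w by lra.
  have [z0|z0] := leP 0 z; last by move=> _; apply: le_trans rhs0; lra.
  by rewrite ler_sqr ?nnegrE// mulr_ge0.
have penM : 4 * (rho M * noise_energy M) <= pen kappa n L U m + pen kappa n L U mh + 4 / s * T.
  have hm : forall k, noise_energy k <= 8 * H k + T ->
      4 * (rho k * noise_energy k) <= pen kappa n L U k + 4 / s * T.
    move=> k hk; rewrite penE.
    have r0 := rho_ge0 k; have rs := rho_le k; have Hk := H_ge0 k.
    have a1 : rho k * noise_energy k <= rho k * (8 * H k + T) by rewrite ler_wpM2l.
    have a2 : rho k * T <= s^-1 * T by rewrite ler_wpM2r.
    have a3 : 32 * (rho k * H k) <= kappa * (rho k * H k) by rewrite ler_wpM2r// mulr_ge0.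
    rewrite -[kappa * _ * _]mulrA -[4 / s * T]mulrA.
    rewrite mulrDr in a1.
    move: (rho k) (H k) (noise_energy k) (s^-1) a1 a2 a3 => r h e si a1 a2 a3.
    lra.
  have pen0 k : 0 <= pen kappa n L U k.
    rewrite penE mulr_ge0 ?H_ge0// mulr_ge0 ?rho_ge0//.
    by have := kappa32; lra.
  have := pen0 m; have := pen0 mh; have := hm _ e1; have := hm _ e2.
  by rewrite /M; case: (leqP m mh) => _; lra.
rewrite noiseB in amgm.
have -> : 8 / s * T = 2 * (4 / s * T) by ring.
(* A quarter of [sqB] puts half of the loss on the right-hand side, and [penM] cancels the penalty
   at [mh]. What remains is half the loss below 3/2 of the bias, twice the penalty at [m], and
   [4 / s * T]. *)
move: h1 sqB amgm penM; lra.
Qed.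

Lemma oracle_L2 m mh T (c : nat -> R) : 0 <= T ->
  crit kappa n X L U mh <= crit kappa n X L U m ->
  noise_energy m <= 8 * H m + T -> noise_energy mh <= 8 * H mh + T ->
  L2sq (fun x => fcirc n X L U mh x - f x) <=
  3 / s * L2sq (fun x => f x - trigpoly m c x) +
  4 / s ^+ 2 * (kappa * ((Dm m)%:R / n%:R)) + 8 / s ^+ 2 * T.
Proof.
move=> T0 hc e1 e2; have := oracle_emp c T0 hc e1 e2.
have bmh : bdm (fcirc n X L U mh) by rewrite fcircE; exact: trigpoly_bdm.
have bm := trigpoly_bdm m c.
have h1 := emp_sqnorm_ge (bdmB bmh bf); have h2 := emp_sqnorm_le (bdmB bm bf).
have -> : L2sq (fun x => f x - trigpoly m c x) = L2sq (fun x => trigpoly m c x - f x).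
  by apply: eq_Icirc => x _; ring.
have h3 : pen kappa n L U m <= s^-1 * (kappa * ((Dm m)%:R / n%:R)).
  rewrite penE [kappa * _]mulrC -mulrA ler_pM ?rho_ge0 ?rho_le//.
    by rewrite mulr_ge0 ?H_ge0//; have := kappa32; lra.
  rewrite ler_wpM2l//; first by have := kappa32; lra.
  rewrite ler_wpM2l// invfM ler_piMl ?invr_ge0// invf_le1//.
  by have := pi_ge2 R; rewrite mulr2n; lra.
move=> h4.
have : s * L2sq (fun x => fcirc n X L U mh x - f x) <=
   3 * L2sq (fun x => trigpoly m c x - f x) + 4 * (s^-1 * (kappa * ((Dm m)%:R / n%:R))) + 8 / s * T.
  by move: h1 h2 h3 h4; lra.
rewrite -ler_pdivlMl// => /le_trans; apply.
move: (L2sq _) (kappa * _) => a b; rewrite le_eqVlt; apply/orP; left; apply/eqP.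
by field; rewrite gt_eqF.
Qed.

(* If [fcirc] is truncated then its norm exceeds [n], so either [f] is as far from it
   as from 0, or [n^2 < 4 v]. *)
Lemma ftilde_L2 m v : L2sq f <= v -> 0 <= v ->
  L2sq (fun x => ftilde n X L U m x - f x) <=
  L2sq (fun x => fcirc n X L U m x - f x) + 4 * v ^+ 2 / n%:R.
Proof.
move=> fv v0; have bm : bdm (fcirc n X L U m) by rewrite fcircE; exact: trigpoly_bdm.
rewrite /ftilde; case: (leP (L2sq (fcirc n X L U m)) (n%:R ^+ 2)) => hn /=; first by rewrite lerDl divr_ge0// mulr_ge0// sqr_ge0.
have -> : L2sq (fun x => 0 - f x) = L2sq f by apply: eq_Icirc => x _; ring.
have h1 : L2sq (fcirc n X L U m) <= 2 * L2sq (fun x => fcirc n X L U m x - f x) + 2 * L2sq f.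
  have -> : L2sq (fcirc n X L U m) = L2sq (fun x => (fcirc n X L U m x - f x) - - f x).
    by apply: eq_Icirc => x _; ring.
  have -> : L2sq f = L2sq (fun x => - f x) by apply: eq_Icirc => x _; ring.
  by apply: L2sqB_le; [exact: bdmB|exact: bdmN].
have N1 : 1 <= n%:R :> R by rewrite ler1n.
have [nv|nv] := leP (4 * v) (n%:R ^+ 2).
  have : 0 <= 4 * v ^+ 2 / n%:R by rewrite divr_ge0// mulr_ge0// sqr_ge0.
  by move: h1 hn nv fv; lra.
have := L2sq_ge0 (fun x => fcirc n X L U m x - f x).
suff : v <= 4 * v ^+ 2 / n%:R by move: fv; lra.
rewrite ler_pdivlMr// expr2 mulrA mulrC ler_wpM2r//.
have : n%:R <= n%:R ^+ 2 :> R by rewrite expr2 ler_peMl.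
by move: nv; lra.
Qed.

End oracle_inequality.

Lemma ftilde_bdm {R : realType} n (X L U : nat -> R) m : bdm (ftilde n X L U m).
Proof.
rewrite /ftilde; case: (leP (L2sq (fcirc n X L U m)) (n%:R ^+ 2)) => _; last exact: bdm_cst.
by apply: bdm_sum => a; apply: bdmZ; exact: phi_bdm.
Qed.

Lemma ftilde_L2_crude {R : realType} n (X L U : nat -> R) (f : R -> R) m : bdm f ->
  L2sq (fun x => ftilde n X L U m x - f x) <= 2 * n%:R ^+ 2 + 2 * L2sq f.
Proof.
move=> bf; have bt := ftilde_bdm n X L U m.
apply: le_trans (L2sqB_le bt bf) _; rewrite lerD2r ler_wpM2l//.
rewrite /ftilde; case: (leP (L2sq (fcirc n X L U m)) (n%:R ^+ 2)) => // _.
have -> : L2sq (fun _ : R => 0 : R) = 0.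
  rewrite -[RHS](mul0r (pi *+ 2)) -Icirc_cst; apply: eq_Icirc => x _.
  by rewrite expr0n.
exact: sqr_ge0.
Qed.

(** * The oracle inequality for a bounded density *)

(** The integral of a nonnegative function is a supremum over the simple functions below it, hence
    monotone for arbitrary functions. It serves to compare the loss, as a function of [w], with a
    measurable majorant. *)
Lemma ge0_le_integral_nonmeas {R : realType} d (T : measurableType d)
    (mu : {measure set T -> \bar R}) (g h : T -> \bar R) :
  (forall x, 0 <= g x)%E -> (forall x, g x <= h x)%E ->
  (\int[mu]_x g x <= \int[mu]_x h x)%E.
Proof.
move=> g0 gh; have h0 x : (0 <= h x)%E by exact: le_trans (gh x).
rewrite !ge0_integralTE//; apply: le_ereal_sup => _ [k kg <-]; exists k => // x.
exact: le_trans (kg x) (gh x).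
Qed.

Lemma sum_half_le2 {R : realType} n : \sum_(j < n) (2^-1 : R) ^+ j <= 2.
Proof.
have -> : \sum_(j < n) (2^-1 : R) ^+ j = 2 - 2 * 2^-1 ^+ n.
  elim: n => [|n IH]; first by rewrite big_ord0 expr0; lra.
  by rewrite big_ord_recr /= IH exprS; field.
by rewrite gerBl mulr_ge0// exprn_ge0// invr_ge0.
Qed.

Lemma le_add_pow4 {R : realType} (u h : R) : 0 < h -> u <= h + u ^+ 4 / h ^+ 3.
Proof.
move=> h0; have p0 : 0 <= u ^+ 4 / h ^+ 3.
  by apply: divr_ge0; [exact: exprn_even_ge0|rewrite exprn_ge0// ltW].
have [uh|hu] := leP u h; first by rewrite (le_trans uh)// lerDl.
have u0 : 0 < u by exact: lt_trans hu.
rewrite (@le_trans _ _ (u ^+ 4 / h ^+ 3))//; last by rewrite lerDr ltW.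
rewrite ler_pdivlMr ?exprn_gt0// [leRHS]exprS ler_wpM2l ?(ltW u0)//.
by rewrite lerXn2r ?nnegrE ?ltW.
Qed.

Section oracle_constants.
Variable R : realType.
(** Bound for [E M^4 / (n^4 D^2)]: [D / pi + 4 v] is replaced by [D (1 + 4 v)], and the inner 5
    comes from [D <= 5 n] at the dyadic levels. *)
Definition moment_cst (v : R) : R :=
  expR 1 * (80 * ((4 * v) ^+ 2 * (1 + 4 * v) ^+ 2) + 15 * (4 * v * (5 * (1 + 4 * v) ^+ 3))).
Definition excess_cst (v : R) : R := 4 * v + 32 * pi ^+ 3 * moment_cst v.
(** Twice [N + 1], where [N] is the integer part of [8 / s0] plus 1, so that [N * (s0 / 4) >= 2]. *)
Definition ncells (s0 : R) : nat := (Num.trunc (8 / s0)).+2.*2.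
Definition bias_cst (s0 : R) : R := 3 / (s0 / 2) + 4 / (s0 / 2) ^+ 2.
(** Contributions of the excess, of the truncation and of the bad event; [24 ^+ 3] is 27 times
    [8 ^+ 3] from the cubic bound on the exponential. *)
Definition rest_cst (s0 v : R) : R :=
  8 / (s0 / 2) ^+ 2 * excess_cst v + 4 * v ^+ 2 +
  (ncells s0)%:R * (24 ^+ 3 / (s0 / 4) ^+ 6) * (2 + 2 * v).

Lemma moment_cst_ge0 v : 0 <= v -> 0 <= moment_cst v.
Proof.
move=> v0; have v4 : 0 <= 4 * v by rewrite mulr_ge0.
have b0 : 0 <= (1 + 4 * v) ^+ 3 by rewrite exprn_ge0// addr_ge0.
rewrite /moment_cst mulr_ge0 ?expR_ge0//; apply: addr_ge0; apply: mulr_ge0 => //.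
  by apply: mulr_ge0; exact: sqr_ge0.
by apply: mulr_ge0 => //; apply: mulr_ge0.
Qed.
End oracle_constants.

Section bounded_density.
Context {R : realType} {d : measure_display} {Om : measurableType d}.
Variables (P : probability Om R) (n : nat) (X L U : nat -> Om -> R)
  (f : R -> R) (nu : probability (R * R)%type R) (v : R).
Hypothesis n0 : (0 < n)%N.
Hypotheses (mX : forall i, measurable_fun setT (X i))
  (mL : forall i, measurable_fun setT (L i)) (mU : forall i, measurable_fun setT (U i)).
Hypothesis XLU : forall i w, circ (X i w) /\ circ (L i w) /\ circ (U i w).
Hypotheses (mf : measurable_fun setT f) (f0 : forall x, 0 <= f x) (fv : forall x, f x <= v).
Hypothesis law : forall (A : nat -> set R) (B : nat -> set (R * R)%type),
  (forall i, measurable (A i)) -> (forall i, measurable (B i)) ->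
  P (\bigcap_(i in `I_n) [set w | A i (X i w) /\ B i (L i w, U i w)]) =
  (\prod_(i < n) ((\int[leb]_(x in A i `&` circ) (f x)%:E) * nu (B i)))%E.

Local Notation E F := (\int[P]_w F w)%R.
Local Notation sample := (sample X L U).
Local Notation LU i := (fun w => (L i w, U i w)).
Local Notation H m := ((Dm m)%:R / ((pi *+ 2) * n%:R)).
Local Notation energy m w := (noise_energy n (X^~ w) (L^~ w) (U^~ w) f m).

Let bf : bdm f := f_bdm mf f0 fv.
Let Pfin : (P setT < +oo)%E.
Proof. by rewrite probability_setT ltry. Qed.
Let ms i : measurable_fun setT (sample i) := msample mX mL mU i.
Let v0 : 0 <= v := le_trans (f0 0) (fv 0).
Let nR : 0 < n%:R :> R.
Proof. by rewrite ltr0n. Qed.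
Let N1 : 1 <= n%:R :> R.
Proof. by rewrite ler1n. Qed.

Definition ust q w := ustat sample (fun a : 'I_(Dm q) => xi f a) n w.

Lemma emp_noise_xi a w :
  emp_noise n (X^~ w) (L^~ w) (U^~ w) f (phi a) = n%:R^-1 * \sum_(i < n) xi f a (sample i w).
Proof.
rewrite /emp_noise /emp_mean /xi sumrB mulrBr; congr (_ - _).
  congr (_ * _); apply: eq_bigr => i _; congr (_ * _).
  rewrite /Delta indicE; case: asboolP => h.
    by rewrite mem_set.
  by rewrite memNset.
have b i : bdm (fun x => \1_(arc (L i w) (U i w)) x * (phi a x * f x)).
  by apply: bdmM; [exact: arc_indic_bdm|apply: bdmM => //; exact: phi_bdm].
have -> : (fun x => coverage n (L^~ w) (U^~ w) x * (phi a x * f x)) =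
    (fun x => n%:R^-1 * \sum_(i < n) \1_(arc (L i w) (U i w)) x * (phi a x * f x)).
  by apply/funext => x; rewrite /coverage -mulrA mulr_suml.
rewrite IcircZ; last exact: bdm_sum.
rewrite Icirc_sum//; congr (_ * _); apply: eq_bigr => i _.
by apply: eq_Icirc => x _; rewrite arc_indicE /=; ring.
Qed.

Lemma energy_le m w : energy m w <= 2 * H m + 4 * v / n%:R + 2 * ust m w / n%:R ^+ 2.
Proof.
have -> : energy m w = (n%:R ^+ 2)^-1 * sqn sample (fun a : 'I_(Dm m) => xi f a) n w.
  rewrite /noise_energy /sqn mulr_sumr; apply: eq_bigr => a _.
  by rewrite emp_noise_xi exprMn exprVn.
have := sqn_le sample (xi := fun a : 'I_(Dm m) => xi f a)
  (xi_sumsq_le n0 mf f0 fv law m) n w.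
rewrite -/(ust m w) => h.
have := ler_wpM2l (_ : 0 <= (n%:R ^+ 2)^-1) h; rewrite invr_ge0 exprn_ge0// => /(_ isT).
move=> /le_trans; apply; rewrite le_eqVlt; apply/orP; left; apply/eqP.
have : pi != 0 :> R by rewrite gt_eqF ?pi_gt0.
move: pi (ust m w) (Dm m)%:R => p u D p0.
by field; rewrite gt_eqF.
Qed.

Lemma energy_mono m q w : (m <= q)%N -> energy m w <= energy q w.
Proof.
move=> mq; have DD : (Dm m <= Dm q)%N by rewrite /Dm ltnS leq_double.
rewrite /noise_energy (big_ord_widen _
  (fun a => emp_noise n (X^~ w) (L^~ w) (U^~ w) f (phi a) ^+ 2) DD).
rewrite big_mkcond /=; apply: ler_sum => a _.
by case: ifP => // _; exact: sqr_ge0.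
Qed.

(** One variable for all models at once, because it is evaluated at the random [mhat]. *)
Definition excess w : R := 4 * v / n%:R +
  \sum_(j < n | (2 ^ j <= n)%N)
    (2 * ust (2 ^ j.+1) w / n%:R ^+ 2) ^+ 4 / ((Dm (2 ^ j.+1))%:R / (pi * n%:R)) ^+ 3.

Let hpos q : 0 < (Dm q)%:R / (pi * n%:R) :> R.
Proof. by rewrite divr_gt0 ?mulr_gt0 ?pi_gt0// ltr0n. Qed.

Let term_ge0 q w : 0 <= (2 * ust q w / n%:R ^+ 2) ^+ 4 / ((Dm q)%:R / (pi * n%:R)) ^+ 3.
Proof.
by apply: divr_ge0; [exact: exprn_even_ge0|rewrite exprn_ge0// ltW// hpos].
Qed.

Lemma excess_ge0 w : 0 <= excess w.
Proof. by rewrite addr_ge0 ?sumr_ge0// divr_ge0// mulr_ge0. Qed.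

(** The 8 is a product of three factors 2: the bound on the diagonal is [2 H], an equal amount [h]
    is allowed for the martingale, and passing from [m] to the next power of 2 at most doubles the
    dimension. *)
Lemma energy_excess m w : Mn n m -> energy m w <= 8 * H m + excess w.
Proof.
move=> [m1 mn].
have mn' : (m <= n)%N.
  by move: mn; lia.
have /andP[j1 j2] := trunc_log_bounds (ltnSn 1) m1.
set j := trunc_log 2 m in j1 j2 *.
have jn : (j < n)%N by apply: leq_trans (ltn_expl j (ltnSn 1)) (leq_trans j1 mn').
pose q := (2 ^ j.+1)%N.
have e1 := energy_le q w; have e2 := energy_mono w (ltnW j2).
have hE : 2 * H q = (Dm q)%:R / (pi * n%:R) :> R.
  have : pi != 0 :> R by rewrite gt_eqF ?pi_gt0.
  by move: pi ((Dm q)%:R : R) => p D p0; field; rewrite gt_eqF.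
have hm : (Dm q)%:R / (pi * n%:R) <= 4 * H m :> R.
  have -> : 4 * H m = (2 * (Dm m)%:R) / (pi * n%:R) :> R.
    have : pi != 0 :> R by rewrite gt_eqF ?pi_gt0.
    by move: pi ((Dm m)%:R : R) => p D p0; field; rewrite gt_eqF.
  rewrite ler_wpM2r ?invr_ge0 ?mulr_ge0 ?pi_ge0// -natrM ler_nat /Dm /q expnS.
  by rewrite -!muln2; move: j1; lia.
have u := le_add_pow4 (2 * ust q w / n%:R ^+ 2) (hpos q).
have s : (2 * ust q w / n%:R ^+ 2) ^+ 4 / ((Dm q)%:R / (pi * n%:R)) ^+ 3 + 4 * v / n%:R <= excess w.
  rewrite /excess addrC lerD2l (bigD1 (Ordinal jn))/=; last exact: leq_trans j1 mn'.
  by rewrite lerDl sumr_ge0.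
rewrite hE in e1.
move: ((2 * ust q w / n%:R ^+ 2) ^+ 4 / _) u s e1 => y.
move: ((Dm q)%:R / (pi * n%:R)) (H m) (energy q w) (energy m w) (2 * ust q w / _) hm e2.
move: (4 * v / n%:R) (excess w) => *; lra.
Qed.

Let bust q : bdm (ust q).
Proof.
apply: (poly_bdm ms (k := n)); apply: poly_ustat => // a.
exact: (xi_bdm n0 mX mL mU mf f0 fv law a).
Qed.

Let bterm q : bdm (fun w => (2 * ust q w / n%:R ^+ 2) ^+ 4 / ((Dm q)%:R / (pi * n%:R)) ^+ 3).
Proof.
by do ![apply: bdmM|apply: bdmX|exact: bdm_cst|exact: bust].
Qed.

Let excessE : excess = fun w => 4 * v / n%:R + \sum_(j <- [seq j : 'I_n <- enum 'I_n | (2 ^ j <= n)%N])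
   (2 * ust (2 ^ j.+1) w / n%:R ^+ 2) ^+ 4 / ((Dm (2 ^ j.+1))%:R / (pi * n%:R)) ^+ 3.
Proof. by apply/funext => w; rewrite /excess big_filter big_enum_cond /=; congr (_ + _); apply: eq_bigl => j; rewrite inE. Qed.

Lemma excess_bdm : bdm excess.
Proof. by rewrite excessE; apply: bdmD; [exact: bdm_cst|apply: bdm_sum => j; exact: bterm]. Qed.

(** The order is [n^4 D^2 / n^8] times [n^3 / D^3], that is [1 / (n D)] with [D >= 2^j]. The part
    [n^3 B^3] of the fourth moment is brought to [n^4 D^2] by [D <= 5 n], which follows from
    [2^j <= n]. *)
Lemma mean_term j : (2 ^ j <= n)%N ->
  E (fun w => (2 * ust (2 ^ j.+1) w / n%:R ^+ 2) ^+ 4 / ((Dm (2 ^ j.+1))%:R / (pi * n%:R)) ^+ 3)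
  <= 16 * pi ^+ 3 * moment_cst v / n%:R * 2^-1 ^+ j.
Proof.
move=> jn; set q := (2 ^ j.+1)%N.
have pi0 : 0 < pi :> R by exact: pi_gt0.
have D1 : 1 <= (Dm q)%:R :> R by rewrite ler1n.
have D0 : 0 < (Dm q)%:R :> R by rewrite ltr0n.
have D5 : (Dm q)%:R <= 5 * n%:R :> R.
  by rewrite -natrM ler_nat /Dm /q expnS -muln2; move: jn n0; lia.
have Dj : 2 ^+ j <= (Dm q)%:R :> R.
  by rewrite -natrX ler_nat /Dm /q expnS -muln2; lia.
set D : R := (Dm q)%:R in D1 D0 D5 Dj *.
have := mean_ustat4_sample n0 mX mL mU mf f0 fv law q.
rewrite -/(ust q) -/D; set a := E (fun w => ust q w ^+ 4) => ha.
set B := D / pi + 4 * v in ha.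
pose b := 1 + 4 * v.
have b1 : 1 <= b by rewrite /b; have := v0; lra.
have B0 : 0 <= B by rewrite addr_ge0 ?divr_ge0 ?mulr_ge0// ltW.
have BD : B <= D * b.
  rewrite /B /b mulrDr mulr1 lerD//.
    by rewrite ler_pdivrMr// ler_peMr ?(ltW D0)//; have := pi_ge2 R; lra.
  by rewrite ler_peMl// mulr_ge0.
have B2 : B ^+ 2 <= D ^+ 2 * b ^+ 2.
  by rewrite -exprMn lerXn2r// nnegrE mulr_ge0 ?ltW// (lt_le_trans ltr01).
have B3 : n%:R ^+ 3 * B ^+ 3 <= n%:R ^+ 4 * (D ^+ 2 * (5 * b ^+ 3)).
  apply: (@le_trans _ _ (n%:R ^+ 3 * (D * b) ^+ 3)).
    rewrite ler_wpM2l ?exprn_ge0// lerXn2r// nnegrE mulr_ge0 ?ltW// (lt_le_trans ltr01)//.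
  have -> : n%:R ^+ 3 * (D * b) ^+ 3 = (n%:R ^+ 3 * (D ^+ 2 * b ^+ 3)) * D by ring.
  have -> : n%:R ^+ 4 * (D ^+ 2 * (5 * b ^+ 3)) = (n%:R ^+ 3 * (D ^+ 2 * b ^+ 3)) * (5 * n%:R) by ring.
  by rewrite ler_wpM2l// !mulr_ge0 ?exprn_ge0// ltW// (lt_le_trans ltr01).
have aC : a <= moment_cst v * (n%:R ^+ 4 * D ^+ 2).
  apply: le_trans ha _; rewrite /moment_cst -/b -[leRHS]mulrA ler_wpM2l ?expR_ge0// [leRHS]mulrDl.
  apply: lerD.
    have -> : 80 * ((4 * v) ^+ 2 * b ^+ 2) * (n%:R ^+ 4 * D ^+ 2) =
      80 * ((4 * v) ^+ 2 * n%:R ^+ 4 * (D ^+ 2 * b ^+ 2)) by ring.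
    by rewrite ler_wpM2l// ler_wpM2l// mulr_ge0// ?sqr_ge0// exprn_ge0.
  have -> : 15 * (4 * v * (5 * b ^+ 3)) * (n%:R ^+ 4 * D ^+ 2) =
    15 * (4 * v * (n%:R ^+ 4 * (D ^+ 2 * (5 * b ^+ 3)))) by ring.
  have -> : 15 * (4 * v * n%:R ^+ 3 * B ^+ 3) = 15 * (4 * v * (n%:R ^+ 3 * B ^+ 3)) by ring.
  by rewrite ler_wpM2l// ler_wpM2l// mulr_ge0.
have -> : E (fun w => (2 * ust q w / n%:R ^+ 2) ^+ 4 / (D / (pi * n%:R)) ^+ 3) =
    16 * pi ^+ 3 / (n%:R ^+ 5 * D ^+ 3) * a.
  rewrite -(bdm_RintegralZ measurableT Pfin); last by apply: bdmX; exact: bust.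
  apply: eq_Rintegral => w _; move: pi pi0 (ust q w) => p p0 u.
  by field; rewrite !gt_eqF.
apply: (@le_trans _ _ (16 * pi ^+ 3 / (n%:R ^+ 5 * D ^+ 3) * (moment_cst v * (n%:R ^+ 4 * D ^+ 2)))).
  by rewrite ler_wpM2l// divr_ge0 ?mulr_ge0 ?exprn_ge0// ltW.
have -> : 16 * pi ^+ 3 / (n%:R ^+ 5 * D ^+ 3) * (moment_cst v * (n%:R ^+ 4 * D ^+ 2)) =
    16 * pi ^+ 3 * moment_cst v / n%:R * D^-1.
  by move: pi pi0 => p p0; field; rewrite !gt_eqF.
have M0 : 0 <= moment_cst v.
  exact: moment_cst_ge0.
rewrite ler_wpM2l//; first last.
  by rewrite exprVn lef_pV2 ?posrE// exprn_gt0.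
apply: divr_ge0 => //; apply: mulr_ge0 => //; apply: mulr_ge0 => //.
exact/exprn_ge0/ltW.
Qed.

Lemma mean_excess : E excess <= excess_cst v / n%:R.
Proof.
have pi0 : 0 <= pi :> R by exact: pi_ge0.
have M0 : 0 <= moment_cst v.
  exact: moment_cst_ge0.
rewrite excessE (bdm_RintegralD measurableT Pfin); [|exact: bdm_cst|by apply: bdm_sum => j; exact: bterm].
rewrite mean_cst (bdm_Rintegral_sum measurableT Pfin); last by move=> j; exact: bterm.
rewrite big_filter big_enum_cond /=.
have C0 : 0 <= 16 * pi ^+ 3 * moment_cst v / n%:R.
  apply: divr_ge0 => //; apply: mulr_ge0 => //; apply: mulr_ge0 => //.
  exact: exprn_ge0.
apply: (@le_trans _ _ (4 * v / n%:R + 16 * pi ^+ 3 * moment_cst v / n%:R * \sum_(j < n) 2^-1 ^+ j)).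
  rewrite lerD2l mulr_sumr big_mkcond /=; apply: ler_sum => j _.
  by case: ifP => [/mean_term//|_]; rewrite mulr_ge0// exprn_ge0// invr_ge0.
rewrite /excess_cst [leRHS]mulrDl lerD2l.
have := ler_wpM2l C0 (@sum_half_le2 R n) => /le_trans; apply.
rewrite le_eqVlt; apply/orP; left; apply/eqP; ring.
Qed.

Variables (kappa s0 : R) (mhat : Om -> nat).
Hypothesis kappa32 : 32 <= kappa.
Hypotheses (s00 : 0 < s0) (nus0 : forall x, circ x -> (s0%:E <= sigma nu x)%E).
Hypothesis hmhat : forall w, Mn n (mhat w) /\
     forall m, Mn n m ->
       crit kappa n (X^~ w) (L^~ w) (U^~ w) (mhat w)
       <= crit kappa n (X^~ w) (L^~ w) (U^~ w) m.

(** [bad] is the sum of the Chernoff majorants over all cells: if it is below 1, so is each term,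
    and no frequency is too small. With [e = s0 / 4] the losses of the cell construction and of the
    deviation leave [s0 - 2 e = s0 / 2]. *)
Lemma bad_events : exists bad : Om -> R,
  [/\ bdm bad, forall w, 0 <= bad w,
     E bad <= (ncells s0)%:R * (24 ^+ 3 / (s0 / 4) ^+ 6) / n%:R ^+ 3 &
     forall w, bad w < 1 -> forall x, circ x -> s0 / 2 <= coverage n (L^~ w) (U^~ w) x].
Proof.
pose e := s0 / 4; pose N := (Num.trunc (8 / s0)).+1.
have e0 : 0 < e by rewrite divr_gt0.
have eN : 2 <= N%:R * e.
  have h : 8 / s0 <= N%:R by apply/ltW; exact: truncnS_gt.
  have -> : 2 = 8 / s0 * e :> R by rewrite /e; field; rewrite gt_eqF.
  by rewrite ler_wpM2r// ltW.
have es0 : e <= s0 by rewrite /e; move: s00; lra.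
have [B [mB pB covB]] := cells_exist e0 eN nus0.
pose A j := snd @^-1` B j : set (R * (R * R)).
have mA j : measurable (A j).
  by rewrite -[X in measurable X]setTI; exact: (measurable_snd measurableT (B j) (mB j)).
pose p j := fine (nu (B j)).
have EA j i : (i < n)%N -> E (fun w => \1_(A j) (sample i w)) = p j.
  move=> ni; rewrite -[LHS]/(E (\1_(LU i @^-1` B j))) mean_indic; last first.
    by rewrite -[X in measurable X]setTI; apply: (measurable_fun_pair (mL i) (mU i)).
  by rewrite (law_LU n0 mf f0 fv law ni (mB j)).
have p01 j : 0 <= p j <= 1.
  rewrite /p fine_ge0//= -lee_fin fineK; first exact: probability_le1.
  by apply: fin_num_measure.
have s01 : s0 <= 1.
  have c0 : circ (0 : R) by rewrite /circ /= in_itv /= lexx mulrn_wgt0// pi_gt0.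
  have [j _ _] := covB 0 c0.
  rewrite -lee_fin; apply: le_trans (nus0 c0) _; apply: probability_le1.
  have mp : measurable_fun setT (fun p : R * R => (0 : R, p)) by exact: measurable_fun_pair.
  by have := mp measurableT _ (@measurable_arc_set R); rewrite setTI.
have e1 : e <= 1 by apply: le_trans es0 s01.
have sind := sample_indep n0 mX mL mU mf f0 fv law.
pose ch j := chernoff_prod n sample (A j) (p j) e.
have bch j : bdm (ch j) by exact: (chernoff_prod_bdm n ms (p j) (mA j) e0).
have ch0 j w : 0 <= ch j w by exact: chernoff_prod_ge0.
exists (fun w => \sum_(j < ncells s0) ch j w); split.
- by apply: bdm_sum => j.
- by move=> w; exact: sumr_ge0.
- rewrite (bdm_Rintegral_sum measurableT Pfin)//.
  have chle j : E (ch j) <= 24 ^+ 3 / e ^+ 6 / n%:R ^+ 3.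
    apply: le_trans (chernoff_prod_le ms sind (mA j) (EA j) (p01 j) e0 e1) _.
    have y0 : 0 < n%:R * (e ^+ 2 / 8) by rewrite mulr_gt0// divr_gt0// exprn_gt0.
    apply: le_trans (expRN_le_cube y0) _.
    rewrite le_eqVlt; apply/orP; left; apply/eqP.
    by field; rewrite !gt_eqF.
  apply: le_trans (ler_sum _ (fun (j : 'I_(ncells s0)) _ => chle j)) _.
  by rewrite sumr_const card_ord -[leRHS]mulrA [leRHS]mulr_natl /e.
move=> w bad1 x cx; have [j jN Bj] := covB x cx.
have chj : ch j w < 1.
  apply: le_lt_trans bad1.
  have jN' : (j < ncells s0)%N by [].
  by rewrite (bigD1 (Ordinal jN'))//= lerDl sumr_ge0.
have h : p j - e < n%:R^-1 * (\sum_(i < n) \1_(A j) (sample i w)).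
  rewrite ltNge; apply/negP => hle.
  have := chernoff_prod_ge1 e0 hle n0.
  by rewrite leNgt => /negP; apply.
have h2 : n%:R^-1 * (\sum_(i < n) \1_(A j) (sample i w)) <= coverage n (L^~ w) (U^~ w) x.
  rewrite /coverage ler_wpM2l ?invr_ge0//; apply: ler_sum => i _.
  rewrite !indicE; have [hB|hB] := boolP (sample i w \in A j) => //.
  move: hB; rewrite inE => /Bj /= ha.
  by rewrite mem_set.
have := pB j; rewrite -/(p j) => h3.
apply/ltW/(lt_le_trans _ h2)/(le_lt_trans _ h).
by move: h3; rewrite /e; lra.
Qed.

Theorem oracle_bounded m : Mn n m ->
  (\int[P]_w (L2sq (fun x => ftilde n (X^~ w) (L^~ w) (U^~ w) (mhat w) x - f x))%:E <=
   (bias_cst s0 * (L2sq (fun x => f x - fproj f m x) + kappa * ((Dm m)%:R / n%:R)) +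
    rest_cst s0 v / n%:R)%:E)%E.
Proof.
move=> Mm; have [bad [bbad bad0 Ebad cov]] := bad_events.
pose s := s0 / 2; have s_gt0 : 0 < s by rewrite divr_gt0.
pose b := L2sq (fun x => f x - fproj f m x); pose k := kappa * ((Dm m)%:R / n%:R).
have b0 : 0 <= b by exact: L2sq_ge0.
have k0 : 0 <= k.
  by rewrite mulr_ge0 ?divr_ge0//; move: kappa32; lra.
have fL2 : L2sq f <= v := L2sq_density n0 mf f0 fv law.
pose cst := 3 / s * b + 4 / s ^+ 2 * k + 4 * v ^+ 2 / n%:R.
(* A majorant valid on both events: the oracle inequality bounds the loss where [bad w < 1], and
   elsewhere the last term alone exceeds the crude bound. *)
pose W w := cst + (8 / s ^+ 2 * excess w + (2 * n%:R ^+ 2 + 2 * v) * bad w).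
have bW : bdm W.
  apply: bdmD; first exact: bdm_cst.
  by apply: bdmD; apply: bdmZ => //; exact: excess_bdm.
have cst0 : 0 <= cst.
  apply: addr_ge0; last by apply: divr_ge0 => //; apply: mulr_ge0 => //; exact: sqr_ge0.
  apply: addr_ge0; apply: mulr_ge0 => //; apply: divr_ge0 => //; first exact: ltW.
  exact: sqr_ge0.
have ex0 w : 0 <= 8 / s ^+ 2 * excess w by rewrite mulr_ge0 ?excess_ge0// divr_ge0// sqr_ge0.
have n2v : 0 <= 2 * n%:R ^+ 2 + 2 * v by rewrite addr_ge0 ?mulr_ge0// sqr_ge0.
have FW w : L2sq (fun x => ftilde n (X^~ w) (L^~ w) (U^~ w) (mhat w) x - f x) <= W w.
  have [b1|b1] := ltP (bad w) 1; last first.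
    apply: le_trans (ftilde_L2_crude _ _ _ _ _ bf) _; rewrite /W.
    have := ler_wpM2l n2v b1; rewrite mulr1.
    by have := ex0 w; have := cst0; move: fL2; lra.
  have scov := cov w b1.
  have cL i : circ (L i w) by have [_ []] := XLU i w.
  have cU i : circ (U i w) by have [_ []] := XLU i w.
  have [Mh hh] := hmhat w.
  apply: le_trans (ftilde_L2 _ _ _ n0 bf (mhat w) fL2 v0) _.
  have := oracle_L2 n0 cL cU bf s_gt0 scov kappa32 (fun a => Icirc (fun y => f y * phi a y))
    (excess_ge0 w) (hh m Mm) (energy_excess w Mm) (energy_excess w Mh).
  rewrite -/(fproj f m) -/b -/k /W /cst => h.
  have := mulr_ge0 n2v (bad0 w); move: h.
  move: (4 * v ^+ 2 / n%:R) (8 / s ^+ 2 * excess w) (3 / s * _) (4 / s ^+ 2 * k) => *; lra.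
apply: (@le_trans _ _ (\int[P]_w (W w)%:E)%E).
  apply: ge0_le_integral_nonmeas => w; rewrite lee_fin; first exact: L2sq_ge0.
  exact: FW.
rewrite (bdm_integralE measurableT Pfin bW) lee_fin /W.
rewrite (bdm_RintegralD measurableT Pfin); last 2 first.
- exact: bdm_cst.
- by apply: bdmD; apply: bdmZ => //; exact: excess_bdm.
rewrite mean_cst (bdm_RintegralD measurableT Pfin); last 2 first.
- by apply: bdmZ; exact: excess_bdm.
- exact: bdmZ.
rewrite (bdm_RintegralZ measurableT Pfin _ excess_bdm) (bdm_RintegralZ measurableT Pfin _ bbad).
have t1 : 8 / s ^+ 2 * E excess <= 8 / s ^+ 2 * (excess_cst v / n%:R).
  by rewrite ler_wpM2l ?mean_excess// divr_ge0// sqr_ge0.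
pose Q := (ncells s0)%:R * (24 ^+ 3 / (s0 / 4) ^+ 6).
have Q0 : 0 <= Q.
  by apply: mulr_ge0; [exact: ler0n|apply: divr_ge0; apply: exprn_ge0 => //; apply: divr_ge0 => //; exact: ltW].
have t2 : (2 * n%:R ^+ 2 + 2 * v) * E bad <= Q * (2 + 2 * v) / n%:R.
  apply: (@le_trans _ _ ((2 * n%:R ^+ 2 + 2 * v * n%:R ^+ 2) * (Q / n%:R ^+ 3))).
    apply: ler_pM => //; first by apply: Rintegral_ge0 => w _; exact: bad0.
    by rewrite lerD2l ler_peMr ?mulr_ge0// expr2 (le_trans N1)// ler_peMr.
  rewrite le_eqVlt; apply/orP; left; apply/eqP.
  by field; rewrite gt_eqF.
have t3 : 3 / s * b + 4 / s ^+ 2 * k <= bias_cst s0 * (b + k).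
  rewrite /bias_cst -/s; have h1 : 0 <= 3 / s by rewrite divr_ge0// ltW.
  have h2 : 0 <= 4 / s ^+ 2 by rewrite divr_ge0// sqr_ge0.
  by have := mulr_ge0 h1 k0; have := mulr_ge0 h2 b0; rewrite mulrDl !mulrDr; lra.
have t4 : rest_cst s0 v / n%:R = 8 / s ^+ 2 * (excess_cst v / n%:R) + 4 * v ^+ 2 / n%:R + Q * (2 + 2 * v) / n%:R.
  by rewrite /rest_cst -/s -/Q; ring.
rewrite t4 /cst -/b -/k; move: t1 t2 t3.
move: (8 / s ^+ 2 * _) (8 / s ^+ 2 * _) (_ * E bad) (Q * _ / _) (bias_cst _ * _) => *; lra.
Qed.

End bounded_density.

(** * Essentially bounded densities *)

Section essential_bound.
Variables (R : realType) (f : R -> R).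
Hypotheses (mf : measurable_fun setT f) (f0 : forall x, 0 <= f x).
Hypothesis supf : (supnorm f < +oo)%E.

(** Equal to [f] almost everywhere on the circle, so the law, the projections and the losses are
    unchanged, while the bound by [|f|_oo] becomes pointwise. *)
Definition truncated_density x := Num.min (f x) (fine (supnorm f)).

Lemma supnorm_ge0 : (0 <= supnorm f)%E.
Proof.
apply: ess_sup_gee; last by apply: aeW => x; rewrite lee_fin; case: ifP.
apply: (@lt_le_trans _ _ (lebesgue_measure (circ : set R))).
  by rewrite leb_circ lte_fin mulrn_wgt0// pi_gt0.
by apply: le_measure => //; rewrite inE//; exact: measurable_circ.
Qed.

Lemma truncated_density_ae : ae_eq (@lebesgue_measure R) circ f truncated_density.
Proof.
have := ess_sup_ge (@lebesgue_measure R)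
  (fun x => (if `[< circ x >] then `|f x| else 0)%:E).
rewrite -/(supnorm f); apply: filterS => x h cx; rewrite /truncated_density.
move: h; rewrite asboolT// ger0_norm// -(fineK (x := supnorm f)); last first.
  by rewrite ge0_fin_numE ?supnorm_ge0.
by rewrite lee_fin => h; rewrite min_l.
Qed.

Lemma measurable_truncated_density : measurable_fun setT truncated_density.
Proof. exact: measurable_minr. Qed.

Lemma truncated_density_ge0 x : 0 <= truncated_density x.
Proof. by rewrite le_min f0 fine_ge0// supnorm_ge0. Qed.

Lemma truncated_density_le x : truncated_density x <= fine (supnorm f).
Proof. by rewrite ge_min lexx orbT. Qed.

Lemma integral_truncated_density A : measurable A ->
  (\int[leb]_(x in A `&` circ) (f x)%:E = \int[leb]_(x in A `&` circ) (truncated_density x)%:E)%E.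
Proof.
move=> mA; apply: (@ae_eq_integral _ _ _ (@lebesgue_measure R)).
- by apply: measurableI => //; exact: measurable_circ.
- by apply/measurable_EFinP; exact: measurable_funS mf.
- by apply/measurable_EFinP; exact: measurable_funS measurable_truncated_density.
by move: truncated_density_ae; apply: filterS => x h [_ cx]; rewrite h.
Qed.

Lemma Icirc_truncated (G : R -> R -> R) :
  measurable_fun setT (fun x => G x (f x)) ->
  measurable_fun setT (fun x => G x (truncated_density x)) ->
  Icirc (fun x => G x (f x)) = Icirc (fun x => G x (truncated_density x)).
Proof.
move=> m1 m2; congr fine; apply: (@ae_eq_integral _ _ _ (@lebesgue_measure R)).
- exact: measurable_circ.
- by apply/measurable_EFinP; exact: measurable_funS m1.
- by apply/measurable_EFinP; exact: measurable_funS m2.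
by move: truncated_density_ae; apply: filterS => x h cx; rewrite h.
Qed.

Lemma L2sqB_truncated g : bdm g ->
  L2sq (fun x => g x - f x) = L2sq (fun x => g x - truncated_density x).
Proof.
move=> [mg _]; apply: (Icirc_truncated (G := fun x y => (g x - y) ^+ 2)).
  by apply: measurable_funX; exact: measurable_funB.
by apply: measurable_funX; apply: measurable_funB => //; exact: measurable_truncated_density.
Qed.

Lemma fproj_truncated m : fproj f m = fproj truncated_density m.
Proof.
apply/funext => x; apply: eq_bigr => a _; congr (_ * _).
have [mp _] := phi_bdm R a.
apply: (Icirc_truncated (G := fun x y => y * phi a x)); apply: measurable_funM => //.
exact: measurable_truncated_density.
Qed.

Lemma L2sq_bias_truncated m : L2sq (fun x => f x - fproj f m x) =
  L2sq (fun x => truncated_density x - fproj truncated_density m x).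
Proof.
have bp : bdm (fproj f m) by exact: (trigpoly_bdm m (fun a => Icirc (fun y => f y * phi a y))).
rewrite -fproj_truncated.
have swap g h : L2sq (fun x : R => g x - h x) = L2sq (fun x => h x - g x).
  by apply: eq_Icirc => x _; ring.
by rewrite swap L2sqB_truncated// swap.
Qed.

End essential_bound.

Theorem theorem3 (R : realType) (kappa : R) :
  32 < kappa ->
  exists (K : R -> R) (Kt : R -> R -> R),
  forall (d : measure_display) (Omega : measurableType d)
    (P : probability Omega R) (n : nat) (X L U : nat -> Omega -> R)
    (f : R -> R) (nu : probability (R * R)%type R) (sigma0 : R)
    (mhat : Omega -> nat),
  (4 <= n)%N ->
  (forall i, measurable_fun setT (X i)) ->
  (forall i, measurable_fun setT (L i)) ->
  (forall i, measurable_fun setT (U i)) ->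
  (forall i w, circ (X i w) /\ circ (L i w) /\ circ (U i w)) ->
  measurable_fun setT f -> (forall x, 0 <= f x) ->
  (* (X_i, L_i, U_i), i < n, are i.i.d., X_i has density f on the circle,
     (L_i, U_i) has law nu, and X_i is independent of (L_i, U_i) *)
  (forall (A : nat -> set R) (B : nat -> set (R * R)%type),
     (forall i, measurable (A i)) -> (forall i, measurable (B i)) ->
     P (\bigcap_(i in `I_n) [set w | A i (X i w) /\ B i (L i w, U i w)]) =
     (\prod_(i < n) ((\int[leb]_(x in A i `&` circ) (f x)%:E) * nu (B i)))%E) ->
  nu [set p | p.1 = p.2] = 0%E ->
  (supnorm f < +oo)%E ->
  0 < sigma0 -> (forall x, circ x -> (sigma0%:E <= sigma nu x)%E) ->
  (forall k, measurable (mhat @^-1` [set k])) ->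
  (forall w, Mn n (mhat w) /\
     forall m, Mn n m ->
       crit kappa n (X^~ w) (L^~ w) (U^~ w) (mhat w)
       <= crit kappa n (X^~ w) (L^~ w) (U^~ w) m) ->
  (\int[P]_w
     (L2sq (fun x => ftilde n (X^~ w) (L^~ w) (U^~ w) (mhat w) x - f x))%:E
   <= (K sigma0 *
         inf [set L2sq (fun x => f x - fproj f m x) + kappa * ((Dm m)%:R / n%:R)
             | m in Mn n]
       + Kt sigma0 (fine (supnorm f)) / n%:R)%:E)%E.
Proof.
move=> kappa32; exists (@bias_cst R), (@rest_cst R).
move=> d Omega P n X L U f nu s0 mhat n4 mX mL mU XLU mf f0 law _ supf s00 nus0 _ hmhat.
have n0 : (0 < n)%N by exact: leq_trans n4.
set I := (\int[P]_w _)%E; set v := fine (supnorm f).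
have law' (A : nat -> set R) (B : nat -> set (R * R)%type) :
    (forall i, measurable (A i)) -> (forall i, measurable (B i)) ->
    P (\bigcap_(i in `I_n) [set w | A i (X i w) /\ B i (L i w, U i w)]) =
    (\prod_(i < n) ((\int[leb]_(x in A i `&` circ) (truncated_density f x)%:E) * nu (B i)))%E.
  move=> mA mB; rewrite law//; apply: eq_bigr => i _.
  by rewrite (integral_truncated_density mf f0 supf (mA i)).
have bound m : Mn n m -> (I <= (bias_cst s0 *
    (L2sq (fun x => f x - fproj f m x) + kappa * ((Dm m)%:R / n%:R)) + rest_cst s0 v / n%:R)%:E)%E.
  move=> Mm; rewrite (L2sq_bias_truncated mf f0 supf).
  have -> : I = (\int[P]_w
     (L2sq (fun x => ftilde n (X^~ w) (L^~ w) (U^~ w) (mhat w) x - truncated_density f x))%:E)%E.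
    apply: eq_integral => w _; congr EFin; apply: L2sqB_truncated => //.
    exact: ftilde_bdm.
  apply: (oracle_bounded n0 mX mL mU XLU (measurable_truncated_density mf)
    (truncated_density_ge0 f0) (truncated_density_le f) law' (ltW kappa32) s00 nus0 hmhat Mm).
(* From [4 <= n]. The bound at this model makes [I] finite, and the infimum is taken over a nonempty
   set. *)
have M1 : Mn n 1 by split => //; move: n4; lia.
have I0 : (0 <= I)%E by apply: integral_ge0 => w _; rewrite lee_fin L2sq_ge0.
have Ifin : I \is a fin_num.
  by rewrite ge0_fin_numE//; apply: le_lt_trans (bound 1%N M1) _; rewrite ltry.
have K0 : 0 < bias_cst s0.
  have h : 0 < s0 / 2 by rewrite divr_gt0.
  by rewrite /bias_cst addr_gt0// divr_gt0// exprn_gt0.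
(* Isolating the infimum, with a positive factor, leaves a lower bound to be checked at each [m]. *)
rewrite -(fineK Ifin) lee_fin -lerBlDr -ler_pdivrMl//.
apply: lb_le_inf.
  by exists (L2sq (fun x => f x - fproj f 1 x) + kappa * ((Dm 1)%:R / n%:R)); exists 1%N.
move=> _ [m Mm <-]; rewrite ler_pdivrMl// lerBlDr -lee_fin (fineK Ifin).
exact: bound.
Qed.
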